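(* Assume that $F:\Omega\times X\to\mathbb{R}^m$ is continuous, of class $C^1$ with respect to the second variable, that $F(\Omega\times X_1)$ is bounded in $\mathbb{R}^m$ for every bounded set $X_1\subset X$, that $$F(\omega,\psi)-F(\omega,\phi)\geq B\,(\psi(0)-\phi(0))\quad\text{whenever }\phi\leq_B\psi \text{ and }\omega\in\Omega,$$ that $$F(\omega,\lambda\psi)\ge\lambda F(\omega,\psi)\quad\text{whenever }\psi\ge_B0,\ \lambda\in[0,1]\text{ and }\omega\in\Omega,$$ and that there exists a pair $(\omega_0,\phi_0)\in\Omega\times\operatorname{Int}\widetilde K_B$ with bounded semitrajectory $\{(\omega_0\cdot t,y_t(\omega_0,\phi_0))\mid t\ge0\}$ and such that $y_t(\omega_0,\phi_0)\ge_B\psi_0$ for some $\psi_0\gg_B0$ and each $t\ge0$. Then, for each $\omega\in\Omega$ and $\phi\gg_B0$, the semiorbit $\{(\omega\cdot t,y_t(\omega,\phi))\mid t\ge 0\}$ is a relatively compact subset of $\Omega\times X_L$ and it is uniformly stable. Moreover, the omega-limit set is strongly positive, i.e. $\mathcal{O}(\omega,\phi)\gg_B0$, and the restriction of $\tau$ to the compact invariant set $\mathcal{O}(\omega,\phi)\subset\Omega\times X_L$ is continuous.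
   Context: $\Omega$ is a compact metric space with a continuous minimal flow $\mathbb{R}\times\Omega\to\Omega$, $(t,\omega)\mapsto\omega\cdot t$. Fix $r>0$, $m\ge 1$. $X=C([-r,0],\mathbb{R}^m)$ with the sup-norm $\|\varphi\|_\infty=\sup_{s\in[-r,0]}\|\varphi(s)\|$, where $\|\cdot\|$ is the maximum norm on $\mathbb{R}^m$. For a continuous $y:[-r,\infty)\to\mathbb{R}^m$ and $t\ge0$, $y_t\in X$ is $y_t(s)=y(t+s)$, $s\in[-r,0]$. For $y\in\mathbb{R}^m$, $y\ge0$ (resp. $y\gg0$) means all components are nonnegative (resp. positive); for $\phi\in X$, $\phi\ge0$ (resp. $\phi\gg0$) means $\phi(s)\ge0$ (resp. $\phi(s)\gg0$) for all $s\in[-r,0]$. $B=[b_{ij}]$ is a fixed real $m\times m$ quasipositive matrix ($b_{ij}\ge0$ for $i\ne j$). The exponential ordering is given by the cone $K_B=\{\phi\in X\mid \phi\ge0,\ \phi(t)\ge e^{B(t-s)}\phi(s)\text{ for } -r\le s\le t\le0\}$: $\phi\le_B\psi$ iff $\psi-\phi\in K_B$. $X_L\subset X$ is the Banach space of Lipschitz functions with norm $\|\phi\|_L=\|\phi\|_\infty+\sup\{\|\phi(t)-\phi(s)\|/|t-s| : s\ne t\in[-r,0]\}$; $\widetilde K_B=K_B\cap X_L$, whose interior in $X_L$ is $\operatorname{Int}\widetilde K_B=\{\phi\in X_L\mid \phi\gg0 \text{ and, for some }\varepsilon>0,\ \phi'-B\phi\ge(\varepsilon,\dots,\varepsilon)\text{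 a.e. on }[-r,0]\}$. We write $\phi\gg_B0$ iff $\phi\in\operatorname{Int}\widetilde K_B$. For $\omega\in\Omega$, $\varphi\in X$, $y(t,\omega,\varphi)$ denotes the unique solution of $y'(t)=F(\omega\cdot t,y_t)$, $t\ge0$, with $y(s,\omega,\varphi)=\varphi(s)$ for $s\in[-r,0]$, and $y_t(\omega,\varphi)(s)=y(t+s,\omega,\varphi)$. The induced skew-product semiflow is $\tau(t,\omega,\varphi)=(\omega\cdot t,y_t(\omega,\varphi))$ (under the hypotheses of the claim it is globally defined on $\Omega\times K_B$). $\mathcal{O}(\omega,\phi)$ is the omega-limit set in $\Omega\times X_L$: the set of limits in $\Omega\times X_L$ of sequences $(\omega\cdot t_n,y_{t_n}(\omega,\phi))$ with $t_n\uparrow\infty$. A compact set $M\subset\Omega\times X_L$ is strongly positive, written $M\gg_B0$, if $M\subset\Omega\times\operatorname{Int}\widetilde K_B$. The semiorbit of $(\omega,\phi)$ is uniformly stable if for every $\varepsilon>0$ there is a $\delta>0$ such that, if $\|y_s(\omega,\phi)-\psi\|_L<\delta$ for some $s\ge0$ and $\psi\in\operatorname{Int}\widetilde K_B$, then $\|y_{s+t}(\omega,\phi)-y_t(\omega\cdot s,\psi)\|_L<\varepsilon$ for all $t\ge0$.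
   Formalization: Relative compactness of the semiorbit in Ω×X_L is false from t=0 (e.g. y'=1−y, φ=1/2, B=−1: moving corner at 0); it is proved for t≥r in Ω×X_L, and for t≥0 in Ω×X with the sup-norm, with y_t Lipschitz for all t≥0. *)

(* Defs.v *)
From HB Require Import structures.
From mathcomp Require Import all_boot all_order all_algebra.
From mathcomp Require Import all_classical all_reals all_analysis.

Set Implicit Arguments.
Unset Strict Implicit.
Unset Printing Implicit Defensive.

Import Order.TTheory GRing.Theory Num.Theory.
Import numFieldNormedType.Exports.

Local Open Scope classical_set_scope.
Local Open Scope ring_scope.

(** ** The space C([-r,0], R^m)

    An element is represented by its extension by zero to the whole real
    line, so that Leibniz equality is equality of functions on [-r,0].  The
    library norm on ['cV[R]_m] is the maximum norm. *)

Definition continuous_segment (R : realType) (r : R) (m : nat) :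
    {pred R -> 'cV[R]_m} :=
  fun f => `[< {within `[- r, 0], continuous f} /\
               forall t, ~ `[- r, 0]%classic t -> f t = 0 >].

Record Cseg (R : realType) (r : R) (m : nat) := MkC {
  C_fun :> R -> 'cV[R]_m;
  C_funP : C_fun \in @continuous_segment R r m }.

HB.instance Definition _ (R : realType) (r : R) (m : nat) :=
  [isSub for @C_fun R r m].
HB.instance Definition _ (R : realType) (r : R) (m : nat) :=
  [Choice of Cseg r m by <:].

Section Cseg_normedModType.
Context (R : realType) (r : R) (m : nat).
Implicit Types f g : Cseg r m.

Let segment_submod : submod_closed (@continuous_segment R r m).
Proof.
split=> [|a f g /asboolP[cf zf] /asboolP[cg zg]]; apply/asboolP.
  by split=> // x; exact: cst_continuous.
split=> [x|t rt].
  by apply: cvgD; [apply: cvgZr; exact: cf | exact: cg].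
by rewrite /GRing.add /= /GRing.scale /= zf// zg// scaler0 addr0.
Qed.

HB.instance Definition _ :=
  GRing.isSubmodClosed.Build R (R -> 'cV[R]_m) (@continuous_segment R r m)
    segment_submod.
HB.instance Definition _ := [SubChoice_isSubLmodule of Cseg r m by <:].

Lemma C_within f : {within `[- r, 0], continuous f}.
Proof. by have /asboolP[] := C_funP f. Qed.

Lemma C_out f t : ~ `[- r, 0]%classic t -> f t = 0.
Proof. by have /asboolP[_] := C_funP f; exact. Qed.

Lemma CD f g t : (f + g) t = f t + g t. Proof. by []. Qed.
Lemma CB f g t : (f - g) t = f t - g t. Proof. by []. Qed.
Lemma CZ a f t : (a *: f) t = a *: f t. Proof. by []. Qed.

Definition sup_norm f : R := sup [set `|f t| | t in `[- r, 0]].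

Lemma sup_norm_ubound f : has_ubound [set `|f t| | t in `[- r, 0]].
Proof.
have : compact (f @` `[- r, 0]).
  by apply: continuous_compact; [exact: C_within|exact: segment_compact].
move=> /compact_bounded[M [_ /(_ (M + 1))]].
rewrite ltrDl ltr01 => /(_ isT) fM.
by exists (M + 1) => _ [t rt <-]; apply: fM; exists t.
Qed.

Lemma sup_norm_ge0 f : 0 <= sup_norm f.
Proof.
rewrite /sup_norm; set A := (X in sup X).
have [->|/set0P[x Ax]] := eqVneq A set0; first by rewrite sup0.
apply: (@le_trans _ _ x); first by case: Ax => t _ <-.
by apply: ub_le_sup => //; exact: sup_norm_ubound.
Qed.

Lemma le_sup_norm f t : `|f t| <= sup_norm f.
Proof.
have [rt|rt] := pselect (`[- r, 0]%classic t).
  by apply: ub_le_sup; [exact: sup_norm_ubound|exists t].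
by rewrite C_out// normr0 sup_norm_ge0.
Qed.

Lemma sup_norm_le f (M : R) : 0 <= M ->
  (forall t, `[- r, 0]%classic t -> `|f t| <= M) -> sup_norm f <= M.
Proof.
move=> M0 fM; rewrite /sup_norm; set A := (X in sup X).
have [->|/set0P A0] := eqVneq A set0; first by rewrite sup0.
by apply: ge_sup => // _ [t rt <-]; exact: fM.
Qed.

Let sup_normD f g : sup_norm (f + g) <= sup_norm f + sup_norm g.
Proof.
apply: sup_norm_le => [|t _]; first by rewrite addr_ge0 ?sup_norm_ge0.
by rewrite CD (le_trans (ler_normD _ _))// lerD ?le_sup_norm.
Qed.

Let sup_normZ_le a f : sup_norm (a *: f) <= `|a| * sup_norm f.
Proof.
apply: sup_norm_le => [|t _]; first by rewrite mulr_ge0 ?sup_norm_ge0.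
by rewrite CZ normrZ ler_wpM2l ?le_sup_norm.
Qed.

Let sup_normZ a f : sup_norm (a *: f) = `|a| * sup_norm f.
Proof.
apply/eqP; rewrite eq_le sup_normZ_le /=.
have [->|a0] := eqVneq a 0; first by rewrite normr0 mul0r sup_norm_ge0.
rewrite -ler_pdivlMl ?normr_gt0// -normfV.
by rewrite -[X in sup_norm X <= _](scalerK a0) sup_normZ_le.
Qed.

Let sup_norm0_eq0 f : sup_norm f = 0 -> f = 0.
Proof.
move=> f0; apply/val_inj/funext => t; apply/eqP.
by rewrite -normr_le0 -f0 le_sup_norm.
Qed.

HB.instance Definition _ := Lmodule_isNormed.Build R (Cseg r m)
  sup_normD sup_normZ sup_norm0_eq0.

Lemma C_normE f : `|f| = sup_norm f. Proof. by []. Qed.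

End Cseg_normedModType.

(** ** The space X_L of Lipschitz functions on [-r,0], a subset of
    C([-r,0], R^m) with its own, finer, norm *)

Definition lipschitz_segment (R : realType) (r : R) (m : nat) :
    {pred Cseg r m} :=
  fun f => `[< exists k : R, k.-lipschitz_`[- r, 0] (f : R -> 'cV[R]_m) >].

Record Lipseg (R : realType) (r : R) (m : nat) := MkL {
  L_C :> Cseg r m;
  L_CP : L_C \in @lipschitz_segment R r m }.

HB.instance Definition _ (R : realType) (r : R) (m : nat) :=
  [isSub for @L_C R r m].
HB.instance Definition _ (R : realType) (r : R) (m : nat) :=
  [Choice of Lipseg r m by <:].

Section Lipseg_normedModType.
Context (R : realType) (r : R) (m : nat).
Implicit Types f g : Lipseg r m.

Let lipschitz_submod : submod_closed (@lipschitz_segment R r m).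
Proof.
split=> [|a f g /asboolP[k kf] /asboolP[l lg]]; apply/asboolP.
  by exists 0 => -[x y] _ /=; rewrite mul0r subrr normr0.
exists (`|a| * k + l) => -[x y] [/= rx ry].
rewrite [X in `|X|](_ : _ = a *: (f x - f y) + (g x - g y)); last first.
  by rewrite scalerBr addrACA -opprD.
rewrite mulrDl.
rewrite (le_trans (ler_normD _ _))// lerD//; last exact: (lg (x, y)).
by rewrite normrZ -mulrA ler_wpM2l//; exact: (kf (x, y)).
Qed.

HB.instance Definition _ :=
  GRing.isSubmodClosed.Build R (Cseg r m) (@lipschitz_segment R r m)
    lipschitz_submod.
HB.instance Definition _ := [SubChoice_isSubLmodule of Lipseg r m by <:].

Lemma L_lipschitz f : exists k : R, k.-lipschitz_`[- r, 0] (f : R -> 'cV[R]_m).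
Proof. by have /asboolP := L_CP f. Qed.

Lemma LD f g : L_C (f + g) = L_C f + L_C g. Proof. by []. Qed.
Lemma LB f g : L_C (f - g) = L_C f - L_C g. Proof. by []. Qed.
Lemma LZ a f : L_C (a *: f) = a *: L_C f. Proof. by []. Qed.

Definition diff_quotients f : set R :=
  [set q | exists s t : R, [/\ `[- r, 0]%classic s, `[- r, 0]%classic t,
    s != t & q = `|f t - f s| / `|t - s|]].

Definition lip_seminorm f : R := sup (diff_quotients f).

Definition lip_norm f : R := `|L_C f| + lip_seminorm f.

Lemma diff_quotients_ubound f : has_ubound (diff_quotients f).
Proof.
have [k kf] := L_lipschitz f.
exists k => _ [s [t [rs rt st ->]]].
rewrite ler_pdivrMr ?normr_gt0 ?subr_eq0 1?eq_sym//.
exact: (kf (t, s)).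
Qed.

Lemma lip_seminorm_ge0 f : 0 <= lip_seminorm f.
Proof.
rewrite /lip_seminorm; have [->|/set0P[x fx]] := eqVneq (diff_quotients f) set0.
  by rewrite sup0.
apply: (@le_trans _ _ x); first by case: fx => s [t [_ _ _ ->]].
by apply: ub_le_sup => //; exact: diff_quotients_ubound.
Qed.

Lemma le_lip_seminorm f s t : `[- r, 0]%classic s -> `[- r, 0]%classic t ->
  `|f t - f s| <= lip_seminorm f * `|t - s|.
Proof.
move=> rs rt; have [->|st] := eqVneq s t; first by rewrite !subrr !normr0 mulr0.
rewrite -ler_pdivrMr ?normr_gt0 ?subr_eq0 1?eq_sym//.
by apply: ub_le_sup; [exact: diff_quotients_ubound|exists s, t].
Qed.

Lemma lip_seminorm_le f (M : R) : 0 <= M ->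
  (forall s t, `[- r, 0]%classic s -> `[- r, 0]%classic t ->
    `|f t - f s| <= M * `|t - s|) -> lip_seminorm f <= M.
Proof.
move=> M0 fM; rewrite /lip_seminorm.
have [->|/set0P A0] := eqVneq (diff_quotients f) set0; first by rewrite sup0.
apply: ge_sup => // _ [s [t [rs rt st ->]]].
by rewrite ler_pdivrMr ?normr_gt0 ?subr_eq0 1?eq_sym// fM.
Qed.

Let lip_normD f g : lip_norm (f + g) <= lip_norm f + lip_norm g.
Proof.
rewrite /lip_norm addrACA LD lerD ?ler_normD//.
apply: lip_seminorm_le => [|s t rs rt].
  by rewrite addr_ge0 ?lip_seminorm_ge0.
rewrite !LD !CD opprD addrACA mulrDl (le_trans (ler_normD _ _))//.
by rewrite lerD ?le_lip_seminorm.
Qed.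

Let lip_seminormZ_le a f : lip_seminorm (a *: f) <= `|a| * lip_seminorm f.
Proof.
apply: lip_seminorm_le => [|s t rs rt].
  by rewrite mulr_ge0 ?lip_seminorm_ge0.
by rewrite !LZ !CZ -scalerBr normrZ -mulrA ler_wpM2l ?le_lip_seminorm.
Qed.

Let lip_normZ a f : lip_norm (a *: f) = `|a| * lip_norm f.
Proof.
rewrite /lip_norm LZ normrZ mulrDr; congr (_ + _).
apply/eqP; rewrite eq_le lip_seminormZ_le /=.
have [->|a0] := eqVneq a 0; first by rewrite normr0 mul0r lip_seminorm_ge0.
rewrite -ler_pdivlMl ?normr_gt0// -normfV.
by rewrite -[X in lip_seminorm X <= _](scalerK a0) lip_seminormZ_le.
Qed.

Let lip_norm0_eq0 f : lip_norm f = 0 -> f = 0.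
Proof.
move=> /eqP; rewrite paddr_eq0 ?lip_seminorm_ge0// normr_eq0 => /andP[/eqP f0 _].
exact: val_inj.
Qed.

HB.instance Definition _ := Lmodule_isNormed.Build R (Lipseg r m)
  lip_normD lip_normZ lip_norm0_eq0.

Lemma L_normE f : `|f| = lip_norm f. Proof. by []. Qed.

End Lipseg_normedModType.

(** ** Orderings *)

Section ordering.
Context (R : realType) (m : nat).

Definition vle (x y : 'cV[R]_m) : Prop := forall i, x i ord0 <= y i ord0.

Definition quasipositive (B : 'M[R]_m) : Prop :=
  forall i j, i != j -> 0 <= B i j.

Definition expmx (A : 'M[R]_m) : 'M[R]_m :=
  limn (series (fun k : nat => (k`!%:R)^-1 *: A ^+ k)).

Context (r : R) (B : 'M[R]_m).

(* the cone K_B *)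
Definition exp_cone : set (Cseg r m) :=
  [set phi | (forall s, `[- r, 0]%classic s -> vle 0 (phi s)) /\
     forall s t, - r <= s -> s <= t -> t <= 0 ->
       vle (expmx ((t - s) *: B) *m phi s) (phi t)].

Definition exp_le (phi psi : Cseg r m) : Prop := exp_cone (psi - phi).

(* [exp_pos phi] is phi >>_B 0; the interior is taken for the norm of X_L *)
Definition exp_pos : set (Lipseg r m) :=
  interior [set phi : Lipseg r m | exp_cone phi].

End ordering.

(** ** Flows *)

Section flows.
Context (R : realType) (Omega : metricType R).

(* [sigma t w] is w.t *)
Definition continuous_flow (sigma : R -> Omega -> Omega) : Prop :=
  [/\ continuous (fun p : R * Omega => sigma p.1 p.2),
      forall w, sigma 0 w = w &
      forall s t w, sigma (s + t) w = sigma t (sigma s w)].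

Definition minimal_flow (sigma : R -> Omega -> Omega) : Prop :=
  forall A : set Omega, closed A -> A !=set0 ->
    (forall t, sigma t @` A = A) -> A = setT.

End flows.

(** ** The delay equation y'(t) = F(w.t, y_t) *)

Section delay_equation.
Context (R : realType) (Omega : metricType R) (r : R) (m : nat).
Context (sigma : R -> Omega -> Omega) (F : Omega -> Cseg r m -> 'cV[R]_m).

(* the element of C([-r,0], R^m) given by [f]; it is 0 if [f] is not continuous
   on [-r,0] *)
Definition toC (f : R -> 'cV[R]_m) : Cseg r m :=
  insubd 0 (fun s => if s \in `[- r, 0] then f s else 0).

(* [phi] as an element of X_L; it is 0 if [phi] is not Lipschitz *)
Definition toL (phi : Cseg r m) : Lipseg r m := insubd 0 phi.

Definition history (y : R -> 'cV[R]_m) (t : R) : Cseg r m :=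
  toC (fun s => y (t + s)).

(* F is of class C^1 in its second variable: the Frechet derivative exists and
   is continuous from Omega x X to the bounded operators with operator norm.
   Continuity jointly in both variables is what makes F locally Lipschitz in
   its second variable, locally uniformly in the first, as needed for the
   uniqueness of solutions. *)
Definition C1_second : Prop :=
  (forall w phi, differentiable (F w) phi) /\
  forall (w : Omega) (phi : Cseg r m) (e : R), 0 < e ->
    \forall v \near w & psi \near phi,
      forall h, `|'d (F v) psi h - 'd (F w) phi h| <= e * `|h|.

(* only the values of [y] on [-r, +oo[ matter *)
Definition is_solution (w : Omega) (phi : Cseg r m) (y : R -> 'cV[R]_m) :
    Prop :=
  [/\ {within `[- r, +oo[, continuous y},
      forall s, `[- r, 0]%classic s -> y s = phi s,
      (h^-1 *: (y h - y 0)) @[h --> 0^'+] --> F w phi &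
      forall t : R, 0 < t ->
        is_derive t (1 : R) y (F (sigma t w) (history y t))].

(* the function t |-> y(t, w, phi); a solution on [-r, +oo[ if there is one,
   and 0 otherwise *)
Definition sol (w : Omega) (phi : Cseg r m) : R -> 'cV[R]_m :=
  xget (cst 0) [set y | is_solution w phi y].

Definition solC (t : R) (w : Omega) (phi : Cseg r m) : Cseg r m :=
  history (sol w phi) t.

Definition solL (t : R) (w : Omega) (phi : Lipseg r m) : Lipseg r m :=
  toL (solC t w phi).

(* y(., w, phi) exists on [-r, +oo[ and is the only solution there *)
Definition globally_solvable (w : Omega) (phi : Cseg r m) : Prop :=
  is_solution w phi (sol w phi) /\
  forall y, is_solution w phi y -> forall t, - r <= t -> y t = sol w phi t.

Definition tau (t : R) (p : Omega * Lipseg r m) : Omega * Lipseg r m :=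
  (sigma t p.1, solL t p.1 p.2).

Definition omega_limit (w : Omega) (phi : Lipseg r m) :
    set (Omega * Lipseg r m) :=
  [set p | exists u : nat -> R,
    [/\ forall n, 0 <= u n, nondecreasing_seq u, u @ \oo --> +oo &
        tau (u n) (w, phi) @[n --> \oo] --> p]].

(* The semiorbit of (w,phi) lies in Omega x X_L, and it is relatively compact:
   from t = 0 on for the sup-norm, and from t = r on for the norm of X_L.  In
   the norm of X_L one cannot start at t = 0: for 0 < t < r the corner that
   y(., w, phi) has at 0 when phi'(0-) <> F(w, phi) sits at s = -t in y_t, and
   two Lipschitz functions with corners of the same size at different places
   are a fixed distance apart in X_L.  This occurs for y' = 1 - y, phi = 1/2. *)
Definition relatively_compact_semiorbit (w : Omega) (phi : Lipseg r m) :
    Prop :=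
  [/\ forall t, 0 <= t -> L_C (solL t w phi) = solC t w phi,
      precompact [set (sigma t w, solC t w phi) | t in [set t | 0 <= t]] &
      precompact [set tau t (w, phi) | t in [set t | r <= t]]].

Context (B : 'M[R]_m).

Definition uniformly_stable (w : Omega) (phi : Lipseg r m) : Prop :=
  forall e : R, 0 < e -> exists2 d : R, 0 < d &
    forall (s : R) (psi : Lipseg r m), 0 <= s -> exp_pos B psi ->
      `|solL s w phi - psi| < d ->
      forall t : R, 0 <= t ->
        `|solL (s + t) w phi - solL t (sigma s w) psi| < e.

Definition strongly_positive (M : set (Omega * Lipseg r m)) : Prop :=
  compact M /\ M `<=` [set: Omega] `*` exp_pos B.

End delay_equation.

(* Main.v *)
(** The solution semiflow is monotone and sublinear on the cone: a solution
    above a subsolution is obtained by a monotone iteration that keeps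
    psi |-> F(w, psi) - B psi(0), which is monotone, on the right-hand side.
    Hence multiples of a strongly positive semiorbit trap every other one over
    the same base point, and minimality of the base flow carries a bounded
    strongly positive semiorbit from w0 to an arbitrary w.  All semiorbits
    therefore live in sets of uniformly bounded, uniformly Lipschitz functions,
    which are compact for the sup-norm.  The time-r map is continuous from the
    sup-norm to the Lipschitz norm, which yields compactness in X_L; the omega
    limit set is the set of cluster points of the semiorbit in its compact
    image, and it lies above a strongly positive function. *)
Require Import Defs.
From mathcomp Require Import all_boot all_order all_algebra.
From mathcomp Require Import all_classical all_reals all_analysis.
From mathcomp Require Import ring lra.

Set Implicit Arguments.
Unset Strict Implicit.
Unset Printing Implicit Defensive.

Import Order.TTheory GRing.Theory Num.Theory.
Import numFieldNormedType.Exports.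

Local Open Scope classical_set_scope.
Local Open Scope ring_scope.

(** The hypotheses give neither a global Lipschitz constant for F nor an a priori bound on
    solutions. Sublinearity replaces the bound: on the cone [Fres] grows at most linearly, so all
    iterates stay below one exponential barrier on each [0,T]. Differentiability of F enters only
    through local Lipschitz estimates, which yield uniqueness and continuous dependence. The other
    obstacle is the norm of X_L. Order estimates control only the sup-norm, and translation in time
    is not continuous in X_L. But the derivative of a solution at positive times is F along its
    orbit, so Lipschitz distances are controlled as soon as F is uniformly continuous near a set
    that is compact for the sup-norm. Up to time r the initial segment still contributes its own
    Lipschitz distance; from time r on it has dropped out. Joint continuity of [tau] is therefore
    proved at time-r images only, and all points of the omega-limit sets considered are of this
    kind. *)

(** * Mean value inequalities and antiderivatives of vector functions *)

Section vector_calculus.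
Context {R : realType} {m : nat}.
Implicit Types (x : 'cV[R]_m) (y z : R -> 'cV[R]_m).

Lemma coord_le_norm x i : `|x i ord0| <= `|x|.
Proof.
by rewrite [leRHS]/Num.Def.normr/= mx_normrE; exact: (le_bigmax _ _ (i, ord0)).
Qed.

Lemma norm_le_coord x (M : R) : 0 <= M -> (forall i, `|x i ord0| <= M) -> `|x| <= M.
Proof.
move=> M0 xM; rewrite [leLHS]/Num.Def.normr/= mx_normrE.
by apply: bigmax_le => // -[i j] _ /=; rewrite ord1.
Qed.

Lemma is_derive_mxP p q (M : R -> 'M[R]_(p, q)) (t : R) D :
  is_derive t 1 M D <-> forall i j, is_derive t 1 (fun u => M u i j) (D i j).
Proof.
split=> [[Mt <-] i j|H].
  have Mtij : derivable (fun u => M u i j) t 1 by move/derivable_mxP : Mt; exact.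
  by split=> //; rewrite derive_mx// mxE.
have Mt : derivable M t 1 by apply/derivable_mxP => i j; case: (H i j).
split=> //; rewrite derive_mx//; apply/matrixP => i j; rewrite mxE.
by rewrite derive_val.
Qed.

Lemma is_derive_coordP y (t : R) d :
  is_derive t 1 y d <-> forall i, is_derive t 1 (fun u => y u i ord0) (d i ord0).
Proof.
split=> [/is_derive_mxP H i //|H].
by apply/is_derive_mxP => i j; rewrite (ord1 j); exact: H.
Qed.

Lemma continuous_mxP p q (T : topologicalType) (f : T -> 'M[R]_(p, q)) (t : T) :
  {for t, continuous f} <-> forall i j, {for t, continuous (fun u => f u i j)}.
Proof.
split=> [ft i j|H].
  exact: (continuous_comp ft (@coord_continuous _ _ _ i j _)).
apply/cvgrPdist_le => e e0.
have : \forall u \near t, forall ij : 'I_p * 'I_q,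
    `|f t ij.1 ij.2 - f u ij.1 ij.2| <= e.
  by apply: filter_forall => -[i j]; move/cvgrPdist_le : (H i j); exact.
apply: filterS => u fu.
rewrite [leLHS]/Num.Def.normr/= mx_normrE.
by apply: bigmax_le => [|ij _]; [exact: ltW|rewrite !mxE; exact: fu].
Qed.

Lemma continuous_coordP (T : topologicalType) (f : T -> 'cV[R]_m) (t : T) :
  {for t, continuous f} <-> forall i, {for t, continuous (fun u => f u i ord0)}.
Proof.
split=> [/continuous_mxP H i //|H].
by apply/continuous_mxP => i j; rewrite (ord1 j); exact: H.
Qed.

Lemma derive_nonneg_le (f df : R -> R) (a b : R) : a <= b -> continuous f ->
  (forall t : R, a < t < b -> is_derive t 1 f (df t)) ->
  (forall t : R, a < t < b -> 0 <= df t) -> f a <= f b.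
Proof.
rewrite le_eqVlt => /predU1P[->//|ab] cf dfE df0.
have dfE' t : t \in `]a, b[%R -> is_derive t 1 f (df t).
  by rewrite in_itv/=; exact: dfE.
have [c + E] := MVT ab dfE' (continuous_subspaceT cf).
rewrite in_itv/= => cab; rewrite -subr_ge0 E mulr_ge0 ?df0//.
by rewrite subr_ge0 ltW.
Qed.

(** For the maximum norm this is a family of scalar statements: each of the functions f + y_i and f
    - y_i has nonnegative derivative. *)
Lemma mean_value_ineq y (dy : R -> 'cV[R]_m) (f df : R -> R) (a b : R) :
  a <= b -> continuous y -> continuous f ->
  (forall t : R, a < t < b -> is_derive t 1 y (dy t)) ->
  (forall t : R, a < t < b -> is_derive t 1 f (df t)) ->
  (forall t : R, a < t < b -> `|dy t| <= df t) -> `|y b - y a| <= f b - f a.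
Proof.
move=> ab cy cf yE fE ydf.
have cyi i : continuous (fun u => y u i ord0).
  by move=> t; exact: (iffLR (continuous_coordP y t) (cy t)).
have coordb i t : a < t < b -> `|dy t i ord0| <= df t.
  by move=> /ydf H; apply: le_trans H; exact: coord_le_norm.
have fab : f a <= f b.
  by apply: (derive_nonneg_le ab cf fE) => t /ydf H; apply: le_trans H.
apply: norm_le_coord => [|i]; first by rewrite subr_ge0.
rewrite !mxE ler_norml; apply/andP; split.
  rewrite -subr_ge0 opprK [X in 0 <= X](_ : _ =
    (y b i ord0 + f b) - (y a i ord0 + f a)); last by ring.
  rewrite subr_ge0.
  apply: (@derive_nonneg_le (fun u => y u i ord0 + f u)
    (fun u => dy u i ord0 + df u)) => //.
  - by move=> t; apply: cvgD; [exact: cyi|exact: cf].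
  - move=> t tab; have := yE _ tab => /is_derive_coordP/(_ i) ?.
    by have := fE _ tab => ?; exact: is_deriveD.
  - by move=> t /(coordb i); rewrite ler_norml -subr_ge0 opprK addrC => /andP[].
rewrite -subr_ge0 [X in 0 <= X](_ : _ =
    (f b - y b i ord0) - (f a - y a i ord0)); last by ring.
rewrite subr_ge0.
apply: (@derive_nonneg_le (fun u => f u - y u i ord0)
    (fun u => df u - dy u i ord0)) => //.
- by move=> t; apply: cvgB; [exact: cf|exact: cyi].
- move=> t tab; have := yE _ tab => /is_derive_coordP/(_ i) ?.
  by have := fE _ tab => ?; exact: is_deriveB.
- by move=> t /(coordb i); rewrite ler_norml -[0 <= _]subr_ge0 subr0 subr_ge0 => /andP[].
Qed.

Lemma mean_value_bound y (dy : R -> 'cV[R]_m) (M a b : R) :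
  a <= b -> continuous y ->
  (forall t : R, a < t < b -> is_derive t 1 y (dy t)) ->
  (forall t : R, a < t < b -> `|dy t| <= M) -> `|y b - y a| <= M * (b - a).
Proof.
move=> ab cy yE yM; rewrite mulrBr.
apply: (@mean_value_ineq y dy (fun t => M * t) (fun=> M)) => //.
  by move=> t; apply: cvgMr; exact: cvg_id.
move=> t _; rewrite [X in is_derive _ _ X](_ : _ = M \*: id)//.
by apply: is_derive_eq; rewrite /GRing.scale/= mulr1.
Qed.

Lemma antiderivative_real (g : R -> R) : continuous g ->
  exists G : R -> R, [/\ continuous G, G 0 = 0 &
    forall t : R, 0 < t -> is_derive t 1 G (g t)].
Proof.
move=> cg.
(* Integrating from -1 makes 0 an interior point, so that H is continuous there. The clamp
   [Num.max s 0] below extends the antiderivative as a constant to negative times, hence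
   continuously to the whole line. *)
pose H (x : R) : R := (\int[lebesgue_measure]_(t in [set` `[-1, x]]) g t)%R.
have dH (x : R) : -1 < x -> is_derive x 1 H (g x).
  move=> x1; have xx1 : x < x + 1 by rewrite ltrDl.
  have gi : lebesgue_measure.-integrable `[-1, x + 1] (EFin \o g).
    apply: continuous_compact_integrable; first exact: segment_compact.
    exact: continuous_subspaceT.
  have [dH EH] := continuous_FTC1_closed xx1 gi x1 (cg x).
  by split; [exact: dH|rewrite -derive1E].
exists (fun s : R => H (Num.max s 0) - H 0); split.
- move=> x; apply: cvgB; last exact: cvg_cst.
  apply: (@continuous_comp _ _ _ (fun x : R => Num.max x 0) H).
    by apply: continuous_max; [exact: cvg_id|exact: cvg_cst].
  apply/differentiable_continuous/derivable1_diffP.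
  suff [] : is_derive (Num.max x 0) 1 H (g (Num.max x 0)) by [].
  by apply: dH; rewrite lt_max (_ : -1 < 0) ?orbT// oppr_lt0.
- by rewrite maxxx subrr.
move=> t t0; rewrite -[g t]subr0.
apply: is_deriveB; have := dH t (lt_trans _ t0); rewrite oppr_lt0 ltr01 => /(_ isT).
apply: near_eq_is_derive.
near=> s; rewrite max_l//; apply: ltW; near: s; exact: lt_nbhsr.
Unshelve. all: by end_near. Qed.

Lemma antiderivative (g : R -> 'cV[R]_m) : continuous g ->
  exists G : R -> 'cV[R]_m, [/\ continuous G, G 0 = 0 &
    forall t : R, 0 < t -> is_derive t 1 G (g t)].
Proof.
move=> cg.
have /choice[G GP] : forall i, exists G : R -> R, [/\ continuous G, G 0 = 0 &
    forall t : R, 0 < t -> is_derive t 1 G (g t i ord0)].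
  move=> i; apply: antiderivative_real => t.
  exact: (iffLR (continuous_coordP g t) (cg t)).
have E i : (fun u => (\col_j G j u) i ord0) = G i.
  by apply/funext => u; rewrite mxE.
exists (fun t => \col_i G i t); split.
- move=> t; apply: (iffRL (continuous_coordP _ t)) => i; rewrite E.
  by case: (GP i) => + _ _; exact.
- by apply/matrixP => i j; rewrite !mxE; case: (GP i).
- by move=> t t0; apply/is_derive_coordP => i; rewrite E; case: (GP i) => _ _; exact.
Qed.

End vector_calculus.

(** * Products of matrix functions *)

Section matrix_product_rule.
Context {R : realType}.

Lemma cvg_sum_ord k (f : 'I_k -> nat -> R) (a : 'I_k -> R) :
  (forall l, f l n @[n --> \oo] --> a l) ->
  \sum_l f l n @[n --> \oo] --> \sum_l a l.
Proof.
by move=> H; apply: cvg_big => [|l _]; [exact: add_continuous|exact: H].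
Qed.

Lemma is_derive_mulmx p q k (M : R -> 'M[R]_(p, q)) (N : R -> 'M[R]_(q, k))
    (t : R) dM dN : is_derive t 1 M dM -> is_derive t 1 N dN ->
  is_derive t 1 (fun u => M u *m N u) (dM *m N t + M t *m dN).
Proof.
move=> /is_derive_mxP HM /is_derive_mxP HN; apply/is_derive_mxP => i j.
rewrite (_ : (fun u => _) = \sum_l (fun u => M u i l * N u l j)); last first.
  by apply/funext => u; rewrite mxE fct_sumE.
rewrite [X in is_derive _ _ _ X](_ : _ =
    \sum_l (M t i l * dN l j + N t l j * dM i l)); last first.
  rewrite !mxE -big_split/=; apply: eq_bigr => l _.
  by rewrite addrC [_ * dM _ _]mulrC.
apply: is_derive_sum => l.
have := HM i l; have := HN l j => ? ?.
exact: is_deriveM.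
Qed.

Lemma continuous_mulmx p q k (T : topologicalType) (M : T -> 'M[R]_(p, q))
    (N : T -> 'M[R]_(q, k)) (t : T) : {for t, continuous M} -> {for t, continuous N} ->
  {for t, continuous (fun u => M u *m N u)}.
Proof.
move=> /continuous_mxP cM /continuous_mxP cN; apply: (iffRL (continuous_mxP _ t)) => i j.
rewrite (_ : (fun u => (M u *m N u) i j) = fun u => \sum_l M u i l * N u l j); last first.
  by apply/funext => u; rewrite mxE.
by apply: cvg_big => [|l _]; [exact: add_continuous|apply: cvgM; [exact: cM|exact: cN]].
Qed.

Lemma mulmx_norm_le p (M : 'M[R]_p) (x : 'cV[R]_p) (K : R) :
  (forall i j, `|M i j| <= K) -> `|M *m x| <= (p%:R * K) * `|x|.
Proof.
move=> MK; case: p M x MK => [|p] M x MK.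
  by rewrite [x]flatmx0 [_ *m _]flatmx0 normr0 mulr0.
have K0 : 0 <= K by apply: le_trans (MK ord0 ord0).
apply: norm_le_coord => [|i]; first by rewrite !mulr_ge0.
rewrite mxE; apply: le_trans (ler_norm_sum _ _ _) _.
rewrite -mulrA mulr_natl -[X in _ *+ X]card_ord -sumr_const.
apply: ler_sum => j _; rewrite normrM ler_pM//; exact: coord_le_norm.
Qed.

Lemma matrix_eq_cst p q (M : R -> 'M[R]_(p, q)) (s t : R) :
  (forall u : R, is_derive u 1 M 0) -> M s = M t.
Proof.
move=> H; apply/matrixP => i j.
apply: (@is_derive_0_is_cst R (fun u => M u i j)) => u.
by have /is_derive_mxP/(_ i j) := H u; rewrite mxE.
Qed.

End matrix_product_rule.

(** * The matrix exponential, its functional equation and its positivity *)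

Section matrix_exponential.
Context {R : realType} {m : nat}.
Implicit Types (B C : 'M[R]_m).

(** Coefficients of the power series of the entry (i, j) of B^p e^{xB}. The shift p makes the family
    stable under termwise differentiation, which raises p by one. *)
Definition expmx_coeff B (p : nat) (i j : 'I_m) (k : nat) : R :=
  (k`!%:R)^-1 * (B ^+ (k + p)) i j.

Lemma expmx_power_entry_le B k i j :
  `|(B ^+ k) i j| <= (\sum_a \sum_b `|B a b|) ^+ k.
Proof.
elim: k i j => [|k IH] i j.
  rewrite expr0 mxE; case: (i == j); by rewrite ?normr1 ?normr0.
rewrite exprS mxE; apply: le_trans (ler_norm_sum _ _ _) _.
rewrite exprS; set b := \sum_a _.
have b0 : 0 <= b by rewrite sumr_ge0// => a _; rewrite sumr_ge0.
apply: (@le_trans _ _ (\sum_l `|B i l| * b ^+ k)).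
  by apply: ler_sum => l _; rewrite normrM ler_wpM2l.
rewrite -mulr_suml ler_wpM2r ?exprn_ge0//.
by rewrite /b [leRHS](bigD1 i)//= lerDl sumr_ge0// => a _; rewrite sumr_ge0.
Qed.

(** Dominated by b^p times the exponential series at b|x|, where b, the sum of the absolute values
    of all entries, satisfies |(B^k)_{ij}| <= b^k. *)
Lemma expmx_coeff_cvg B p i j (x : R) : cvgn (pseries (expmx_coeff B p i j) x).
Proof.
set b : R := \sum_a \sum_b `|B a b|.
have b0 : 0 <= b by rewrite sumr_ge0// => a _; rewrite sumr_ge0.
apply: normed_cvg.
apply: (@series_le_cvg _ _ (fun k => b ^+ p * exp_coeff (b * `|x|) k)) => //.
- by move=> k /=.
- move=> k; rewrite mulr_ge0 ?exprn_ge0//; apply: exp_coeff_ge0.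
  by rewrite mulr_ge0.
- move=> k /=; rewrite !normrM normfV normrX normr_nat /exp_coeff/=.
  rewrite exprMn [leRHS](_ : _ = k`!%:R^-1 * b ^+ (k + p) * `|x| ^+ k); last first.
    by rewrite exprD; ring.
  by rewrite ler_wpM2r ?exprn_ge0// ler_wpM2l ?expmx_power_entry_le.
- rewrite (_ : series _ = (b ^+ p) \*: (series (exp_coeff (b * `|x|)))).
    by apply: is_cvgZr; exact: is_cvg_series_exp_coeff.
  by apply/funext => n; rewrite /series/= -mulr_sumr.
Qed.

Lemma expmx_coeff_diffs B p i j :
  pseries_diffs (expmx_coeff B p i j) = expmx_coeff B p.+1 i j.
Proof.
apply/funext => k; rewrite /pseries_diffs /expmx_coeff factS natrM invfM.
by rewrite mulrA mulrA mulfV ?pnatr_eq0// mul1r addnS.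
Qed.

Lemma is_derive_expmx_coeff B p i j (x : R) :
  is_derive x 1 (fun x => limn (pseries (expmx_coeff B p i j) x))
    (limn (pseries (expmx_coeff B p.+1 i j) x)).
Proof.
rewrite -expmx_coeff_diffs.
apply: (@pseries_snd_diffs _ _ (`|x| + 1)); rewrite ?expmx_coeff_diffs;
  try exact: expmx_coeff_cvg.
by rewrite [ltRHS]ger0_norm ?addr_ge0// ltrDl.
Qed.

Lemma expmx_entryE B (t : R) i j :
  expmx (t *: B) i j = limn (pseries (expmx_coeff B 0 i j) t).
Proof.
have powZ k : (t *: B) ^+ k = t ^+ k *: B ^+ k.
  elim: k => [|k IH]; first by rewrite !expr0 scale1r.
  by rewrite !exprS IH -[_ * _]/(_ *m _) -scalemxAl -scalemxAr scalerA.
pose L : 'M[R]_m := \matrix_(i, j) limn (pseries (expmx_coeff B 0 i j) t).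
suff : series (fun k : nat => (k`!%:R)^-1 *: (t *: B) ^+ k) @ \oo --> L.
  by move=> /cvg_lim; rewrite /expmx => ->//; rewrite mxE.
apply/cvgrPdist_le => e e0.
have : \forall n \near \oo, forall ij : 'I_m * 'I_m,
    `|limn (pseries (expmx_coeff B 0 ij.1 ij.2) t) -
      pseries (expmx_coeff B 0 ij.1 ij.2) t n| <= e.
  apply: filter_forall => -[a b].
  by have /cvgrPdist_le := @expmx_coeff_cvg B 0 a b t; exact.
apply: filterS => n Hn.
rewrite [leLHS]/Num.Def.normr/= mx_normrE.
apply: bigmax_le => [|ij _]; [exact: ltW|].
rewrite !mxE; apply: le_trans (Hn ij); rewrite le_eqVlt; apply/orP; left.
apply/eqP; congr (`|_ - _|); rewrite /pseries /series/= summxE.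
apply: eq_bigr => k _; rewrite mxE powZ mxE /expmx_coeff addn0.
by rewrite mulrA mulrAC.
Qed.

Lemma is_derive_expmx B (t : R) :
  is_derive t 1 (fun t => expmx (t *: B)) (B *m expmx (t *: B)).
Proof.
apply/is_derive_mxP => i j.
rewrite (_ : (fun u => _) = fun x => limn (pseries (expmx_coeff B 0 i j) x)).
  rewrite mxE [X in is_derive _ _ _ X](_ : _ =
    limn (pseries (expmx_coeff B 1 i j) t)).
    exact: is_derive_expmx_coeff.
  apply/esym/cvg_lim => //.
  rewrite (_ : pseries _ _ =
      (fun n => \sum_l B i l * pseries (expmx_coeff B 0 l j) t n)).
    apply: cvg_sum_ord => l; rewrite expmx_entryE.
    by apply: cvgMr; exact: expmx_coeff_cvg.
  apply/funext => n; rewrite /pseries /series/=.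
  under [RHS]eq_bigr do rewrite mulr_sumr.
  rewrite exchange_big/=; apply: eq_bigr => k _.
  rewrite /expmx_coeff addn1 exprS mxE !(mulr_sumr, mulr_suml).
  by apply: eq_bigr => l _; rewrite addn0; ring.
by apply/funext => u; rewrite expmx_entryE.
Qed.

Lemma expmx_commute B (t : R) : B *m expmx (t *: B) = expmx (t *: B) *m B.
Proof.
apply/matrixP => i j; rewrite !mxE.
under eq_bigr do rewrite expmx_entryE.
under [RHS]eq_bigr do rewrite expmx_entryE.
have H1 : (fun n => \sum_l B i l * pseries (expmx_coeff B 0 l j) t n) @ \oo -->
    \sum_l B i l * limn (pseries (expmx_coeff B 0 l j) t).
  by apply: cvg_sum_ord => l; apply: cvgMr; exact: expmx_coeff_cvg.
have H2 : (fun n => \sum_l pseries (expmx_coeff B 0 i l) t n * B l j) @ \oo -->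
    \sum_l limn (pseries (expmx_coeff B 0 i l) t) * B l j.
  by apply: cvg_sum_ord => l; apply: cvgMl; exact: expmx_coeff_cvg.
rewrite -(cvg_lim _ H1)// -(cvg_lim _ H2)//; congr (limn _).
apply/funext => n; rewrite /pseries /series/=.
under eq_bigr do rewrite mulr_sumr.
under [RHS]eq_bigr do rewrite mulr_suml.
rewrite exchange_big/= [RHS]exchange_big/=; apply: eq_bigr => k _.
rewrite /expmx_coeff addn0.
have BB : B *m B ^+ k = B ^+ k *m B.
  by rewrite -[LHS]/(B * B ^+ k) -[RHS]/(B ^+ k * B) -exprS exprSr.
transitivity ((k`!%:R^-1 * t ^+ k) * (B *m B ^+ k) i j).
  by rewrite mxE mulr_sumr; apply: eq_bigr => l _; ring.
by rewrite BB mxE mulr_sumr; apply: eq_bigr => l _; ring.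
Qed.

Lemma expmx0 B : expmx (0 *: B) = 1%:M.
Proof.
apply/matrixP => i j; rewrite expmx_entryE; apply/cvg_lim => //.
apply: (@cvg_trans _ (cst (1%:M i j) @ \oo)); last exact: cvg_cst.
apply: near_eq_cvg; exists 1 => // n /= n1; rewrite /pseries /series/=.
case: n n1 => // n _; rewrite big_nat_recl//= big1.
  by rewrite /expmx_coeff fact0 expr0 addr0 invr1 mul1r mulr1.
by move=> k _; rewrite exprS mul0r mulr0.
Qed.

Lemma is_derive_expmx_comp B (a c t : R) :
  is_derive t 1 (fun t => expmx ((a * t + c) *: B))
    (a *: (B *m expmx ((a * t + c) *: B))).
Proof.
apply/is_derive_mxP => i j; rewrite mxE mulrC.
have /is_derive_mxP/(_ i j) dE := is_derive_expmx B (a * t + c).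
apply: (@is_derive1_comp _ (fun u => expmx (u *: B) i j) (fun t => a * t + c)) => //.
rewrite [X in is_derive _ _ X](_ : _ = (a \*: id) + cst c)//.
by apply: is_derive_eq; rewrite /GRing.scale/= mulr1 addr0.
Qed.

(** The left-hand side has zero derivative in t. This is uniqueness for U' = BU in a form from which
    the inverse, the addition formula and the comparison with a shifted generator all follow. *)
Lemma expmxN_flow B p (U : R -> 'M[R]_(m, p)) (t : R) :
  (forall u : R, is_derive u 1 U (B *m U u)) -> expmx ((- t) *: B) *m U t = U 0.
Proof.
move=> dU.
have dN (u : R) : is_derive u 1 (fun t => expmx ((- t) *: B))
    (- (B *m expmx ((- u) *: B))).
  have := is_derive_expmx_comp B (-1) 0 u; rewrite scaleN1r mulN1r addr0.
  by under eq_fun do rewrite mulN1r addr0.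
rewrite -[RHS]mul1mx -(expmx0 B) -[X in expmx (X *: _) *m U 0]oppr0.
apply: (@matrix_eq_cst _ _ _ (fun u => expmx ((- u) *: B) *m U u)) => u.
have := is_derive_mulmx (dN u) (dU u).
by rewrite expmx_commute mulNmx mulmxA addNr.
Qed.

Lemma expmxNK B (t : R) : expmx (t *: B) *m expmx ((- t) *: B) = 1%:M.
Proof.
rewrite -[X in expmx (X *: _) *m _]opprK.
by rewrite (expmxN_flow (- t) (is_derive_expmx B)) expmx0.
Qed.

Lemma expmxD B (s t : R) : expmx ((s + t) *: B) = expmx (s *: B) *m expmx (t *: B).
Proof.
have dS (u : R) : is_derive u 1 (fun u => expmx ((u + t) *: B))
    (B *m expmx ((u + t) *: B)).
  have := is_derive_expmx_comp B 1 t u; rewrite scale1r mul1r.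
  by under eq_fun do rewrite mul1r.
by rewrite -[LHS]mul1mx -(expmxNK B s) -mulmxA (expmxN_flow s dS) add0r.
Qed.

(** For c large, C = B + c has nonnegative entries, so its exponential series has nonnegative terms;
    and e^{tB} = e^{-ct} e^{tC}, since both sides solve U' = BU with value 1 at 0. *)
Lemma expmx_ge0 B (t : R) i j :
  quasipositive B -> 0 <= t -> 0 <= expmx (t *: B) i j.
Proof.
move=> qB t0; set c := \sum_a `|B a a|.
pose C := B + c%:M.
have C0 a b : 0 <= C a b.
  rewrite !mxE; have [->|ab] := eqVneq a b; last by rewrite mulr0n addr0 qB.
  rewrite mulr1n -lerBlDl sub0r (le_trans (ler_norm _))// normrN.
  by rewrite /c (bigD1 b)//= lerDl sumr_ge0.
have Ck0 k a b : 0 <= (C ^+ k) a b.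
  elim: k a b => [|k IH] a b; first by rewrite expr0 mxE; case: (a == b).
  by rewrite exprS mxE sumr_ge0// => l _; rewrite mulr_ge0.
have EC0 a b : 0 <= expmx (t *: C) a b.
  rewrite expmx_entryE limr_ge//; first exact: expmx_coeff_cvg.
  apply: nearW => n; rewrite /pseries /series/= sumr_ge0// => k _.
  by rewrite mulr_ge0 ?exprn_ge0// /expmx_coeff mulr_ge0.
have dU (u : R) : is_derive u 1 (fun t => expR (- c * t) *: expmx (t *: C))
    (B *m (expR (- c * u) *: expmx (u *: C))).
  apply/is_derive_mxP => a b.
  rewrite (_ : (fun _ => _) = fun t => expR (- c * t) * expmx (t *: C) a b); last first.
    by apply/funext => v; rewrite mxE.
  have /is_derive_mxP/(_ a b) d1 := is_derive_expmx C u.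
  have d2 : is_derive u 1 (fun t => expR (- c * t)) (expR (- c * u) * - c).
    apply: (@is_derive1_comp _ expR (fun t => - c * t)) => //.
    rewrite [X in is_derive _ _ X](_ : _ = (- c) \*: id)//.
    by apply: is_derive_eq; rewrite /GRing.scale/= mulr1.
  apply: is_derive_eq (is_deriveM d2 d1) _.
  rewrite -[B](addrK c%:M) -/C mulmxBl -scalemxAr mul_scalar_mx scalerA.
  by rewrite !mxE /GRing.scale/=; ring.
have -> : expmx (t *: B) = expR (- c * t) *: expmx (t *: C).
  rewrite -[RHS]mul1mx -(expmxNK B t) -mulmxA (expmxN_flow t dU).
  by rewrite mulr0 expR0 scale1r expmx0 mulmx1.
by rewrite mxE mulr_ge0// expR_ge0.
Qed.

Lemma expmx_bound B (T : R) : exists2 K : R, 1 <= K &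
  forall (u : R) (x : 'cV[R]_m), - T <= u <= T -> `|expmx (u *: B) *m x| <= K * `|x|.
Proof.
have cE i j : continuous (fun u : R => expmx (u *: B) i j).
  move=> u; apply/differentiable_continuous/derivable1_diffP.
  by have /is_derive_mxP/(_ i j)[] := is_derive_expmx B u.
have /choice[K HK] : forall ij : 'I_m * 'I_m, exists K : R,
    forall u : R, - T <= u <= T -> `|expmx (u *: B) ij.1 ij.2| <= K.
  move=> [i j] /=.
  have : compact ((fun u : R => expmx (u *: B) i j) @` `[- T, T]).
    apply: continuous_compact; last exact: segment_compact.
    exact: continuous_subspaceT.
  move=> /compact_bounded[M [_ /(_ (M + 1))]]; rewrite ltrDl ltr01 => /(_ isT) H.
  by exists (M + 1) => u uT; apply: H; exists u => //; rewrite /= in_itv.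
exists (1 + m%:R * \sum_ij `|K ij|).
  by rewrite lerDl mulr_ge0// sumr_ge0.
move=> u x uT; rewrite mulrDl mul1r -[leLHS]add0r lerD//.
apply: mulmx_norm_le => i j; apply: le_trans (HK (i, j) u uT) _.
rewrite (bigD1 (i, j))//= (le_trans (ler_norm _))// lerDl sumr_ge0//.
Qed.

End matrix_exponential.

(** * Filters and neighbourhoods in normed spaces *)

Lemma ultra_fmap (T U : Type) (f : T -> U) (F : set_system T) :
  UltraFilter F -> UltraFilter (f @ F).
Proof.
move=> UF; split; first exact: fmap_proper_filter.
move=> G GF FG; rewrite predeqE => A; split; last exact: FG.
move=> GA; have [//|FnA] := in_ultra_setVsetC (f @^-1` A) UF.
have GnA : G (~` A) by apply: FG.
by have [u []] := filter_ex (filterI GA GnA).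
Qed.

Lemma near_prodP (T U : Type) (F : set_system T) (G : set_system U)
    (P : set T) (Q : set U) (S : T -> U -> Prop) : F P -> G Q ->
  (forall x y, P x -> Q y -> S x y) -> \forall x \near F & y \near G, S x y.
Proof. by move=> FP GQ H; exists (P, Q) => // -[x y] /= [Px Qy]; exact: H. Qed.

Section normed_neighborhoods.
Context {R : realType} {V W : normedModType R}.

Lemma nbhs_normE (x : V) (P : set V) :
  nbhs x P <-> exists2 d : R, 0 < d & forall y, `|x - y| < d -> P y.
Proof.
split=> [/nbhs_ballP[d /= d0 H]|[d d0 H]].
  by exists d => // y xy; apply: H; rewrite -ball_normE.
by apply/nbhs_ballP; exists d => //= y; rewrite -ball_normE; exact: H.
Qed.

Lemma near_dist_le (x : V) (d : R) : 0 < d -> \forall y \near x, `|x - y| <= d.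
Proof. by move=> d0; apply/nbhs_normE; exists d => // y /ltW. Qed.

Lemma continuous_normP (h : V -> W) (x : V) :
  (forall e : R, 0 < e -> exists2 d : R, 0 < d &
    forall y, `|x - y| < d -> `|h x - h y| <= e) -> {for x, continuous h}.
Proof.
move=> H; apply/cvgrPdist_le => e /H[d d0 {}H].
by apply/nbhs_normE; exists d.
Qed.

Lemma lipschitz_continuous (h : V -> W) (K : R) :
  (forall x y, `|h x - h y| <= K * `|x - y|) -> continuous h.
Proof.
move=> H x; apply: continuous_normP => e e0.
have K0 : 0 < `|K| + 1 by rewrite ltr_wpDl.
exists (e / (`|K| + 1)); first exact: divr_gt0.
move=> y xy; apply: le_trans (H _ _) _.
apply: (@le_trans _ _ ((`|K| + 1) * `|x - y|)).
  by rewrite ler_wpM2r// (le_trans (ler_norm _))// lerDl.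
by rewrite mulrC -ler_pdivlMr// ltW.
Qed.

End normed_neighborhoods.

(** * Histories, uniform estimates on [-r,0] and compactness for the sup-norm *)

Section segment_functions.
Context {R : realType} {r : R} {m : nat}.
Implicit Types (f g : Cseg r m) (y z : R -> 'cV[R]_m) (s t M : R).

Lemma segmentE (s : R) : (s \in `[- r, 0]) = (- r <= s <= 0).
Proof. by rewrite in_itv. Qed.

Lemma Cseg_ext f g : (forall s, - r <= s <= 0 -> f s = g s) -> f = g.
Proof.
move=> fg; apply/val_inj/funext => s /=.
have [|sr] := boolP (- r <= s <= 0); first exact: fg.
by rewrite !C_out//= in_itv/=; apply/negP.
Qed.

Lemma le_Cnorm f s : `|f s| <= `|f|.
Proof. exact: le_sup_norm. Qed.

Lemma Cnorm_le f M : 0 <= M -> (forall s, - r <= s <= 0 -> `|f s| <= M) -> `|f| <= M.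
Proof. by move=> M0 H; apply: sup_norm_le => // s; rewrite /= in_itv/=; exact: H. Qed.

Lemma continuous_within_comp (T U V : topologicalType) (A : set U) (f : U -> V)
    (c : T -> U) : {within A, continuous f} -> (forall u, A (c u)) ->
  continuous c -> continuous (f \o c).
Proof.
move=> /subspace_continuousP cf Ac cc t; apply: cvg_comp (cf _ (Ac t)).
move=> P H; suff : nbhs t (c @^-1` P) by [].
apply: (@filterS _ (nbhs t) _ (fun u => A (c u) -> P (c u))); last exact: (cc t _ H).
by move=> u; apply.
Qed.

Lemma toCE (f : R -> 'cV[R]_m) s : {within `[- r, 0], continuous f} ->
  - r <= s <= 0 -> (toC r f : Cseg r m) s = f s.
Proof.
move=> cf rs; pose g := fun s => if s \in `[- r, 0] then f s else 0.
have gP : g \in @continuous_segment R r m.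
  apply/asboolP; split.
    apply: subspace_eq_continuous cf => u; rewrite inE/= => ur.
    by rewrite /from_subspace /g ur.
  by move=> u; rewrite /= /g => /negP/negbTE ->.
by rewrite /toC insubdK//= segmentE rs.
Qed.

Lemma toC_eq (f g : R -> 'cV[R]_m) : (forall s, - r <= s <= 0 -> f s = g s) ->
  toC r f = toC r g.
Proof.
move=> fg; rewrite /toC; congr insubd; apply/funext => s.
by rewrite segmentE; case: ifP => // /fg.
Qed.

Lemma historyE y t s : continuous y -> - r <= s <= 0 ->
  (history r y t) s = y (t + s).
Proof.
move=> cy rs; apply: (toCE _ rs); apply: continuous_subspaceT => u.
apply: continuous_comp; last exact: cy.
by apply: cvgD; [exact: cvg_cst|exact: cvg_id].
Qed.

Lemma history_eq y z t : (forall s, - r <= s <= 0 -> y (t + s) = z (t + s)) ->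
  history r y t = history r z t.
Proof. exact: toC_eq. Qed.

Lemma historyB y z t : continuous y -> continuous z ->
  history r (z \- y) t = history r z t - history r y t.
Proof.
move=> cy cz; apply: Cseg_ext => s rs; rewrite CB !historyE// => u.
by apply: cvgB; [exact: cz|exact: cy].
Qed.

Lemma historyZ a y t : continuous y ->
  history r (a \*: y) t = a *: history r y t.
Proof.
move=> cy; apply: Cseg_ext => s rs; rewrite CZ !historyE// => u.
by apply: cvgZr; exact: cy.
Qed.

Lemma history_norm_le y t M : continuous y -> 0 <= M ->
  (forall s, - r <= s <= 0 -> `|y (t + s)| <= M) -> `|history r y t| <= M.
Proof. by move=> cy M0 H; apply: Cnorm_le => // s rs; rewrite historyE// H. Qed.

(** Compactness of [-r,0] turns estimates that are local in s into a uniform one; for this each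
    local estimate must hold jointly in the point s' and the index i. *)
Lemma near_Cnorm_le (I : Type) (F : set_system I) (f g : I -> Cseg r m) (e : R) :
  Filter F -> 0 <= e ->
  (forall s, - r <= s <= 0 -> \forall s' \near s & i \near F,
    - r <= s' <= 0 -> `|f i s' - g i s'| <= e) ->
  \forall i \near F, `|f i - g i| <= e.
Proof.
move=> FF e0 H.
have /compact_near_coveringP K := @segment_compact R (- r) 0.
have : \forall i \near F, `[- r, 0]%classic `<=`
    (fun s => - r <= s <= 0 -> `|f i s - g i s| <= e).
  by apply: K => s; rewrite /= in_itv/=; exact: H.
apply: filterS => i Hi; apply: Cnorm_le => // s rs.
by rewrite CB; apply: Hi => //=; rewrite in_itv.
Qed.

Lemma history_continuous y : continuous y -> continuous (history r y).
Proof.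
move=> cy t; apply/cvgrPdist_le => e e0.
apply: near_Cnorm_le; first exact: ltW.
move=> s rs.
have e20 : 0 < e / 2 by rewrite divr_gt0.
have /cvgrPdist_lt/(_ _ e20) H1 := cy (t + s).
have cadd : (fun p : R * R => p.2 + p.1) p @[p --> (s, t)] --> t + s.
  by apply: cvgD; [exact: cvg_snd|exact: cvg_fst].
have cadd' : (fun p : R * R => t + p.1) p @[p --> (s, t)] --> t + s.
  by apply: cvgD; [exact: cvg_cst|exact: cvg_fst].
have : \forall p \near (s, t), `|y (t + s) - y (p.2 + p.1)| < e / 2 /\
    `|y (t + s) - y (t + p.1)| < e / 2.
  by apply: filterI; [exact: (cadd _ H1)|exact: (cadd' _ H1)].
apply: filterS => -[s' t'] /= [H2 H3] rs'.
rewrite !historyE// -[X in `|X|](subrKA (y (t + s))) addrC.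
rewrite (le_trans (ler_normD _ _))// (splitr e) lerD// ltW//.
by rewrite distrC.
Qed.

(** Elements of [Cseg] vanish outside [-r,0] and may jump at its ends. Clamping the argument gives
    an extension that is continuous on the line. *)
Lemma Cseg_clamp_continuous f : 0 <= r ->
  continuous (fun s => f (Num.max (- r) (Num.min s 0))).
Proof.
move=> r0; apply: (continuous_within_comp (C_within (f:=f))).
  move=> t /=; rewrite in_itv/= le_max lexx/= ge_max oppr_le0 r0/=.
  by rewrite ge_min lexx orbT.
move=> t; apply: (@continuous_max _ _ (cst (- r)) (fun s => Num.min s 0)); first exact: cvg_cst.
by apply: (@continuous_min _ _ id (cst 0)); [exact: cvg_id|exact: cvg_cst].
Qed.

Lemma Cseg_eval_continuous (s : R) (i : 'I_m) :
  continuous (fun f : Cseg r m => f s i ord0).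
Proof.
apply: (@lipschitz_continuous _ _ R^o _ 1) => f g; rewrite mul1r.
rewrite (_ : f s i ord0 - g s i ord0 = (f s - g s) i ord0); last by rewrite !mxE.
by apply: le_trans (coord_le_norm _ _) _; rewrite -CB; exact: le_Cnorm.
Qed.

(* An ultrafilter converges pointwise, hence uniformly by equicontinuity. *)
Lemma lipschitz_ball_compact (M L : R) :
  compact [set f : Cseg r m | `|f| <= M /\
    forall s t, - r <= s <= 0 -> - r <= t <= 0 -> `|f t - f s| <= L * `|t - s|].
Proof.
rewrite compact_ultra => U UU UA.
have Hlim (s : R) (i : 'I_m) :
    exists l : R, (fun f : Cseg r m => f s i ord0) f @[f --> U] --> l.
  have := @segment_compact R (- M) M; rewrite compact_ultra.
  move=> /(_ ((fun f : Cseg r m => f s i ord0) @ U)) [||l [_ Hl]]; last by exists l.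
    exact: ultra_fmap.
  suff : \forall f \near U, `[- M, M]%classic ((f : Cseg r m) s i ord0) by [].
  apply: filterS UA => f [fM _]; rewrite /= in_itv/= -ler_norml.
  by rewrite (le_trans (coord_le_norm _ _))// (le_trans (le_Cnorm _ _)).
pose l s i := sval (cid (Hlim s i)).
have lP s i : (f : Cseg r m) s i ord0 @[f --> U] --> l s i by exact: svalP (cid (Hlim s i)).
pose h (s : R) : 'cV[R]_m := \col_i l s i.
have hP s : (f : Cseg r m) s @[f --> U] --> h s.
  apply/cvgrPdist_le => e e0.
  have : \forall f \near U, forall i, `|l s i - (f : Cseg r m) s i ord0| <= e.
    by apply: filter_forall => i; have /cvgrPdist_le := lP s i; exact.
  apply: filterS => f Hf; apply: norm_le_coord => [|i]; first exact: ltW.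
  by rewrite !mxE.
have hM s : `|h s| <= M.
  apply/ler_addgt0Pr => e e0.
  have : \forall f \near U, `|h s - (f : Cseg r m) s| <= e.
    by have /cvgrPdist_le := hP s; exact.
  move=> H; have [f [[fM _] Hf]] := filter_ex (filterI UA H).
  rewrite -(subrK (f s) (h s)) (le_trans (ler_normD _ _))// addrC lerD//.
  by rewrite (le_trans (le_Cnorm _ _)).
have hL s t : - r <= s <= 0 -> - r <= t <= 0 -> `|h t - h s| <= L * `|t - s|.
  move=> rs rt; apply/ler_addgt0Pr => e e0.
  have H u : \forall f \near U, `|h u - (f : Cseg r m) u| <= e / 2.
    by have /cvgrPdist_le := hP u; apply; rewrite divr_gt0.
  have [f [[_ fL] [Hs Ht]]] := filter_ex (filterI UA (filterI (H s) (H t))).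
  rewrite (_ : h t - h s = (f t - f s) + ((h t - f t) - (h s - f s))); last first.
    by apply/matrixP => i j; rewrite !mxE; ring.
  rewrite (le_trans (ler_normD _ _))// lerD ?fL//.
  by rewrite (le_trans (ler_normB _ _))// (splitr e) lerD.
have L0 : 0 <= `|L| by [].
have hc : {within `[- r, 0], continuous h}.
  apply/subspace_continuousP => s; rewrite /= in_itv/= => rs.
  apply/cvgrPdist_le => e e0; rewrite near_withinE.
  have : \forall t \near s, `|s - t| <= e / (`|L| + 1).
    by apply: near_dist_le; rewrite divr_gt0// ltr_wpDl.
  apply: filterS => t st; rewrite /= in_itv/= => rt.
  rewrite (le_trans (hL _ _ rt rs))//.
  rewrite (@le_trans _ _ ((`|L| + 1) * `|s - t|))//.
    by rewrite ler_wpM2r// (le_trans (ler_norm _))// lerDl.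
  by rewrite mulrC -ler_pdivlMr// ltr_wpDl.
exists (toC r h); split.
  split; first by apply: Cnorm_le => [|s rs]; [exact: le_trans (hM 0)|rewrite toCE].
  by move=> s t rs rt; rewrite !toCE//; exact: hL.
apply/cvgrPdist_le => e e0.
apply: near_Cnorm_le; first exact: ltW.
move=> s rs.
have L1 : 0 < `|L| + 1 by rewrite ltr_wpDl.
have e3 : 0 < e / 3 by rewrite divr_gt0.
have d0 : 0 < e / 3 / (`|L| + 1) by rewrite divr_gt0.
apply: (near_prodP (near_dist_le s d0) (Q := [set f : Cseg r m | `|h s - f s| <= e / 3 /\
    forall s t, - r <= s <= 0 -> - r <= t <= 0 -> `|f t - f s| <= L * `|t - s|])).
  apply: filterI; first by have /cvgrPdist_le := hP s; exact.
  by apply: filterS UA => f [].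
move=> t f /= st [Hf fL] rt; rewrite toCE//.
have Lst : L * `|t - s| <= e / 3.
  rewrite (@le_trans _ _ ((`|L| + 1) * `|t - s|))//.
    by rewrite ler_wpM2r// (le_trans (ler_norm _))// lerDl.
  by rewrite mulrC distrC -ler_pdivlMr.
rewrite (_ : h t - f t = (h t - h s) + ((h s - f s) - (f t - f s))); last first.
  by apply/matrixP => i j; rewrite !mxE; ring.
rewrite (_ : e = e / 3 + (e / 3 + e / 3)); last by field.
rewrite (le_trans (ler_normD _ _))// lerD//.
  exact: le_trans (hL _ _ rs rt) Lst.
rewrite (le_trans (ler_normB _ _))// lerD//.
exact: le_trans (fL _ _ rs rt) Lst.
Qed.

End segment_functions.

(** * The componentwise order *)

Section vector_order.
Context {R : realType} {m : nat}.
Implicit Types (x y z : 'cV[R]_m) (A : 'M[R]_m).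

Lemma vle0P x y : vle x y <-> vle 0 (y - x).
Proof. by split=> H i; have := H i; rewrite !mxE subr_ge0. Qed.

Lemma vle_refl x : vle x x.
Proof. by move=> i. Qed.

Lemma vle_trans x y z : vle x y -> vle y z -> vle x z.
Proof. by move=> xy yz i; exact: le_trans (xy i) (yz i). Qed.

Lemma vleD x y x' y' : vle x y -> vle x' y' -> vle (x + x') (y + y').
Proof. by move=> H H' i; rewrite !mxE lerD. Qed.

Lemma vleZ (a : R) x y : 0 <= a -> vle x y -> vle (a *: x) (a *: y).
Proof. by move=> a0 H i; rewrite !mxE ler_wpM2l. Qed.

Lemma vle_mulmx A x y : (forall i j, 0 <= A i j) -> vle x y ->
  vle (A *m x) (A *m y).
Proof.
by move=> A0 xy i; rewrite !mxE; apply: ler_sum => j _; rewrite ler_wpM2l.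
Qed.

Lemma vle_norm x y : vle 0 x -> vle x y -> `|x| <= `|y|.
Proof.
move=> x0 xy; apply: norm_le_coord => // i.
have := x0 i; rewrite mxE => xi0; rewrite ger0_norm//.
rewrite (le_trans (xy i))// (le_trans (ler_norm _))//.
exact: coord_le_norm.
Qed.

End vector_order.

(** * Propagation of the exponential order along linear equations *)

Section cone_of_trajectories.
Context {R : realType} {m : nat} (r : R) (B : 'M[R]_m).
Context (qB : quasipositive B).
Implicit Types (y z w : R -> 'cV[R]_m) (phi psi chi : Cseg r m) (s t : R).

(* Trajectories on [-r, +oo[ all of whose histories lie in the cone. *)
Definition pos_trajectory y : Prop :=
  (forall s, - r <= s -> vle 0 (y s)) /\
  forall s t, - r <= s -> s <= t -> vle (expmx ((t - s) *: B) *m y s) (y t).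

Lemma exp_cone_history y t : continuous y -> pos_trajectory y -> 0 <= t ->
  exp_cone B (history r y t).
Proof.
move=> cy [y0 yE] t0; split=> [s|s u rs su u0].
  rewrite /= in_itv/= => rs; rewrite historyE//; apply: y0.
  by case/andP : rs => rs _; rewrite -[- r]add0r lerD.
have rs' : - r <= s <= 0 by rewrite rs (le_trans su).
have ru' : - r <= u <= 0 by rewrite (le_trans rs).
rewrite !historyE// (_ : u - s = t + u - (t + s)); last by ring.
by apply: yE; rewrite ?lerD2l// -[- r]add0r lerD.
Qed.

Lemma exp_le_history y z t : continuous y -> continuous z ->
  pos_trajectory (z \- y) -> 0 <= t -> exp_le B (history r y t) (history r z t).
Proof.
move=> cy cz H t0; rewrite /exp_le -historyB//; apply: exp_cone_history => // u.
by apply: cvgB; [exact: cz|exact: cy].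
Qed.

(** The derivative of u |-> e^{(t-u)B} w(u) is e^{(t-u)B} g(u), which is nonnegative because the
    exponential of a quasipositive matrix has nonnegative entries; the two sides are the values at u
    = s and u = t. *)
Lemma expmx_flow_nondecreasing w (g : R -> 'cV[R]_m) s t : 0 <= s -> s <= t ->
  continuous w ->
  (forall u : R, 0 < u -> is_derive u 1 w (B *m w u + g u)) ->
  (forall u : R, 0 < u -> vle 0 (g u)) -> vle (expmx ((t - s) *: B) *m w s) (w t).
Proof.
move=> s0 st cw dw g0 i.
have dE (u : R) : is_derive u 1 (fun u => expmx ((t - u) *: B))
    (- (B *m expmx ((t - u) *: B))).
  have := is_derive_expmx_comp B (-1) t u; rewrite scaleN1r mulN1r addrC.
  by under eq_fun do rewrite mulN1r addrC.
have cE : continuous (fun u => expmx ((t - u) *: B)).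
  move=> u; apply/differentiable_continuous/derivable1_diffP.
  by have [] := dE u.
have cEw : continuous (fun u => (expmx ((t - u) *: B) *m w u) i ord0).
  move=> u; under eq_fun do rewrite mxE.
  apply: cvg_big; first exact: add_continuous.
  move=> j _; apply: cvgM.
    exact: (iffLR (continuous_mxP _ u) (cE u)).
  exact: (iffLR (continuous_coordP _ u) (cw u)).
have := @derive_nonneg_le R (fun u => (expmx ((t - u) *: B) *m w u) i ord0)
  (fun u => (expmx ((t - u) *: B) *m g u) i ord0) s t st cEw.
rewrite subrr expmx0 mul1mx; apply.
  move=> u /andP[su ut]; have u0 : 0 < u by rewrite (le_lt_trans s0).
  have := is_derive_mulmx (dE u) (dw u u0).
  rewrite mulmxDr mulmxA mulNmx expmx_commute addrA addNr add0r.
  by move/is_derive_coordP/(_ i).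
move=> u /andP[su ut]; rewrite mxE sumr_ge0// => j _.
have := g0 u (le_lt_trans s0 su) j; rewrite mxE => gj.
by rewrite mulr_ge0// expmx_ge0// subr_ge0 ltW.
Qed.

(** The cone condition on the initial segment and the flow inequality for positive times are chained
    at time 0: if s < 0 < t, then e^{(t-s)B} = e^{tB} e^{-sB}, and the nonnegative matrix e^{tB}
    preserves the inequality between s and 0. *)
Lemma pos_trajectory_ode w (g : R -> 'cV[R]_m) : continuous w ->
  (forall u : R, 0 < u -> is_derive u 1 w (B *m w u + g u)) ->
  (forall u : R, 0 < u -> vle 0 (g u)) ->
  0 <= r -> exp_cone B (toC r w : Cseg r m) -> pos_trajectory w.
Proof.
move=> cw dw g0 r0 [w0 wE].
have cw' : {within `[- r, 0], continuous w} by exact: continuous_subspaceT.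
have r00 : - r <= 0 :> R by rewrite oppr_le0.
have flow s t (st0 : 0 <= s) (st : s <= t) := @expmx_flow_nondecreasing w g s t st0 st cw dw g0.
have wpos s : - r <= s <= 0 -> vle 0 (w s).
  by move=> rs; have := w0 s; rewrite /= in_itv/= => /(_ rs); rewrite toCE.
have Epos t i j : 0 <= t -> 0 <= expmx (t *: B) i j by exact: (expmx_ge0 i j qB).
have wneg s t : - r <= s -> s <= t -> t <= 0 -> vle (expmx ((t - s) *: B) *m w s) (w t).
  move=> rs st t0; have := wE s t rs st t0.
  by rewrite !toCE//; [rewrite (le_trans rs)|rewrite rs (le_trans st)].
split=> [s rs|s t rs st].
  have [s0|/ltW s0] := leP s 0; first by apply: wpos; rewrite rs.
  apply: vle_trans (flow 0 s (lexx _) s0); rewrite subr0.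
  by rewrite -(mulmx0 _ (expmx (s *: B))); apply: vle_mulmx;
    [move=> i j; exact: Epos|apply: wpos; rewrite r00 /=].
have [t0|/ltW t0] := leP t 0; first exact: wneg.
have [s0|/ltW s0] := leP s 0; last exact: flow.
have := flow 0 t (lexx _) t0; rewrite subr0; apply: vle_trans.
rewrite (_ : t - s = t + (0 - s)); last by ring.
rewrite expmxD -mulmxA; apply: vle_mulmx; first by move=> i j; exact: Epos.
exact: wneg.
Qed.

Lemma pos_trajectoryD y z : pos_trajectory y -> pos_trajectory z ->
  pos_trajectory (y \+ z).
Proof.
move=> [y0 yE] [z0 zE]; split=> [s rs|s t rs st].
  by rewrite -[0]addr0; exact: vleD (y0 _ rs) (z0 _ rs).
by rewrite mulmxDr; exact: vleD (yE _ _ rs st) (zE _ _ rs st).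
Qed.

Lemma pos_trajectory_lim (f : nat -> R -> 'cV[R]_m) y :
  (forall t, - r <= t -> f n t @[n --> \oo] --> y t) ->
  (\forall n \near \oo, pos_trajectory (f n)) -> pos_trajectory y.
Proof.
move=> fy fpos.
have fyi t i : - r <= t -> f n t i ord0 @[n --> \oo] --> y t i ord0.
  move=> rt; apply: (@cvg_comp _ _ _ _ (fun x : 'cV[R]_m => x i ord0) _ _ _ (fy t rt)).
  exact: (@coord_continuous _ _ _ i ord0 (y t)).
split=> [s rs i|s t rs st i].
  rewrite mxE; apply: (cvgr_to_ge (fyi s i rs)).
  by apply: filterS fpos => n [/(_ s rs i)]; rewrite mxE.
have rt : - r <= t by exact: le_trans st.
have lhs : (expmx ((t - s) *: B) *m f n s) i ord0 @[n --> \oo] -->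
    (expmx ((t - s) *: B) *m y s) i ord0.
  under eq_fun do rewrite mxE; rewrite mxE.
  by apply: cvg_sum_ord => j; apply: cvgMr; exact: fyi.
apply: (ler_cvg_to lhs (fyi t i rt)).
by apply: filterS fpos => n [_ /(_ s t rs st i)].
Qed.

End cone_of_trajectories.

(** * The closed convex cone of the exponential order *)

Section exponential_cone.
Context {R : realType} {m : nat} {r : R} {B : 'M[R]_m}.
Implicit Types (phi psi chi : Cseg r m) (s t : R).

Lemma exp_cone0 : exp_cone B (0 : Cseg r m).
Proof. by split=> [s _|s t _ _ _]; rewrite ?mulmx0; exact: vle_refl. Qed.

Lemma exp_coneD phi psi : exp_cone B phi -> exp_cone B psi -> exp_cone B (phi + psi).
Proof.
move=> [y0 yE] [z0 zE]; split=> [s rs|s t rs st t0].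
  by rewrite CD -[0]addr0; exact: vleD (y0 _ rs) (z0 _ rs).
by rewrite !CD mulmxDr; exact: vleD (yE _ _ rs st t0) (zE _ _ rs st t0).
Qed.

Lemma exp_coneZ (a : R) phi : 0 <= a -> exp_cone B phi -> exp_cone B (a *: phi).
Proof.
move=> a0 [y0 yE]; split=> [s rs|s t rs st t0].
  by rewrite CZ -(scaler0 _ a); exact: vleZ a0 (y0 _ rs).
by rewrite !CZ -scalemxAr; exact: vleZ a0 (yE _ _ rs st t0).
Qed.

Lemma exp_le_refl phi : exp_le B phi phi.
Proof. by rewrite /exp_le subrr; exact: exp_cone0. Qed.

Lemma exp_le_trans phi psi chi : exp_le B phi psi -> exp_le B psi chi -> exp_le B phi chi.
Proof.
rewrite /exp_le => H H'; rewrite -(subrKA psi).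
exact: exp_coneD.
Qed.

Lemma exp_le0 phi : exp_le B 0 phi = exp_cone B phi.
Proof. by rewrite /exp_le subr0. Qed.

Lemma exp_leZ (a : R) phi psi : 0 <= a -> exp_le B phi psi -> exp_le B (a *: phi) (a *: psi).
Proof. by rewrite /exp_le -scalerBr => a0; exact: exp_coneZ. Qed.

Lemma exp_le_norm phi psi : exp_cone B phi -> exp_le B phi psi -> `|phi| <= `|psi|.
Proof.
move=> [phi0 _] [H _]; apply: Cnorm_le => // s rs.
have rs' : `[- r, 0]%classic s by rewrite /= in_itv.
apply: le_trans (le_Cnorm psi s); apply: vle_norm; first exact: phi0.
by apply/vle0P; have := H _ rs'; rewrite CB.
Qed.

Lemma closure_ge0 (A : set (Cseg r m)) (h : Cseg r m -> R^o) phi : continuous h ->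
  (forall psi, A psi -> 0 <= h psi) -> closure A phi -> 0 <= h phi.
Proof.
move=> ch Ah cA; rewrite leNgt; apply/negP => h0.
have [d d0 H] : exists2 d : R, 0 < d & forall psi, `|phi - psi| < d -> h psi < 0.
  have : \forall psi \near phi, h psi < 0 by exact: (cvgr_lt _ (ch phi)).
  by move/nbhs_normE.
have [psi [Apsi /H]] : A `&` [set psi | `|phi - psi| < d] !=set0.
  by apply: cA; apply/nbhs_normE; exists d.
by rewrite ltNge Ah.
Qed.

(** Each defining inequality says that a functional, Lipschitz for the sup-norm, is nonnegative. *)
Lemma exp_cone_closed : closed [set phi : Cseg r m | exp_cone B phi].
Proof.
move=> phi cphi; split=> [s rs i|s t rs st t0 i].
  rewrite mxE; apply: (@closure_ge0 _ (fun phi : Cseg r m => phi s i ord0)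
    _ (@Cseg_eval_continuous R r m s i) _ cphi).
  by move=> psi [/(_ s rs i)]; rewrite mxE.
rewrite -subr_ge0.
have [K K1 HK] := expmx_bound B (t - s).
have ts0 : 0 <= t - s by rewrite subr_ge0.
apply: (@closure_ge0 _ (fun phi : Cseg r m =>
  phi t i ord0 - (expmx ((t - s) *: B) *m phi s) i ord0) _ _ _ cphi).
  apply: (@lipschitz_continuous _ _ R^o _ (1 + K)) => f g.
  rewrite [X in `|X|](_ : _ =
      ((f - g) t - expmx ((t - s) *: B) *m (f - g) s) i ord0); last first.
    by rewrite !CB mulmxBr !mxE; ring.
  apply: le_trans (coord_le_norm _ _) _; apply: le_trans (ler_normB _ _) _.
  rewrite mulrDl mul1r lerD ?le_Cnorm//; apply: le_trans (HK _ _ _) _.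
    by rewrite lexx andbT (le_trans _ ts0)// oppr_le0.
  by rewrite ler_wpM2l ?le_Cnorm// (le_trans _ K1).
by move=> psi [_ /(_ s t rs st t0 i)]; rewrite subr_ge0.
Qed.

Lemma exp_le_closed psi : closed [set phi : Cseg r m | exp_le B psi phi].
Proof.
apply: (@closed_comp _ _ (fun phi : Cseg r m => phi - psi)); last exact: exp_cone_closed.
move=> phi _; apply: (@lipschitz_continuous _ _ _ _ 1) => f g.
by rewrite mul1r opprB addrA subrK.
Qed.

End exponential_cone.

(** * The norm of X_L and the interior of the cone *)

Section lipschitz_functions.
Context {R : realType} {m : nat} {r : R}.
Implicit Types (f g : Lipseg r m) (s t : R).

Lemma L_C_norm_le f : `|L_C f| <= `|f|.
Proof. by rewrite [leRHS]L_normE /lip_norm lerDl lip_seminorm_ge0. Qed.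

Lemma Lnorm_lipschitz f s t : - r <= s <= 0 -> - r <= t <= 0 ->
  `|f t - f s| <= `|f| * `|t - s|.
Proof.
move=> rs rt; apply: le_trans (le_lip_seminorm _ _ _) _; rewrite /= ?in_itv//.
by rewrite ler_wpM2r// [leRHS]L_normE /lip_norm lerDr.
Qed.

Lemma Lnorm_le f (a b : R) : `|L_C f| <= a -> 0 <= b ->
  (forall s t, - r <= s <= 0 -> - r <= t <= 0 -> `|f t - f s| <= b * `|t - s|) ->
  `|f| <= a + b.
Proof.
move=> fa b0 H; rewrite [leLHS]L_normE /lip_norm lerD//.
by apply: lip_seminorm_le => // s t; rewrite /= !in_itv; exact: H.
Qed.

Lemma toLK (phi : Cseg r m) (k : R) :
  (forall s t, - r <= s <= 0 -> - r <= t <= 0 -> `|phi t - phi s| <= k * `|t - s|) ->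
  L_C (toL phi) = phi.
Proof.
move=> H; rewrite /toL insubdK//; apply/asboolP; exists k => -[s t] [/=].
by rewrite !in_itv/= => rs rt; exact: H.
Qed.

Lemma L_C_continuous : continuous (@L_C R r m).
Proof.
apply: (@lipschitz_continuous _ _ _ _ 1) => f g; rewrite mul1r -LB.
exact: L_C_norm_le.
Qed.

Context {B : 'M[R]_m}.

Lemma exp_pos_ball f : exp_pos B f -> exists2 rho : R, 0 < rho &
  forall h : Lipseg r m, `|h| < rho -> exp_cone B (L_C (f + h)).
Proof.
rewrite /exp_pos /interior/= => /nbhs_normE[d d0 H]; exists d => // h hd.
by apply: (H (f + h)); rewrite opprD addrA subrr sub0r normrN.
Qed.

Lemma exp_pos_cone f : exp_pos B f -> exp_cone B (L_C f).
Proof. by move/exp_pos_ball => [d d0 /(_ 0)]; rewrite normr0 addr0; exact. Qed.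

(** Adding g - f, an element of the cone, carries a ball around f inside the cone to a ball around g
    inside the cone. *)
Lemma exp_pos_ge f g : exp_pos B f -> exp_le B (L_C f) (L_C g) -> exp_pos B g.
Proof.
move=> /exp_pos_ball[d d0 H] fg; apply/nbhs_normE; exists d => // h gh.
have := H (h - g); rewrite distrC => /(_ gh) Hh.
have := exp_coneD fg Hh; rewrite -LB -LD.
by rewrite addrA subrK addrC subrK.
Qed.

Lemma exp_posZ (a : R) f : 0 < a -> exp_pos B f -> exp_pos B (a *: f).
Proof.
move=> a0 /exp_pos_ball[d d0 H]; apply/nbhs_normE; exists (a * d); first exact: mulr_gt0.
move=> h fh; have := H (a^-1 *: (h - a *: f)).
rewrite normrZ gtr0_norm ?invr_gt0// -ltr_pdivlMl ?invr_gt0// invrK distrC.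
move=> /(_ fh) /(exp_coneZ (ltW a0)); rewrite -LZ scalerDr scalerA divff ?gt_eqF//.
by rewrite scale1r addrC subrK.
Qed.

(** Interior points of a cone are order units. That the multiple of f is linear in the norm of h is
    what turns closeness in X_L into closeness in the order. *)
Lemma exp_pos_dominates f : exp_pos B f -> exists2 K : R, 0 < K &
  forall h : Lipseg r m, exp_le B (L_C h) ((K * `|h|) *: L_C f) /\
    exp_le B (- ((K * `|h|) *: L_C f)) (L_C h).
Proof.
move=> /[dup] /exp_pos_cone cf /exp_pos_ball[d d0 H].
(* With this constant, h divided by K|h| has norm d/2, strictly inside the ball of radius d around
   0. *)
exists (2 / d); first exact: divr_gt0.
have key (h : Lipseg r m) : exp_le B (L_C h) ((2 / d * `|h|) *: L_C f).
  have [->|h0] := eqVneq h 0; first by rewrite normr0 mulr0 scale0r; exact: exp_le_refl.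
  have n0 : 0 < `|h| by rewrite normr_gt0.
  have c0 : 0 < 2 / d * `|h| by rewrite mulr_gt0// divr_gt0.
  have := H (- ((2 / d * `|h|)^-1 *: h)).
  rewrite normrN normrZ gtr0_norm ?invr_gt0//.
  have -> : (2 / d * `|h|)^-1 * `|h| = d / 2.
    by field; rewrite !gt_eqF.
  rewrite ltr_pdivrMr// ltr_pMr// ltr1n => /(_ isT).
  move/(exp_coneZ (ltW c0)); rewrite /exp_le -LZ scalerBr scalerA divff ?gt_eqF//.
  by rewrite scale1r LB LZ.
move=> h; split; first exact: key.
have := key (- h); rewrite normrN /exp_le -LZ -LB opprK LD LZ => H'.
by rewrite opprK addrC.
Qed.

End lipschitz_functions.

Lemma continuous_pair (T U V : topologicalType) (f : T -> U) (g : T -> V) (t : T) :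
  {for t, continuous f} -> {for t, continuous g} ->
  {for t, continuous (fun x => (f x, g x))}.
Proof. by move=> cf cg; exact: (cvg_pair cf cg). Qed.

(** * From bounds on the differential to Lipschitz estimates *)

Section local_lipschitz.
Context {R : realType} {V : normedModType R} {m : nat}.

Lemma is_derive_segment (f : V -> 'cV[R]_m) (a v : V) (t : R) :
  differentiable f (a + t *: v) ->
  is_derive t 1 (fun u : R => f (a + u *: v)) ('d f (a + t *: v) v).
Proof.
move=> df; have dfv : derivable f (a + t *: v) v by exact: diff_derivable.
have E : (fun h : R => h^-1 *: (((fun u : R => f (a + u *: v)) \o shift t) (h *: 1)
    - f (a + t *: v))) =
  (fun h : R => h^-1 *: ((f \o shift (a + t *: v)) (h *: v) - f (a + t *: v))).
  apply/funext => h /=; congr (_ *: (f _ - _)).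
  by rewrite /shift/= scalerDl [h *: 1]mulr1 addrCA.
split; first by rewrite /derivable E.
by rewrite -(deriveE _ df) /derive E.
Qed.

(** A ball is convex, so the segment from b to a stays where the differential is bounded; the mean
    value inequality is applied along it. *)
Lemma differential_bound_lipschitz (f : V -> 'cV[R]_m) (x : V) (rho l : R) :
  (forall y, differentiable f y) ->
  (forall y, `|x - y| < rho -> forall h, `|'d f y h| <= l * `|h|) ->
  forall a b, `|x - a| < rho -> `|x - b| < rho -> `|f a - f b| <= l * `|a - b|.
Proof.
move=> df H a b xa xb.
pose y (u : R) := f (b + u *: (a - b)).
have dy (u : R) : is_derive u 1 y ('d f (b + u *: (a - b)) (a - b)).
  exact: is_derive_segment.
have cy : continuous y.
  by move=> u; apply/differentiable_continuous/derivable1_diffP; case: (dy u).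
have := @mean_value_bound R m y (fun u => 'd f (b + u *: (a - b)) (a - b))
  (l * `|a - b|) 0 1 ler01 cy (fun u _ => dy u).
have y1 : y 1 = f a by rewrite /y scale1r addrC subrK.
have y0 : y 0 = f b by rewrite /y scale0r addr0.
rewrite y1 y0 subr0 mulr1; apply.
move=> t /andP[t0 t1]; apply: H.
rewrite (_ : x - (b + t *: (a - b)) = t *: (x - a) + (1 - t) *: (x - b)); last first.
  rewrite scalerBl scale1r !scalerBr opprD addrA opprB [RHS]addrC -[RHS]addrA.
  by congr (_ + _); rewrite opprB subrKA.
rewrite (le_lt_trans (ler_normD _ _))// !normrZ gtr0_norm//.
rewrite (ger0_norm (_ : 0 <= 1 - t)) ?subr_ge0 ?ltW//.
rewrite (_ : rho = t * rho + (1 - t) * rho); last by ring.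
by rewrite ltrD// ltr_pM2l// subr_gt0.
Qed.

End local_lipschitz.

(** * First exit times *)

Section exit_time.
Context {R : realType}.

Lemma first_exit (f : R -> R) (t2 : R) : continuous f -> f 0 < 0 -> 0 <= t2 ->
  0 <= f t2 -> exists t1, [/\ 0 < t1, t1 <= t2, 0 <= f t1 &
    forall s, 0 <= s < t1 -> f s < 0].
Proof.
move=> cf f0 t20 ft2; pose A := [set t : R | 0 <= t <= t2 /\ 0 <= f t].
have At2 : A t2 by split=> //; rewrite t20 lexx.
have hA : has_inf A.
  by split; [exists t2|exists 0 => t [/andP[]]].
have lA t : A t -> inf A <= t by move=> At; apply: ge_inf => //; case: hA.
have infA0 : 0 <= inf A by apply: lb_le_inf; [exists t2|move=> t [/andP[]]].
have finf : 0 <= f (inf A).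
  rewrite leNgt; apply/negP => fneg.
  have : \forall t \near inf A, f t < 0 by exact: (cvgr_lt _ (cf (inf A))).
  move=> /nbhs_normE[d d0 Hd].
  have [t At tA] := inf_adherent d0 hA.
  have := Hd t; rewrite ler0_norm ?subr_le0 ?lA// opprB ltrBlDl => /(_ tA).
  by case: At => _; rewrite leNgt => /negbTE ->.
exists (inf A); split=> //; last 1 first.
- move=> s /andP[s0 sA]; rewrite ltNge; apply/negP => fs.
  have : inf A <= s.
    have st2 : s <= t2 by rewrite (le_trans (ltW sA))// lA.
    by apply: lA; split=> //; rewrite s0.
  by rewrite leNgt sA.
- rewrite lt_neqAle infA0 andbT; apply/eqP => E.
  by move: finf; rewrite -E leNgt f0.
- exact: lA.
Qed.

End exit_time.

(** * Continuous dependence and uniqueness for the delay equation *)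

Section delay_equation.
Context {R : realType} {Omega : metricType R} {r : R} {m : nat}.
Context {sigma : R -> Omega -> Omega} {F : Omega -> Cseg r m -> 'cV[R]_m}.
Context (r0 : 0 < r) (sigma_flow : continuous_flow sigma).
Context (F_continuous : continuous (fun p : Omega * Cseg r m => F p.1 p.2)).
Implicit Types (w : Omega) (phi psi : Cseg r m) (y : R -> 'cV[R]_m).

(** A working form of [is_solution]: continuity on the whole line dispenses with subspace
    topologies, and the right derivative at 0 is left out because it follows from the continuity of
    the right-hand side. *)
Definition solves w phi y : Prop :=
  [/\ continuous y, forall s, - r <= s <= 0 -> y s = phi s &
      forall t : R, 0 < t -> is_derive t 1 y (F (sigma t w) (history r y t))].

Lemma flow_continuous w (t : R) :
  (fun p : R * Omega => sigma p.1 p.2) p @[p --> (t, w)] --> sigma t w.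
Proof. by have [+ _ _] := sigma_flow; move=> /(_ (t, w)). Qed.

Lemma rhs_continuous w y : continuous y ->
  continuous (fun t => F (sigma t w) (history r y t)).
Proof.
move=> cy t.
apply: (@continuous_comp _ _ _ (fun t : R => (sigma t w, history r y t))
  (fun p => F p.1 p.2)); last exact: F_continuous.
apply: continuous_pair; last exact: (@history_continuous R r m y cy t).
have csig : continuous (fun p : R * Omega => sigma p.1 p.2) by case: sigma_flow.
apply: (@continuous_comp _ _ _ (fun t : R => (t, w)) (fun p => sigma p.1 p.2));
  last exact: csig.
by apply: continuous_pair; [exact: cvg_id|exact: cvg_cst].
Qed.

Lemma F_near w phi (e : R) : 0 < e ->
  \forall w' \near w & phi' \near phi, `|F w phi - F w' phi'| <= e.
Proof.
move=> e0; have cF : (fun p : Omega * Cseg r m => F p.1 p.2) p @[p --> (w, phi)]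
    --> F w phi by exact: (@F_continuous (w, phi)).
by have /cvgrPdist_le := cF; exact.
Qed.

Lemma solves_history0 w phi y : solves w phi y -> history r y 0 = phi.
Proof.
by move=> [cy yphi _]; apply: Cseg_ext => s rs; rewrite historyE// add0r yphi.
Qed.

Lemma solves_is_solution w phi y : solves w phi y -> is_solution sigma F w phi y.
Proof.
move=> /[dup] ys [cy yphi dy]; split=> //.
  exact: continuous_subspaceT.
pose g t := F (sigma t w) (history r y t).
have g0 : g 0 = F w phi.
  by rewrite /g (solves_history0 ys); case: sigma_flow => _ ->.
apply/cvgrPdist_le => e e0.
have /nbhs_normE[d d0 Hd] : \forall t \near (0 : R), `|g 0 - g t| <= e.
  by have /cvgrPdist_le := @rhs_continuous w y cy (0 : R); exact.
near=> h.
have h0 : 0 < h by near: h; exact: nbhs_right_gt.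
have hd : h < d by near: h; exact: nbhs_right_lt.
rewrite -g0.
(* Subtracting the line of slope [g 0] leaves a function whose derivative is at most e near 0, so
   its difference quotient at 0 is at most e as well. *)
have := @mean_value_bound R m (fun t => y t - t *: g 0) (fun t => g t - g 0) e 0 h (ltW h0).
rewrite scale0r subr0 => H.
rewrite (_ : _ - _ = - (h^-1 *: (y h - h *: g 0 - y 0))); last first.
  rewrite addrAC [in RHS]scalerBr scalerA mulVf ?gt_eqF// scale1r opprB.
  by [].
rewrite normrN normrZ gtr0_norm ?invr_gt0// mulrC ler_pdivrMr//.
rewrite -[X in _ <= _ * X]subr0; apply: H.
- move=> t; apply: cvgB; first exact: cy.
  by apply: cvgZl; exact: cvg_id.
- move=> t /andP[t0 th]; have := dy t t0 => dyt.
  apply/is_derive_coordP => i.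
  rewrite (_ : (fun u => _) = (fun u => y u i ord0) - (g 0 i ord0 \*: id)); last first.
    by apply/funext => u; rewrite !mxE /GRing.scale/= mulrC.
  have /is_derive_coordP/(_ i) dyi := dyt.
  by apply: is_derive_eq; rewrite !mxE /GRing.scale/= mulr1.
- move=> t /andP[t0 th]; rewrite distrC Hd// sub0r normrN gtr0_norm//.
  exact: lt_trans hd.
Unshelve. all: by end_near. Qed.

Lemma is_solution_solves w phi y : is_solution sigma F w phi y ->
  solves w phi (fun t => y (Num.max t (- r))).
Proof.
move=> [cy yphi _ dy]; split.
- apply: (continuous_within_comp cy).
    by move=> t; rewrite /= in_itv/= andbT le_max lexx orbT.
  move=> t; apply: (@continuous_max _ _ id (cst (- r))); first exact: cvg_id.
  exact: cvg_cst.
- by move=> s /[dup] rs /andP[rs' _]; rewrite max_l//; apply: yphi; rewrite /= in_itv.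
move=> t t0.
rewrite (@history_eq _ _ _ (fun t => y (Num.max t (- r))) y t).
  have rt : - r < t by rewrite (lt_trans _ t0)// oppr_lt0.
  apply: near_eq_is_derive (dy t t0); near=> s; rewrite max_l//.
  by apply: ltW; near: s; exact: lt_nbhsr.
by move=> s /andP[rs _]; rewrite max_l// -[- r]add0r lerD// ltW.
Unshelve. all: by end_near. Qed.

Context (F_C1 : C1_second F).

(** Joint continuity of the differential bounds it, on a neighbourhood of (w, phi), by k + 1: k is
    the bound at (w, phi) itself and 1 the allowed oscillation. *)
Lemma F_locally_lipschitz w phi : exists rho l : R, [/\ 0 < rho, 0 < l &
  \forall v \near w, forall a b, `|phi - a| < rho -> `|phi - b| < rho ->
    `|F v a - F v b| <= l * `|a - b|].
Proof.
have [dF cdF] := F_C1.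
have [[U P] /= [Uw Pphi] UP] := cdF w phi 1 ltr01.
have [k k0 Hk] := linear_lipschitz (diff_continuous (dF w phi)).
have [rho rho0 Hrho] := (nbhs_normE _ _).1 Pphi.
exists rho, (k + 1); split=> //; first by rewrite addr_gt0.
apply: filterS Uw => v Uv; apply: differential_bound_lipschitz; first exact: dF.
move=> psi /Hrho Ppsi h; rewrite mulrDl.
rewrite -(subrK ('d (F w) phi h) ('d (F v) psi h)) addrC.
rewrite (le_trans (ler_normD _ _))// lerD ?Hk//.
exact: (UP (v, psi)).
Qed.

Lemma F_lipschitz_along w y (T : R) : continuous y ->
  exists rho l : R, [/\ 0 < rho, 0 < l &
    \forall w' \near w, forall t : R, 0 <= t <= T ->
      forall a b, `|history r y t - a| < rho -> `|history r y t - b| < rho ->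
      `|F (sigma t w') a - F (sigma t w') b| <= l * `|a - b|].
Proof.
move=> cy.
have /compact_near_coveringP K := @segment_compact R 0 T.
(* A single integer n encodes both the Lipschitz constant n + 1 and the radius 1/(n + 1); a covering
   argument along [\oo] then chooses both uniformly on [0,T]. *)
pose P (i : nat * Omega) (t : R) := forall a b,
  `|history r y t - a| < i.1.+1%:R^-1 -> `|history r y t - b| < i.1.+1%:R^-1 ->
  `|F (sigma t i.2) a - F (sigma t i.2) b| <= i.1.+1%:R * `|a - b|.
have : filter_prod \oo (nbhs w) [set i | `[0, T]%classic `<=` P i].
  apply: (K _ (filter_prod \oo (nbhs w)) P) => t _.
  have [rho [l [rho0 l0 H]]] := F_locally_lipschitz (sigma t w) (history r y t).
  have [[A U] /= [At Uw] AU] := flow_continuous H.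
  have rho2 : 0 < rho / 2 by rewrite divr_gt0.
  have hA : \forall t' \near t, `|history r y t - history r y t'| <= rho / 2.
    by have /cvgrPdist_le := @history_continuous R r m y cy t; exact.
  have nrho : \forall n \near \oo, (n.+1%:R^-1 : R) < rho / 2.
    exact: near_infty_natSinv_lt (PosNum rho2).
  have nl : \forall n \near \oo, l <= n%:R by exact: nbhs_infty_ger.
  apply: (near_prodP (filterI At hA)
    (Q := [set i : nat * Omega | (i.1.+1%:R^-1 : R) < rho / 2 /\ l <= i.1%:R /\ U i.2])).
    exists ([set n | (n.+1%:R^-1 : R) < rho / 2 /\ l <= n%:R], U).
      by split => //; exact: filterI.
    by move=> [n v] /= [[? ?] ?].
  move=> t' [n v] [/= At' ht'] [/= nr [ln Uv]] a b.
  have tri c : `|history r y t' - c| < n.+1%:R^-1 -> `|history r y t - c| < rho.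
    move=> tc; rewrite -(subrKA (history r y t')) (le_lt_trans (ler_normD _ _))//.
    by rewrite (splitr rho) ler_ltD// (lt_trans tc).
  move=> /tri ta /tri tb.
  rewrite (le_trans (AU (t', v) _ a b ta tb))// ler_wpM2r// (le_trans ln)//.
  by rewrite ler_nat.
move=> [[N U] /= [NN Uw] NU].
have [n Nn] := filter_ex NN.
exists n.+1%:R^-1, n.+1%:R; split=> //.
apply: filterS Uw => w' Uw' t tT; exact: (NU (n, w')).
Qed.

Lemma F_close_along w y (T e : R) : continuous y -> 0 < e ->
  \forall w' \near w, forall t : R, 0 <= t <= T ->
    `|F (sigma t w') (history r y t) - F (sigma t w) (history r y t)| <= e.
Proof.
move=> cy e0; have /compact_near_coveringP K := @segment_compact R 0 T.
have : \forall w' \near w, `[0, T]%classic `<=` (fun t : R =>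
    `|F (sigma t w') (history r y t) - F (sigma t w) (history r y t)| <= e).
  apply: K => t _.
  have e2 : 0 < e / 2 by rewrite divr_gt0.
  have H1 : \forall t' \near t,
      `|F (sigma t w) (history r y t) - F (sigma t' w) (history r y t')| <= e / 2.
    by have /cvgrPdist_le := @rhs_continuous w y cy t; exact.
  have [[U P] /= [Uw Pphi] UP] := F_near (sigma t w) (history r y t) e2.
  have [[A W] /= [At Ww] AW] := flow_continuous Uw.
  have Ph : \forall t' \near t, P (history r y t').
    exact: (@history_continuous R r m y cy t).
  apply: (near_prodP (filterI At (filterI H1 Ph)) Ww) => t' w' [At' [H1' Pt']] Ww'.
  have := UP (sigma t' w', history r y t'); rewrite /= => /(_ (conj (AW (t', w') (conj At' Ww')) Pt')) H2'.
  rewrite -(subrKA (F (sigma t w) (history r y t))).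
  by rewrite (le_trans (ler_normD _ _))// (splitr e) lerD// distrC.
by apply: filterS => w' H t tT; apply: H; rewrite /= in_itv.
Qed.

(* A first-exit argument: y' stays below the barrier [a * expR (2 * l * t)]. *)
Lemma solution_stability w phi y (T e : R) : solves w phi y -> 0 < e -> 0 <= T ->
  \forall w' \near w & phi' \near phi, forall y', solves w' phi' y' ->
    forall t, - r <= t <= T -> `|y' t - y t| <= e.
Proof.
move=> [cy yphi dy] e0 T0.
have [rho [l [rho0 l0 Hl]]] := F_lipschitz_along w T cy.
(* The barrier ends at min(rho, e)/2 at time T: below e for the conclusion, and below rho so that
   the Lipschitz estimate stays available. *)
pose a : R := Num.min rho e / (2 * expR (2 * l * T)).
have a0 : 0 < a by rewrite divr_gt0 ?lt_min ?rho0// mulr_gt0// expR_gt0.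
have aT : a * expR (2 * l * T) = Num.min rho e / 2.
  by rewrite /a; field; rewrite gt_eqF// expR_gt0.
have minre : Num.min rho e / 2 < Num.min rho e.
  by rewrite ltr_pdivrMr// ltr_pMr ?lt_min ?rho0// ltr1n.
pose D (t : R) : R := a * expR (2 * l * t).
have Dmono s t : s <= t -> D s <= D t.
  by move=> st; rewrite /D ler_pM2l// ler_expR ler_pM2l// mulr_gt0.
have D0 : D 0 = a by rewrite /D mulr0 expR0 mulr1.
have DTrho : D T < rho by rewrite /D aT (lt_le_trans minre)// ge_min lexx.
have DTe : D T < e by rewrite /D aT (lt_le_trans minre)// ge_min lexx orbT.
have eta0 : 0 < l * a / 2 by rewrite divr_gt0// mulr_gt0.
have Qphi : nbhs phi [set phi' : Cseg r m | `|phi - phi'| < a / 2].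
  by apply/nbhs_normE; exists (a / 2) => //; exact: divr_gt0.
apply: (near_prodP (filterI Hl (@F_close_along w y T _ cy eta0)) Qphi).
move=> w' phi' [Hlip Hclose] Hphi y' [cy' yphi' dy'].
have zneg s : - r <= s <= 0 -> `|y' s - y s| < a / 2.
  move=> rs; rewrite yphi// yphi'// distrC -CB.
  exact: le_lt_trans (le_Cnorm _ _) Hphi.
have aa : a / 2 < a by rewrite ltr_pdivrMr// ltr_pMr// ltr1n.
have cz : continuous (fun t => y' t - y t).
  by move=> t; apply: cvgB; [exact: cy'|exact: cy].
have main t : 0 <= t <= T -> `|y' t - y t| < D t.
  move=> /andP[t0 tT]; rewrite ltNge; apply/negP => DT.
  have cD : continuous D.
    by move=> u; apply: cvgMr; apply: continuous_comp; [apply: cvgMr; exact: cvg_id|exact: continuous_expR].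
  have [||//||t1 [t10 t1t Dt1 Hs]] := @first_exit R (fun t => `|y' t - y t| - D t) t.
  - move=> u; apply: cvgB; last exact: cD.
    by apply: cvg_norm; exact: cz.
  - by rewrite subr_lt0 D0 (lt_trans _ aa)// zneg// lexx oppr_le0 ltW.
  - by rewrite subr_ge0.
  have t1T : t1 <= T by exact: le_trans tT.
  have hist s : 0 < s < t1 -> `|history r y s - history r y' s| <= D s.
    move=> /andP[s0 st1]; rewrite -(historyB _ cy' cy); apply: history_norm_le.
    - by move=> u; apply: cvgB; [exact: cy|exact: cy'].
    - by rewrite mulr_ge0 ?expR_ge0 ?ltW.
    move=> u /andP[ru u0]; rewrite /= distrC.
    have [su|su] := leP 0 (s + u).
      have sus : s + u <= s by rewrite gerDl.
      rewrite (@le_trans _ _ (D (s + u))) ?Dmono//.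
      apply: ltW; rewrite -subr_lt0; apply: Hs.
      by rewrite su (le_lt_trans sus).
    rewrite (@le_trans _ _ a)//; last by rewrite -D0 Dmono// ltW.
    rewrite (le_trans _ (ltW aa))// ltW// zneg// (ltW su) andbT.
    by rewrite -[- r]add0r lerD// ltW.
  (* Up to the exit time the difference grows at rate at most l D + l a/2 <= (3/2) l D, which is the
     derivative of (3/4) D. With initial gap below a/2 it is thus less than a/2 + (3/4)(D - a) < D,
     so no exit can occur. *)
  have D1 (s : R) : is_derive s 1 (fun s => 3 / 4 * D s) (3 / 2 * l * D s).
    have d2 : is_derive s 1 (fun t => expR (2 * l * t)) (expR (2 * l * s) * (2 * l)).
      apply: (@is_derive1_comp _ expR (fun t => 2 * l * t)) => //.
      rewrite [X in is_derive _ _ X](_ : _ = (2 * l) \*: id)//.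
      by apply: is_derive_eq; rewrite /GRing.scale/= mulr1.
    rewrite (_ : (fun s => 3 / 4 * D s) = (3 / 4 * a) \*: (fun t => expR (2 * l * t))); last first.
      by apply/funext => u; rewrite /D /GRing.scale/= mulrA.
    by apply: is_derive_eq; rewrite /GRing.scale/= /D; field.
  have := @mean_value_ineq R m (fun t => y' t - y t)
    (fun t => F (sigma t w') (history r y' t) - F (sigma t w) (history r y t))
    (fun s => 3 / 4 * D s) (fun s => 3 / 2 * l * D s) 0 t1 (ltW t10) cz.
  have cD' : continuous (fun s => 3 / 4 * D s).
    by move=> u; apply: cvgMr; exact: cD.
  move=> /(_ cD') H.
  have : `|y' t1 - y t1 - (y' 0 - y 0)| <= 3 / 4 * D t1 - 3 / 4 * D 0.
    apply: H => u /andP[u0 ut1].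
      by have := dy u u0; have := dy' u u0 => ? ?; exact: is_deriveB.
    have uT : 0 <= u <= T by rewrite (ltW u0) (le_trans (ltW ut1)).
    have Hu : `|history r y u - history r y' u| <= D u by apply: hist; rewrite u0.
    have DuT : D u <= D T by rewrite Dmono//; case/andP : uT.
    have Hu' : `|history r y u - history r y' u| < rho.
      by rewrite (le_lt_trans Hu)// (le_lt_trans DuT).
    rewrite -(subrKA (F (sigma u w') (history r y u))).
    rewrite (le_trans (ler_normD _ _))//.
    apply: (@le_trans _ _ (l * D u + l * a / 2)).
      apply: lerD; last exact: Hclose.
      have := Hlip u uT (history r y' u) (history r y u) Hu'.
      rewrite subrr normr0 => /(_ rho0) /le_trans; apply.
      by rewrite distrC ler_pM2l.
    rewrite (_ : 3 / 2 * l * D u = l * D u + l * D u / 2); last by field.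
    by rewrite lerD2l// ler_wpM2r// ler_pM2l// -D0 Dmono// ltW.
  have z0 : `|y' 0 - y 0| < a / 2 by apply: zneg; rewrite lexx oppr_le0 ltW.
  have Dt1' : D t1 <= `|y' t1 - y t1| by rewrite -subr_ge0.
  have := lerB_dist (y' t1 - y t1) (y' 0 - y 0).
  have Da : a <= D t1 by rewrite -D0 Dmono// ltW.
  rewrite D0; lra.
move=> t /andP[rt tT].
have [t0|t0] := leP 0 t.
  rewrite (le_trans _ (ltW DTe))// (le_trans _ (Dmono _ _ tT))// ltW// main//.
  by rewrite t0.
rewrite (le_trans _ (ltW DTe))// (le_trans _ (Dmono _ _ T0))// D0.
by rewrite (le_trans _ (ltW aa))// ltW// zneg// rt ltW.
Qed.

(** Stability with unperturbed data, for every tolerance e. *)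
Lemma solves_unique w phi y y' : solves w phi y -> solves w phi y' ->
  forall t, - r <= t -> y' t = y t.
Proof.
move=> ys ys' t rt; apply/eqP; rewrite -subr_eq0 -normr_le0.
apply/ler_addgt0Pr => e e0; rewrite add0r.
have T0 : 0 <= Num.max t 0 by rewrite le_max lexx orbT.
have [[U P] /= [Uw Pphi] UP] := solution_stability ys e0 T0.
have := UP (w, phi); rewrite /=.
move=> /(_ (conj (nbhs_singleton Uw) (nbhs_singleton Pphi)) y' ys' t); apply.
by rewrite rt le_max lexx.
Qed.

End delay_equation.

(** * Variation of constants *)

Section variation_of_constants.
Context {R : realType} {m : nat} (B : 'M[R]_m).

(** The function e^{-uB} w(u) has derivative e^{-uB} g(u). One factor K bounds this derivative, the
    other is paid when multiplying back by e^{tB}. *)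
Lemma variation_bound (K T : R) (w g : R -> 'cV[R]_m) (f df : R -> R) (t : R) :
  0 <= K ->
  (forall (u : R) (x : 'cV[R]_m), - T <= u <= T -> `|expmx (u *: B) *m x| <= K * `|x|) ->
  continuous w -> (forall u : R, 0 < u -> is_derive u 1 w (B *m w u + g u)) ->
  continuous f -> (forall u : R, 0 < u -> is_derive u 1 f (df u)) ->
  (forall u, 0 < u < t -> `|g u| <= df u) ->
  0 <= t <= T -> `|w t| <= K * (`|w 0| + K * (f t - f 0)).
Proof.
move=> K0 HK cw dw cf df' gdf /andP[t0 tT].
have T0 : 0 <= T by exact: le_trans tT.
have dN (u : R) : is_derive u 1 (fun t => expmx ((- t) *: B))
    (- (B *m expmx ((- u) *: B))).
  have := is_derive_expmx_comp B (-1) 0 u; rewrite scaleN1r mulN1r addr0.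
  by under eq_fun do rewrite mulN1r addr0.
pose v (u : R) := expmx ((- u) *: B) *m w u.
have dv (u : R) : 0 < u -> is_derive u 1 v (expmx ((- u) *: B) *m g u).
  move=> u0; have := is_derive_mulmx (dN u) (dw u u0).
  by rewrite mulmxDr mulmxA mulNmx expmx_commute addrA addNr add0r.
have cv : continuous v.
  move=> u; apply: (@continuous_mulmx _ _ _ _ _ (fun u : R => expmx ((- u) *: B)) w);
    last exact: cw.
  by apply/differentiable_continuous/derivable1_diffP; case: (dN u).
have vt : `|v t - v 0| <= K * f t - K * f 0.
  apply: (@mean_value_ineq R m v (fun u => expmx ((- u) *: B) *m g u)
    (fun u => K * f u) (fun u => K * df u)) => //.
  - by move=> u; apply: cvgMr; exact: cf.
  - by move=> u /andP[u0 _]; exact: dv.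
  - move=> u /andP[u0 _]; have := df' u u0 => ?.
    rewrite [X in is_derive _ _ X](_ : _ = K \*: f)//; exact: is_deriveZ.
  - move=> u /andP[u0 ut]; apply: le_trans (HK _ _ _) _.
      by rewrite lerN2 (le_trans (ltW ut))//= (le_trans _ T0)// oppr_le0 ltW.
    by rewrite ler_wpM2l// gdf// u0.
have v0 : v 0 = w 0 by rewrite /v oppr0 expmx0 mul1mx.
have -> : w t = expmx (t *: B) *m v t by rewrite /v mulmxA expmxNK mul1mx.
apply: le_trans (HK _ _ _) _; first by rewrite tT (le_trans _ t0)// oppr_le0.
rewrite ler_wpM2l// -(subrK (v 0) (v t)) addrC (le_trans (ler_normD _ _))// v0.
by rewrite lerD2l mulrBr -v0.
Qed.

Lemma matrix_bound : exists2 K : R, 0 <= K & forall x : 'cV[R]_m, `|B *m x| <= K * `|x|.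
Proof.
exists (m%:R * \sum_ij `|B ij.1 ij.2|); first by rewrite mulr_ge0// sumr_ge0.
move=> x; apply: mulmx_norm_le => i j.
by rewrite (bigD1 (i, j))//= lerDl sumr_ge0.
Qed.

End variation_of_constants.

(** * Existence above a subsolution by monotone iteration *)

Section monotone_iteration.
Context {R : realType} {Omega : metricType R} {r : R} {m : nat}.
Context {sigma : R -> Omega -> Omega} {F : Omega -> Cseg r m -> 'cV[R]_m}.
Context (r0 : 0 < r) (sigma_flow : continuous_flow sigma).
Context (F_continuous : continuous (fun p : Omega * Cseg r m => F p.1 p.2)).
Context {B : 'M[R]_m} (qB : quasipositive B).
Context (F_bounded : forall X1 : set (Cseg r m), bounded_set X1 ->
  bounded_set [set F w phi | w in [set: Omega] & phi in X1]).
Context (F_mono : forall w phi psi, exp_le B phi psi ->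
  vle (B *m (psi 0 - phi 0)) (F w psi - F w phi)).
Context (F_sublin : forall w psi (lambda : R), exp_le B 0 psi -> 0 <= lambda <= 1 ->
  vle (lambda *: F w psi) (F w (lambda *: psi))).
Implicit Types (w : Omega) (phi psi : Cseg r m) (y z : R -> 'cV[R]_m) (T : R).

(* Unlike F itself, monotone for the exponential order. *)
Definition Fres w psi : 'cV[R]_m := F w psi - B *m psi 0.

Lemma F_boundedE (M : R) : exists2 C : R, 0 <= C &
  forall w psi, `|psi| <= M -> `|F w psi| <= C.
Proof.
have : bounded_set [set psi : Cseg r m | `|psi| <= M].
  by exists M; split; [exact: num_real|move=> x Mx psi /= /le_trans; apply; exact: ltW].
move/F_bounded => [C [_ HC]]; exists (`|C| + 1); first by rewrite addr_ge0.
move=> w psi HM; apply: (HC (`|C| + 1)).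
  by rewrite (le_lt_trans (ler_norm _))// ltrDl.
by exists w => //; exists psi.
Qed.

Lemma Fres_mono w phi psi : exp_le B phi psi -> vle (Fres w phi) (Fres w psi).
Proof.
move=> /(F_mono w) H; apply/vle0P; move/vle0P : H.
by rewrite /Fres mulmxBr opprB => H i; have := H i; rewrite !mxE; lra.
Qed.

(** Sublinearity with lambda = 0 gives F(w, 0) >= 0, and monotonicity of [Fres] extends this to the
    cone. *)
Lemma Fres_ge0 w psi : exp_cone B psi -> vle 0 (Fres w psi).
Proof.
move=> psi0; have F0 : vle 0 (Fres w 0).
  have := F_sublin (psi := 0) (lambda := 0) w; rewrite lexx ler01 /Fres mulmx0 subr0.
  rewrite !scale0r; apply => //; exact: exp_le_refl.
by apply: vle_trans F0 _; apply: Fres_mono; rewrite exp_le0.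
Qed.

Lemma Fres_sublin w psi (a : R) : exp_cone B psi -> 0 <= a <= 1 ->
  vle (a *: Fres w psi) (Fres w (a *: psi)).
Proof.
rewrite -exp_le0 => psi0 a01; have := F_sublin w psi0 a01.
by rewrite /Fres CZ -scalemxAr scalerBr => H i; have := H i; rewrite !mxE; lra.
Qed.

(* Sublinearity at 1 / max(1, |psi|) turns boundedness on the unit ball into
   linear growth on the cone. *)
Lemma Fres_growth : exists2 C : R, 0 < C &
  forall w psi, exp_cone B psi -> `|Fres w psi| <= C * (1 + `|psi|).
Proof.
have [C C0 HC] := F_boundedE 1; have [K K0 HK] := matrix_bound B.
exists (C + K + 1); first by rewrite ltr_wpDl// addr_ge0.
move=> w psi psi0; pose n : R := Num.max 1 `|psi|.
have n1 : 1 <= n by rewrite le_max lexx.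
have n0 : 0 < n by rewrite (lt_le_trans ltr01).
have npsi : `|psi| <= n by rewrite le_max lexx orbT.
have nle : n <= 1 + `|psi|.
  by rewrite ge_max lerDl normr_ge0 lerDr ler01.
apply: (@le_trans _ _ ((C + K + 1) * n)); last first.
  by rewrite ler_wpM2l// addr_ge0// addr_ge0.
apply: norm_le_coord => [|i]; first by rewrite mulr_ge0 ?(ltW n0)// addr_ge0// addr_ge0.
have := Fres_ge0 w psi0 i; rewrite mxE => Gi0; rewrite ger0_norm//.
have ninv : 0 <= n^-1 <= 1 by rewrite invr_ge0 ltW//= invf_le1.
have := F_sublin w (_ : exp_le B 0 psi) ninv; rewrite exp_le0 => /(_ psi0 i).
rewrite mxE ler_pdivrMl// => Fi.
have Fin : F w (n^-1 *: psi) i ord0 <= C.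
  rewrite (le_trans (ler_norm _))// (le_trans (coord_le_norm _ _))// HC//.
  by rewrite normrZ gtr0_norm ?invr_gt0// ler_pdivrMl// mulr1.
have Bi : - (B *m psi 0) i ord0 <= K * n.
  rewrite (le_trans (ler_norm _))// normrN (le_trans (coord_le_norm _ _))//.
  rewrite (le_trans (HK _))// ler_wpM2l// (le_trans (le_Cnorm _ _))//.
rewrite /Fres !mxE -[X in _ - X](_ : (B *m psi 0) i ord0 = _); last by rewrite mxE.
have : n * F w (n^-1 *: psi) i ord0 <= n * C by rewrite ler_pM2l.
rewrite !mulrDl mul1r => H; lra.
Qed.

Definition iteration_step w phi y z : Prop :=
  [/\ continuous z, forall s, - r <= s <= 0 -> z s = phi s &
    forall t : R, 0 < t ->
      is_derive t 1 z (B *m z t + Fres (sigma t w) (history r y t))].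

Lemma Fres_continuous w y : continuous y ->
  continuous (fun t => Fres (sigma t w) (history r y t)).
Proof.
move=> cy t; apply: cvgB; first exact: (@rhs_continuous _ _ _ _ _ _ sigma_flow F_continuous w y cy).
have cy0 : continuous (fun t => (history r y t) 0).
  rewrite (_ : (fun t => _) = y)//; apply/funext => u.
  by rewrite historyE ?addr0// lexx oppr_le0 ltW.
by apply: (@continuous_mulmx _ _ _ _ _ (fun=> B) _ t); [exact: cst_continuous|exact: cy0].
Qed.

(** Variation of constants, Z(t) = e^{tB}(phi(0) + H(t)) with H an antiderivative of e^{-tB} g(t),
    glued to phi at time 0. *)
Lemma linear_ode_exists phi (g : R -> 'cV[R]_m) : continuous g -> exists z,
  [/\ continuous z, forall s, - r <= s <= 0 -> z s = phi s &
    forall t : R, 0 < t -> is_derive t 1 z (B *m z t + g t)].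
Proof.
move=> cg.
have dE (u : R) := is_derive_expmx B u.
have cE (a : R) : continuous (fun u => expmx ((a * u) *: B)).
  move=> u; apply/differentiable_continuous/derivable1_diffP.
  have [+ _] := is_derive_expmx_comp B a 0 u.
  by under eq_fun do rewrite addr0.
have cmul (a : R) (x : R -> 'cV[R]_m) : continuous x ->
    continuous (fun u => expmx ((a * u) *: B) *m x u).
  by move=> cx u; apply: (@continuous_mulmx _ _ _ _ _ (fun u : R => expmx ((a * u) *: B)) x u);
    [exact: cE|exact: cx].
have [H [cH H0 dH]] := antiderivative (cmul (-1) _ cg).
pose Z (t : R) := expmx (t *: B) *m (phi 0 + H t).
have cZ : continuous Z.
  rewrite (_ : Z = fun t => expmx ((1 * t) *: B) *m (phi 0 + H t)).
    by apply: cmul => t; apply: cvgD; [exact: cvg_cst|exact: cH].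
  by apply/funext => t; rewrite mul1r.
(* Both clamped summands are continuous on the line, and on either side of 0 one of them is
   constant; the gluing needs no separate argument at 0. *)
pose z (t : R) := phi (Num.max (- r) (Num.min t 0)) + (Z (Num.max t 0) - phi 0).
have Z0 : Z 0 = phi 0 by rewrite /Z expmx0 mul1mx H0 addr0.
have zE t : 0 <= t -> z t = Z t.
  move=> t0; rewrite /z (min_r t0) max_r ?oppr_le0 ?ltW// (max_l t0).
  by rewrite addrC subrK.
exists z; split.
- move=> t; apply: cvgD; first exact: (@Cseg_clamp_continuous _ _ _ phi (ltW r0)).
  apply: cvgB; last exact: cvg_cst.
  apply: (@continuous_comp _ _ _ (fun x : R => Num.max x 0) Z); last exact: cZ.
  by apply: (@continuous_max _ _ id (cst 0)); [exact: cvg_id|exact: cvg_cst].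
- move=> s /andP[rs s0]; rewrite /z (max_r s0) Z0 subrr addr0.
  by rewrite (min_l s0) max_r.
move=> t t0; rewrite (zE _ (ltW t0)).
have dZ : is_derive t 1 Z (B *m Z t + g t).
  have dH' : is_derive t 1 (fun t => phi 0 + H t)
      (expmx ((-1 * t) *: B) *m g t).
    have := dH t t0 => ?.
    rewrite -[X in is_derive _ _ _ X]add0r; exact: is_deriveD.
  have := is_derive_mulmx (dE t) dH'.
  by rewrite [in X in _ -> X]mulmxA mulN1r mulmxA expmxNK mul1mx.
apply: near_eq_is_derive dZ; near=> s; rewrite zE//.
by apply: ltW; near: s; exact: lt_nbhsr.
Unshelve. all: by end_near. Qed.

Lemma iteration_step_exists w phi y : continuous y -> exists z, iteration_step w phi y z.
Proof. by move=> cy; exact: linear_ode_exists (@Fres_continuous w y cy). Qed.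

(** One barrier D that an iteration step maps below itself bounds all iterates at once; it depends
    on phi only through the bound N1. *)
Lemma iteration_step_bound T (N1 : R) : 0 <= T -> exists D : R -> R,
  [/\ forall s t, s <= t -> D s <= D t, N1 <= D 0 &
    forall w phi y z, `|phi| <= N1 -> continuous y -> pos_trajectory r B y ->
      (forall s, - r <= s <= 0 -> y s = phi s) -> iteration_step w phi y z ->
      (forall t, 0 <= t <= T -> `|y t| <= D t) ->
      forall t, 0 <= t <= T -> `|z t| <= D t].
Proof.
move=> T0; have [C C0 HC] := Fres_growth; have [K K1 HK] := expmx_bound B T.
have K0 : 0 < K by rewrite (lt_le_trans ltr01).
(* In the variation of constants bound, N >= 2K|N1| keeps the contribution of the initial value
   below D/2, and the exponent L = 4K^2 C keeps that of the forcing below D/2. The bound N >= 1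
   absorbs the constant 1 of the growth estimate, so that 1 + |y_u| <= 2D. *)
pose N : R := Num.max 1 (2 * K * `|N1|).
pose L : R := 4 * K ^+ 2 * C.
have N0 : 1 <= N by rewrite le_max lexx.
have L0 : 0 < L by rewrite !mulr_gt0// exprn_gt0.
have NN1 : 2 * K * `|N1| <= N by rewrite le_max lexx orbT.
pose D (t : R) : R := N * expR (L * t).
have Ngt0 : 0 < N by rewrite (lt_le_trans ltr01).
have Dmono s t : s <= t -> D s <= D t.
  by move=> st; rewrite /D ler_pM2l// ler_expR ler_pM2l.
have D0 : D 0 = N by rewrite /D mulr0 expR0 mulr1.
have dD (u : R) : is_derive u 1 D (L * D u).
  have d2 : is_derive u 1 (fun t => expR (L * t)) (expR (L * u) * L).
    apply: (@is_derive1_comp _ expR (fun t => L * t)) => //.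
    rewrite [X in is_derive _ _ X](_ : _ = L \*: id)//.
    by apply: is_derive_eq; rewrite /GRing.scale/= mulr1.
  change (is_derive u 1 (N \*: (fun t => expR (L * t))) (L * D u)).
  by apply: is_derive_eq; rewrite /GRing.scale/= /D; ring.
have N1N : N1 <= N.
  rewrite (le_trans (ler_norm _))// (le_trans _ NN1)// ler_peMl//.
  by move: K1; lra.
exists D; split; [exact: Dmono|by rewrite D0|].
move=> w phi y z phiN cy ypos yphi [cz zphi dz] yD t tT.
have hist u : 0 <= u <= T -> `|history r y u| <= D u.
  move=> /andP[u0 uT]; apply: history_norm_le => //.
    by rewrite mulr_ge0 ?expR_ge0 ?ltW.
  move=> s /andP[rs s0]; have [su|su] := leP 0 (u + s).
    have us : u + s <= u by rewrite gerDl.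
    by rewrite (le_trans (yD _ _)) ?su ?(le_trans us)// Dmono.
  rewrite yphi; last by rewrite (ltW su) andbT -[- r]add0r lerD.
  rewrite (le_trans (le_Cnorm _ _))// (le_trans phiN)// (le_trans N1N)//.
  by rewrite -D0 Dmono.
have cD : continuous (fun u => 2 * C / L * D u).
  move=> u; apply: cvgMr; apply/differentiable_continuous/derivable1_diffP.
  by case: (dD u).
have := @variation_bound R m B K T z (fun u => Fres (sigma u w) (history r y u))
  (fun u => 2 * C / L * D u) (fun u => 2 * C * D u) t (ltW K0) HK cz dz cD.
have dD' (u : R) : 0 < u -> is_derive u 1 (fun u => 2 * C / L * D u) (2 * C * D u).
  move=> _; have := dD u => ?.
  rewrite [X in is_derive _ _ X](_ : _ = (2 * C / L) \*: D)//.
  by apply: is_derive_eq; rewrite /GRing.scale/=; field; rewrite gt_eqF.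
move=> /(_ dD') H; apply: le_trans (H _ tT) _.
  move=> u /andP[u0 ut]; have uT : 0 <= u <= T.
    by case/andP : tT => _ tT; rewrite (ltW u0) (le_trans (ltW ut)).
  rewrite (le_trans (HC _ _ _))//.
    by apply: (exp_cone_history cy ypos); exact: ltW.
  rewrite [leRHS](_ : _ = C * (D u + D u)); last by ring.
  rewrite ler_pM2l// lerD ?hist//.
  by rewrite (le_trans N0)// -D0 Dmono// ltW.
have z0 : `|z 0| <= `|N1|.
  rewrite (zphi 0); last by rewrite lexx oppr_le0 ltW.
  by apply: le_trans (le_Cnorm _ _) _; exact: le_trans phiN (ler_norm _).
have D0t : D 0 <= D t by apply: Dmono; case/andP : tT.
have KN : K * `|z 0| <= K * `|N1| by rewrite ler_pM2l.
have DE : K * (K * (2 * C / L * D t)) = D t / 2.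
  by rewrite /L; field; rewrite !gt_eqF.
have DE0 : K * (K * (2 * C / L * D 0)) >= 0.
  by rewrite D0 !mulr_ge0// ?ltW// invr_gt0.
rewrite mulrDr !mulrBr DE; rewrite D0 in D0t DE0 *.
move: KN NN1 DE0 D0t; rewrite -[2 * K * _]mulrA.
move: (K * `|z 0|) (K * `|N1|) (K * (K * _)) (D t) => x1 x2 x3 x4.
lra.
Qed.

(** The difference solves a linear equation with nonnegative forcing g2 - g1. *)
Lemma comparison y1 y2 (g1 g2 : R -> 'cV[R]_m) : continuous y1 -> continuous y2 ->
  (forall t : R, 0 < t -> is_derive t 1 y1 (B *m y1 t + g1 t)) ->
  (forall t : R, 0 < t -> is_derive t 1 y2 (B *m y2 t + g2 t)) ->
  (forall t : R, 0 < t -> vle (g1 t) (g2 t)) ->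
  exp_cone B (toC r (y2 \- y1) : Cseg r m) -> pos_trajectory r B (y2 \- y1).
Proof.
move=> c1 c2 d1 d2 g12; apply: (@pos_trajectory_ode _ _ r B qB (y2 \- y1) (g2 \- g1)).
- by move=> t; apply: cvgB; [exact: c2|exact: c1].
- move=> t t0; have := d1 t t0; have := d2 t t0 => ? ?.
  rewrite [X in is_derive _ _ _ X](_ : _ =
    B *m y2 t + g2 t - (B *m y1 t + g1 t)); first exact: is_deriveB.
  by rewrite /= mulmxBr opprD addrACA.
- by move=> t /g12 /vle0P.
- exact: ltW.
Qed.

Lemma toC_segment phi y : continuous y -> (forall s, - r <= s <= 0 -> y s = phi s) ->
  toC r y = phi.
Proof.
move=> cy yphi; apply: Cseg_ext => s rs; rewrite toCE ?yphi//.
exact: continuous_subspaceT.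
Qed.

Lemma cvg_coord (T' : Type) (G : set_system T') (FG : Filter G) (f : T' -> 'cV[R]_m)
    (x : 'cV[R]_m) :
  (forall i, f t i ord0 @[t --> G] --> x i ord0) -> f t @[t --> G] --> x.
Proof.
move=> H; apply/cvgrPdist_le => e e0.
have : \forall t \near G, forall i, `|x i ord0 - f t i ord0| <= e.
  by apply: filter_forall => i; have /cvgrPdist_le := H i; exact.
apply: filterS => t Ht; apply: norm_le_coord => [|i]; first exact: ltW.
by rewrite !mxE.
Qed.

(** The iterates start at v and increase, since v is a subsolution and the step is monotone. The
    barrier bounds them, the equation makes them equi-Lipschitz, so they converge uniformly on
    bounded intervals to a fixed point of the step. The last clause makes y least among the
    solutions above v; allowing a larger initial value psi there is what later yields monotonicity
    in the initial value. *)
Lemma subsolution_solution w phi v (h : R -> 'cV[R]_m) : exp_cone B phi ->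
  continuous v -> (forall s, - r <= s <= 0 -> v s = phi s) -> pos_trajectory r B v ->
  (forall t : R, 0 < t -> is_derive t 1 v (B *m v t + h t)) ->
  (forall t : R, 0 < t -> vle (h t) (Fres (sigma t w) (history r v t))) ->
  exists y, [/\ solves (sigma := sigma) (F := F) w phi y, pos_trajectory r B y,
    pos_trajectory r B (y \- v) &
    forall psi z, solves (sigma := sigma) (F := F) w psi z -> pos_trajectory r B z ->
      exp_le B phi psi -> pos_trajectory r B (z \- v) -> pos_trajectory r B (z \- y)].
Proof.
move=> phi0 cv vphi vpos dv hv.
have r00 : 0 <= r by exact: ltW.
(* The step is made a total function, with a dummy value off the continuous functions, so that it
   can be iterated. *)
have /choice[f fP] : forall y, exists z, continuous y -> iteration_step w phi y z.
  move=> y; have [cy|ncy] := pselect (continuous y); last by exists y.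
  by have [z zP] := iteration_step_exists w phi cy; exists z.
pose Y n := iter n f v.
have YP n : [/\ continuous (Y n), forall s, - r <= s <= 0 -> Y n s = phi s &
    pos_trajectory r B (Y n)].
  elim: n => [|n [cY sY pY]]; first by split.
  have [cZ sZ dZ] := fP _ cY; split=> //.
  apply: (@pos_trajectory_ode _ _ r B qB _ _ cZ dZ) => //.
    by move=> t t0; apply: Fres_ge0; apply: exp_cone_history => //; exact: ltW.
  by rewrite (toC_segment cZ sZ).
have cY n : continuous (Y n) by case: (YP n).
have sY n s : - r <= s <= 0 -> Y n s = phi s by case: (YP n) => _ + _; exact.
have pY n : pos_trajectory r B (Y n) by case: (YP n).
have Ystep n : iteration_step w phi (Y n) (Y n.+1) by exact: fP.
have seg0 y1 y2 : continuous y1 -> continuous y2 ->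
    (forall s, - r <= s <= 0 -> y1 s = phi s) ->
    (forall s, - r <= s <= 0 -> y2 s = phi s) ->
    toC r (y2 \- y1) = 0 :> Cseg r m.
  move=> c1 c2 s1 s2; apply: toC_segment.
    by move=> t; apply: cvgB; [exact: c2|exact: c1].
  by move=> s rs /=; rewrite s1// s2// subrr.
have Ymono n : pos_trajectory r B (Y n.+1 \- Y n).
  elim: n => [|n IH].
    have [cZ sZ dZ] := Ystep 0%N.
    apply: (comparison cv cZ dv dZ hv).
    by rewrite (seg0 _ _ cv cZ vphi sZ); exact: exp_cone0.
  have [cZ sZ dZ] := Ystep n.+1; have [cZ' sZ' dZ'] := Ystep n.
  apply: (comparison cZ' cZ dZ' dZ).
    by move=> t t0; apply: Fres_mono; apply: exp_le_history => //; exact: ltW.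
  by rewrite (seg0 _ _ cZ' cZ sZ' sZ); exact: exp_cone0.
have Yle n t : - r <= t -> vle (Y n t) (Y n.+1 t).
  by move=> rt; apply/vle0P; case: (Ymono n) => + _; exact.
have [C C0 HC] := Fres_growth; have [Kb Kb0 HKb] := matrix_bound B.
(* The Lipschitz bound starts at index 1: the forcing h of v is bounded only from above, whereas
   later iterates have forcing controlled by the growth of [Fres]. *)
have bounds T : 0 <= T -> exists M L : R, [/\ 0 <= M, 0 <= L,
    forall n t, - r <= t <= T -> `|Y n t| <= M &
    forall n s t, 0 <= s <= T -> 0 <= t <= T -> `|Y n.+1 t - Y n.+1 s| <= L * `|t - s|].
  move=> T0.
  have : compact (v @` `[0, T]).
    apply: continuous_compact; last exact: segment_compact.
    exact: continuous_subspaceT.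
  move=> /compact_bounded[Mv [_ /(_ (`|Mv| + 1))]].
  rewrite (le_lt_trans (ler_norm _)) ?ltrDl// => /(_ isT) Hv.
  have [D [Dmono D0 HD]] := @iteration_step_bound T (`|phi| + (`|Mv| + 1)) T0.
  have phiN : `|phi| <= `|phi| + (`|Mv| + 1) by rewrite lerDl addr_ge0.
  have YD n t : 0 <= t <= T -> `|Y n t| <= D t.
    elim: n t => [|n IH] t tT.
      rewrite (le_trans (Hv _ _))//; first by exists t => //=; rewrite in_itv.
      rewrite (le_trans _ (Dmono 0 t _))//; last by case/andP : tT.
      by rewrite (le_trans _ D0)// lerDr.
    exact: (HD _ _ _ _ phiN (cY n) (pY n) (sY n) (Ystep n) IH).
  have DT0 : 0 <= D T by rewrite (le_trans _ (YD 0%N T _))// T0 lexx.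
  pose M := D T + `|phi|.
  have M0 : 0 <= M by rewrite addr_ge0.
  have YM n t : - r <= t <= T -> `|Y n t| <= M.
    move=> /andP[rt tT]; have [t0|t0] := leP 0 t.
      rewrite (le_trans (YD n t _)) ?t0// (le_trans (Dmono t T tT))//.
      by rewrite lerDl.
    rewrite sY ?rt ?(ltW t0)// (le_trans (le_Cnorm _ _))//.
    by rewrite lerDr.
  exists M, (Kb * M + C * (1 + M)); split=> //.
    by apply: addr_ge0; [exact: mulr_ge0|apply: mulr_ge0; [exact: ltW|exact: addr_ge0]].
  move=> n.
  have lip s t : 0 <= s -> s <= t -> t <= T ->
      `|Y n.+1 t - Y n.+1 s| <= (Kb * M + C * (1 + M)) * (t - s).
    move=> s0 st tT; have [cZ sZ dZ] := Ystep n.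
    apply: (mean_value_bound st cZ) => u /andP[su ut].
      exact: (dZ u (le_lt_trans s0 su)).
    have u0 : 0 < u by exact: le_lt_trans su.
    have uT : u <= T by rewrite (le_trans (ltW ut)).
    rewrite (le_trans (ler_normD _ _))// lerD//.
      rewrite (le_trans (HKb _))// ler_wpM2l// YM// uT andbT.
      by rewrite (le_trans _ (ltW u0))// oppr_le0.
    rewrite (le_trans (HC _ _ _))//.
      by apply: exp_cone_history => //; exact: ltW.
    rewrite ler_pM2l// lerD2l; apply: history_norm_le => // x /andP[rx x0].
    rewrite YM// (_ : u + x <= T) ?andbT; first by rewrite -[- r]add0r lerD// ltW.
    by rewrite (le_trans _ uT)// gerDl.
  move=> s t /andP[s0 sT] /andP[t0 tT]; have [st|/ltW ts] := leP s t.
    by rewrite (ger0_norm (_ : 0 <= t - s)) ?subr_ge0// lip.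
  by rewrite distrC [X in _ * X]distrC (ger0_norm (_ : 0 <= s - t)) ?subr_ge0// lip.
have cvgY t i : - r <= t -> cvgn (fun n => Y n t i ord0).
  move=> rt; have T0 : 0 <= Num.max t 0 by rewrite le_max lexx orbT.
  have [M [L [M0 L0 HM _]]] := bounds _ T0.
  apply: nondecreasing_is_cvgn.
    by apply/nondecreasing_seqP => n; exact: Yle.
  exists M => _ [n _ <-]; rewrite (le_trans (ler_norm _))//.
  by rewrite (le_trans (coord_le_norm _ _))// HM// rt le_max lexx.
pose y (t : R) : 'cV[R]_m := \col_i limn (fun n => Y n (Num.max t (- r)) i ord0).
have Ycv t : - r <= t -> Y n t @[n --> \oo] --> y t.
  move=> rt; apply: cvg_coord => i; rewrite mxE max_l//; exact: cvgY.
have ys s : - r <= s <= 0 -> y s = phi s.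
  move=> rs; have := Ycv s; case/andP : (rs) => rs' _ => /(_ rs').
  under eq_fun do rewrite sY//.
  move=> H; exact: (cvg_unique (@norm_hausdorff _ _) H (cvg_cst _)).
have ylip T : 0 <= T -> exists2 L : R, 0 <= L & forall s t, 0 <= s <= T -> 0 <= t <= T ->
    `|y t - y s| <= L * `|t - s|.
  move=> T0; have [M [L [M0 L0 _ HL]]] := bounds T T0; exists L => // s t sT tT.
  have rneg u : 0 <= u <= T -> - r <= u.
    by move=> /andP[u0 _]; rewrite (le_trans _ u0)// oppr_le0.
  have H : `|Y n t - Y n s| @[n --> \oo] --> `|y t - y s|.
    by apply: cvg_norm; apply: cvgB; apply: Ycv; exact: rneg.
  apply: (cvgr_to_le H); exists 1%N => // -[//|n] _ /=; exact: HL.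
have cy : continuous y.
  (* On [-r,0] the limit is phi, which is merely continuous, and the Lipschitz bounds hold only on
     [0,T]. The sum of two clamped pieces separates the two regimes. *)
  pose y' (s : R) := phi (Num.max (- r) (Num.min s 0)) + (y (Num.max s 0) - phi 0).
  have -> : y = y'.
    apply/funext => t; rewrite /y'; have [t0|/ltW t0] := leP 0 t.
      by rewrite max_r ?oppr_le0// addrC subrK.
    rewrite (ys 0) ?lexx ?oppr_le0 ?r00// subrr addr0.
    have [rt|/ltW rt] := leP (- r) t; first by rewrite ys// rt.
    rewrite -(ys (- r)); last by rewrite lexx oppr_le0.
    by apply/matrixP => i j; rewrite !mxE (max_r rt) maxxx.
  move=> t; apply: cvgD; first exact: (@Cseg_clamp_continuous _ _ _ phi r00).
  apply: cvgB; last exact: cvg_cst.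
  have T0 : 0 <= `|t| + 1 by rewrite addr_ge0.
  have [L L0 HL] := ylip _ T0.
  have L1 : 0 < L + 1 by rewrite ltr_wpDl.
  apply/cvgrPdist_le => e e0.
  have d0 : 0 < Num.min 1 (e / (L + 1)) by rewrite lt_min ltr01 divr_gt0.
  apply: filterS (near_dist_le t d0) => s.
  rewrite le_min => /andP[ts1 tse].
  have mono : `|Num.max t 0 - Num.max s 0| <= `|t - s|.
    rewrite !maxr_absE !subr0 !addr0.
    rewrite (_ : _ - _ = ((t - s) + (`|t| - `|s|)) / 2); last by field.
    rewrite normrM (ger0_norm (_ : 0 <= 2^-1)) ?invr_ge0// ler_pdivrMr//.
    rewrite (le_trans (ler_normD _ _))// mulr_natr mulr2n lerD2l.
    exact: ler_dist_dist.
  apply: le_trans (HL _ _ _ _) _.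
  - rewrite le_max lexx orbT/= ge_max T0 andbT.
    have := ler_distD t s 0; rewrite !subr0 => H.
    rewrite (le_trans (ler_norm _))// -[s](subrK t) addrC (le_trans (ler_normD _ _))//.
    by rewrite lerD2l distrC.
  - rewrite le_max lexx orbT/= ge_max T0 andbT (le_trans (ler_norm _))//.
    by rewrite lerDl.
  rewrite (le_trans (ler_wpM2l L0 mono))//.
  rewrite (@le_trans _ _ ((L + 1) * `|t - s|))//; first by rewrite ler_wpM2r// lerDl.
  by rewrite mulrC -ler_pdivlMr.
(* Pointwise convergence becomes uniform: near each t the iterates and the limit vary by at most e/2
   in total, thanks to their Lipschitz constants. *)
have Ucv T e : 0 <= T -> 0 < e -> exists N, forall n, (N <= n)%N ->
    forall t, - r <= t <= T -> `|Y n t - y t| <= e.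
  move=> T0 e0; have [M [L [M0 L0 _ HL]]] := bounds T T0; have [L' L0' HL'] := ylip T T0.
  have L2 : 0 < L + L' + 1 by rewrite ltr_wpDl// addr_ge0.
  have d0 : 0 < e / 2 / (L + L' + 1) by rewrite !divr_gt0.
  have e2 : 0 < e / 2 by rewrite divr_gt0.
  have /compact_near_coveringP K := @segment_compact R 0 T.
  have : \forall n \near \oo, `[0, T]%classic `<=`
      (fun t => 0 <= t <= T -> `|Y n t - y t| <= e).
    apply: K => t; rewrite /= in_itv/= => tT.
    have rt : - r <= t by case/andP : tT => t0 _; rewrite (le_trans _ t0)// oppr_le0.
    have Hn : \forall n \near \oo, `|y t - Y n t| <= e / 2 /\ (1 <= n)%N.
      apply: filterI; last by exists 1%N.
      by have /cvgrPdist_le := Ycv t rt; exact.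
    apply: (near_prodP (near_dist_le t d0) Hn) => s n ts [Hn' n1] sT.
    case: n n1 Hn' => // n _ Hn'.
    rewrite -(subrKA (Y n.+1 t)) (le_trans (ler_normD _ _))//.
    rewrite -(subrKA (y t) (Y n.+1 t)).
    have H1 := HL n t s tT sT; have H2 := HL' s t sT tT.
    have H3 : (L + L' + 1) * `|t - s| <= e / 2 by rewrite mulrC -ler_pdivlMr.
    have H4 := ler_normD (Y n.+1 t - y t) (y t - y s).
    have ts0 : 0 <= `|t - s| by [].
    rewrite distrC in Hn'; rewrite [`|s - t|]distrC in H1.
    move: H3; rewrite !mulrDl mul1r => H3.
    lra.
  move=> [N _ HN]; exists N => n Nn t /andP[rt tT]; have [t0|t0] := leP 0 t.
    by apply: (HN n Nn); rewrite /= ?in_itv/= t0 tT.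
  have st : - r <= t <= 0 by rewrite rt ltW.
  by rewrite sY// ys// subrr normr0 ltW.
have hcv T e : 0 <= T -> 0 < e -> exists N, forall n, (N <= n)%N ->
    forall t, 0 <= t <= T -> `|history r (Y n) t - history r y t| <= e.
  move=> T0 e0; have [N HN] := Ucv T e T0 e0; exists N => n Nn t /andP[t0 tT].
  apply: Cnorm_le => [|s /[dup] rs /andP[rs' s0]]; first exact: ltW.
  rewrite CB !historyE// HN// -[- r]add0r lerD//=.
  by rewrite (le_trans _ tT)// gerDl.
have Fcv T e : 0 <= T -> 0 < e -> exists N, forall n, (N <= n)%N ->
    forall t, 0 <= t <= T ->
    `|Fres (sigma t w) (history r y t) - Fres (sigma t w) (history r (Y n) t)| <= e.
  move=> T0 e0.
  have e2 : 0 < e / 2 by rewrite divr_gt0.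
  have e4 : 0 < e / 4 by rewrite divr_gt0.
  have /compact_near_coveringP K := @segment_compact R 0 T.
  have : \forall n \near \oo, `[0, T]%classic `<=` (fun t => 0 <= t <= T ->
      `|F (sigma t w) (history r y t) - F (sigma t w) (history r (Y n) t)| <= e / 2).
    apply: K => t; rewrite /= in_itv/= => tT.
    have [[U P] /= [Uw /nbhs_normE[d d0 HP]] UP] :=
      F_near F_continuous (sigma t w) (history r y t) e4.
    have [[A W] /= [At Ww] AW] := flow_continuous sigma_flow Uw.
    have d3 : 0 < d / 3 by rewrite divr_gt0.
    have hy : \forall s \near t, `|history r y t - history r y s| <= d / 3.
      by have /cvgrPdist_le := @history_continuous R r m y cy t; exact.
    have [N HN] := hcv T _ T0 d3.
    have Hn : \forall n \near \oo, (N <= n)%N by exists N.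
    apply: (near_prodP (filterI At hy) Hn) => s n [As hs] Nn sT.
    have Us : U (sigma s w) := AW (s, w) (conj As (nbhs_singleton Ww)).
    have dd : d / 3 < d by rewrite ltr_pdivrMr// ltr_pMr// ltr1n.
    have P1 : P (history r y s) by apply: HP; exact: le_lt_trans hs dd.
    have P2 : P (history r (Y n) s).
      apply: HP; rewrite -(subrKA (history r y s)) (le_lt_trans (ler_normD _ _))//.
      have := HN n Nn s sT; rewrite distrC => H.
      rewrite (@le_lt_trans _ _ (d / 3 + d / 3)) ?lerD//.
      by move: d0; lra.
    have := UP (sigma s w, history r y s) (conj Us P1).
    have := UP (sigma s w, history r (Y n) s) (conj Us P2).
    rewrite /= => H2 H1; rewrite -(subrKA (F (sigma t w) (history r y t))).
    rewrite (le_trans (ler_normD _ _))// distrC (le_trans (lerD H1 H2))//.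
    by rewrite le_eqVlt; apply/orP; left; apply/eqP; field.
  move=> [N _ HN].
  have eK : 0 < e / 2 / (Kb + 1) by rewrite !divr_gt0// ltr_wpDl.
  have [N' HN'] := hcv T _ T0 eK.
  exists (maxn N N') => n; rewrite geq_max => /andP[Nn Nn'] t tT.
  rewrite /Fres (_ : _ - _ - _ = (F (sigma t w) (history r y t) -
      F (sigma t w) (history r (Y n) t)) +
    B *m (history r (Y n) t - history r y t) 0); last first.
    by rewrite CB mulmxBr opprB [RHS]addrAC addrACA -!addrA; congr (_ + _); rewrite addrCA.
  rewrite (le_trans (ler_normD _ _))// (splitr e) lerD//.
    by apply: (HN n Nn) => //; rewrite /= in_itv.
  rewrite (le_trans (HKb _))//.
  rewrite (@le_trans _ _ ((Kb + 1) * `|history r (Y n) t - history r y t|))//.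
    by apply: ler_pM => //; [rewrite lerDl|exact: le_Cnorm].
  rewrite mulrC -ler_pdivlMr; last by rewrite ltr_wpDl.
  exact: HN'.
(* The limit y is not known to be differentiable, so it is compared with the result z of one more
   step. The forcing of z - Y_{n+1} tends to 0 uniformly, hence z is also the limit of the iterates,
   and y = z inherits the equation. *)
have [z [cz sz dz]] := iteration_step_exists w phi cy.
have zy t : 0 <= t -> z t = y t.
  move=> t0; apply/eqP; rewrite -subr_eq0 -normr_le0; apply/ler_addgt0Pr => e e0.
  rewrite add0r; have [K K1 HK] := expmx_bound B t.
  have K0 : 0 < K by rewrite (lt_le_trans ltr01).
  have e2 : 0 < e / 2 by rewrite divr_gt0.
  have t1 : 0 < t + 1 by rewrite ltr_wpDl.
  (* A forcing of size d contributes at most K^2 d t to the variation of constants bound; t + 1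
     replaces t to avoid dividing by 0. *)
  have d0 : 0 < e / 2 / (K * K * (t + 1)) by rewrite divr_gt0// !mulr_gt0.
  have [N HN] := Fcv t _ t0 d0; have [N' HN'] := Ucv t _ t0 e2.
  pose n := maxn N N'; have Nn : (N <= n)%N by rewrite leq_maxl.
  have Nn' : (N' <= n.+1)%N by rewrite ltnW// ltnS leq_maxr.
  set d := e / 2 / _ in d0 HN.
  have [cY' sY' dY'] := Ystep n.
  have r00' : - r <= (0 : R) <= 0 by rewrite oppr_le0 r00 lexx.
  have := @variation_bound R m B K t (z \- Y n.+1)
    ((fun u => Fres (sigma u w) (history r y u)) \-
     (fun u => Fres (sigma u w) (history r (Y n) u)))
    (fun u => d * u) (fun=> d) t (ltW K0) HK.
  have cd : continuous (fun u => d * u) by move=> u; apply: cvgMr; exact: cvg_id.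
  have dd (u : R) : 0 < u -> is_derive u 1 (fun u => d * u) d.
    move=> _; rewrite [X in is_derive _ _ X](_ : _ = d \*: id)//.
    by apply: is_derive_eq; rewrite /GRing.scale/= mulr1.
  have cw : continuous (z \- Y n.+1).
    by move=> u; apply: cvgB; [exact: cz|exact: cY'].
  have dw (u : R) : 0 < u -> is_derive u 1 (z \- Y n.+1)
      (B *m (z \- Y n.+1) u + ((fun u => Fres (sigma u w) (history r y u)) \-
     (fun u => Fres (sigma u w) (history r (Y n) u))) u).
    move=> u0; have := dz u u0; have := dY' u u0 => ? ?.
    rewrite [X in is_derive _ _ _ X](_ : _ =
      B *m z u + Fres (sigma u w) (history r y u) -
      (B *m Y n.+1 u + Fres (sigma u w) (history r (Y n) u))); first exact: is_deriveB.
    rewrite -[LHS]/(B *m (z u - Y n.+1 u) + (Fres (sigma u w) (history r y u) -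
      Fres (sigma u w) (history r (Y n) u))).
    by rewrite mulmxBr (opprD (B *m Y n.+1 u)) addrACA.
  move=> /(_ cw dw cd dd) H.
  have : `|z t - Y n.+1 t| <= e / 2.
    apply: le_trans (H _ _) _.
    - by move=> u /andP[u0 ut]; apply: (HN n Nn); rewrite (ltW u0) ltW.
    - by rewrite t0 lexx.
    rewrite -[(z \- Y n.+1) 0]/(z 0 - Y n.+1 0) sz// sY'// subrr normr0.
    rewrite mulr0 subr0 add0r mulrA mulrA.
    rewrite (@le_trans _ _ (K * K * d * (t + 1)))//.
      have KKd : 0 < K * K * d by apply: mulr_gt0 d0; exact: mulr_gt0.
      by rewrite (ler_pM2l KKd) lerDl ler01.
    by rewrite /d le_eqVlt; apply/orP; left; apply/eqP; field; rewrite !gt_eqF.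
  have := HN' _ Nn' t; rewrite lexx andbT (le_trans _ t0) ?oppr_le0// => /(_ isT).
  rewrite -(subrKA (Y n.+1 t)) => H1 H2.
  by rewrite (le_trans (ler_normD _ _))// (splitr e) lerD.
exists y; split.
- split=> // t t0.
  have -> : F (sigma t w) (history r y t) =
      B *m z t + Fres (sigma t w) (history r y t).
    rewrite zy ?ltW// /Fres historyE ?addr0 ?lexx ?oppr_le0 ?r00//.
    by rewrite addrC subrK.
  apply: near_eq_is_derive (dz t t0); near=> s; apply: zy.
  by apply: ltW; near: s; exact: lt_nbhsr.
- by apply: (pos_trajectory_lim Ycv); exact: nearW.
- apply: (@pos_trajectory_lim _ _ r B (fun n => Y n \- v)) => [t rt|].
    by apply: cvgB; [exact: Ycv|exact: cvg_cst].
  apply: nearW => n; elim: n => [|n IH].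
    by split=> [s _|s t _ _] /=; rewrite ?subrr ?mulmx0; exact: vle_refl.
  have -> : Y n.+1 \- v = (Y n.+1 \- Y n) \+ (Y n \- v).
    by apply/funext => t /=; rewrite subrKA.
  exact: pos_trajectoryD.
(* A solution x above Y_n has forcing above that of Y_{n+1}, so by comparison it stays above
   Y_{n+1}; the order passes to the limit. *)
move=> psi x xs xpos phipsi xv.
apply: (@pos_trajectory_lim _ _ r B (fun n => x \- Y n)) => [t rt|].
  by apply: cvgB; [exact: cvg_cst|exact: Ycv].
have [cx sx dx] := xs.
apply: nearW => n; elim: n => [//|n IH].
have [cY' sY' dY'] := Ystep n.
apply: (comparison cY' cx dY' (g2 := fun t => Fres (sigma t w) (history r x t))).
- move=> t t0; rewrite /Fres historyE ?addr0 ?lexx ?oppr_le0 ?r00//.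
  by rewrite addrC subrK; exact: dx.
- by move=> t t0; apply: Fres_mono; apply: exp_le_history => //; exact: ltW.
rewrite (_ : toC r _ = psi - phi)//; apply: toC_segment.
  by move=> t; apply: cvgB; [exact: cx|exact: cY'].
by move=> s rs; rewrite CB -(sx _ rs) -(sY' _ rs).
Unshelve. all: by end_near. Qed.

End monotone_iteration.

Lemma thirds_lt (R : realType) (d : R) : 0 < d -> d / 3 < d /\ d / 3 + d / 3 < d.
Proof. by move=> d0; split; lra. Qed.

(** * Tails of a semiorbit and their cluster points *)

Section late_filter.
Context {R : realType} {T : topologicalType}.

(** The filter of tails: its cluster points form the omega-limit set, which can thus be handled
    through neighbourhoods instead of sequences of times. *)
Definition late (x : R -> T) : set_system T :=
  [set N | exists T0, forall t, T0 <= t -> N (x t)].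

#[global] Instance late_proper (x : R -> T) : ProperFilter (late x).
Proof.
split; first by move=> [T0 /(_ T0 (lexx _))].
split; first by exists 0.
- move=> P Q [a Pa] [b Qb]; exists (Num.max a b) => t.
  by rewrite ge_max => /andP[/Pa ? /Qb].
- by move=> P Q PQ [a Pa]; exists a => t /Pa /PQ.
Qed.

Lemma cluster_lateP (x : R -> T) p : cluster (late x) p <->
  forall V, nbhs p V -> forall T0, exists2 t, T0 <= t & V (x t).
Proof.
split=> [H V pV T0|H N V [T0 NT] pV].
  have late_T0 : late x (x @` [set t | T0 <= t]) by exists T0 => t T0t; exists t.
  by have [_ [[t T0t <-] Vt]] := H _ _ late_T0 pV; exists t.
by have [t T0t Vt] := H V pV T0; exists (x t); split=> //; exact: NT.
Qed.

Lemma cluster_closed (G : set_system T) : closed (cluster G).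
Proof. by rewrite clusterE; apply: closed_bigI => A _; exact: closed_closure. Qed.

Lemma cluster_late_sub (x : R -> T) (A : set T) : closed A ->
  (exists T0, forall t, T0 <= t -> A (x t)) -> cluster (late x) `<=` A.
Proof.
by move=> /closure_id Acl xA p; rewrite clusterE => /(_ A xA); rewrite -Acl.
Qed.

End late_filter.

Lemma hausdorff_prod (T U : topologicalType) : hausdorff_space T -> hausdorff_space U ->
  hausdorff_space (T * U)%type.
Proof.
move=> hT hU [a b] [c d] H; congr pair.
  apply: hT => P Q aP cQ.
  have abP : nbhs (a, b) (P `*` [set: U]).
    by exists (P, setT) => //=; split=> //; exact: filterT.
  have cdQ : nbhs (c, d) (Q `*` [set: U]).
    by exists (Q, setT) => //=; split=> //; exact: filterT.
  by have [[x y] [[/= Px _] [/= Qx _]]] := H _ _ abP cdQ; exists x.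
apply: hU => P Q aP cQ.
have abP : nbhs (a, b) ([set: T] `*` P).
  by exists (setT, P) => //=; split=> //; exact: filterT.
have cdQ : nbhs (c, d) ([set: T] `*` Q).
  by exists (setT, Q) => //=; split=> //; exact: filterT.
by have [[x y] [[/= _ Py] [/= _ Qy]]] := H _ _ abP cdQ; exists y.
Qed.

(** * Lipschitz estimates across time 0 *)

Section lipschitz_estimates.
Context {R : realType} {r : R} {m : nat}.
Implicit Types (z dz : R -> 'cV[R]_m) (s t u k T : R).

(** Solutions may have a corner at 0, so increments across 0 are split there: the left part uses the
    initial segment, the right part the derivative. *)
Lemma lipschitz_glue z dz k T : 0 <= T -> continuous z ->
  (forall s t, - r <= s <= 0 -> - r <= t <= 0 -> `|z t - z s| <= k * `|t - s|) ->
  (forall u, 0 < u < T -> is_derive u 1 z (dz u)) ->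
  (forall u, 0 < u < T -> `|dz u| <= k) ->
  forall s t, - r <= s <= T -> - r <= t <= T -> `|z t - z s| <= k * `|t - s|.
Proof.
move=> T0 cz seg dE dk.
have mv s t : 0 <= s -> s <= t -> t <= T -> `|z t - z s| <= k * (t - s).
  move=> s0 st tT; apply: (mean_value_bound st cz) => u /andP[su ut].
    by apply: dE; rewrite (le_lt_trans s0 su) (lt_le_trans ut tT).
  by apply: dk; rewrite (le_lt_trans s0 su) (lt_le_trans ut tT).
have key s t : - r <= s -> s <= t -> t <= T -> `|z t - z s| <= k * (t - s).
  move=> rs st tT; have [t0|/ltW t0] := leP t 0.
    have := seg s t; rewrite rs t0 (le_trans st t0) (le_trans rs st) => /(_ isT isT).
    by rewrite (ger0_norm (_ : 0 <= t - s)) ?subr_ge0.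
  have [s0|/ltW s0] := leP 0 s; first exact: mv.
  rewrite -(subrKA (z 0)) (le_trans (ler_normD _ _))//.
  rewrite (_ : k * (t - s) = k * (t - 0) + k * (0 - s)); last by ring.
  apply: lerD; first exact: mv.
  have := seg s 0; rewrite rs s0 lexx (le_trans rs s0) => /(_ isT isT).
  by have s0' : 0 <= 0 - s by [rewrite subr_ge0]; rewrite (ger0_norm s0').
move=> s t /andP[rs sT] /andP[rt tT]; have [st|/ltW ts] := leP s t.
  by rewrite (ger0_norm (_ : 0 <= t - s)) ?subr_ge0// key.
by rewrite distrC [X in _ * X]distrC (ger0_norm (_ : 0 <= s - t)) ?subr_ge0// key.
Qed.

Lemma mean_value_dist z dz k (a b : R) : continuous z ->
  (forall u, a < u < b -> is_derive u 1 z (dz u)) ->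
  (forall u, a < u < b -> `|dz u| <= k) ->
  forall s t, a <= s <= b -> a <= t <= b -> `|z t - z s| <= k * `|t - s|.
Proof.
move=> cz dE dk; have key s t : a <= s -> s <= t -> t <= b -> `|z t - z s| <= k * (t - s).
  move=> sa st tb; apply: (mean_value_bound st cz) => u /andP[su ut].
    by apply: dE; rewrite (le_lt_trans sa su) (lt_le_trans ut tb).
  by apply: dk; rewrite (le_lt_trans sa su) (lt_le_trans ut tb).
move=> s t /andP[sa sb] /andP[ta tb]; have [st|/ltW ts] := leP s t.
  by rewrite (ger0_norm (_ : 0 <= t - s)) ?subr_ge0// key.
by rewrite distrC [X in _ * X]distrC (ger0_norm (_ : 0 <= s - t)) ?subr_ge0// key.
Qed.

Lemma toL_dist (f g : Cseg r m) (h : R) : L_C (toL f) = f -> L_C (toL g) = g ->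
  `|f - g| <= h ->
  (forall s t, - r <= s <= 0 -> - r <= t <= 0 ->
    `|(f - g) t - (f - g) s| <= h * `|t - s|) ->
  `|toL f - toL g| <= h + h.
Proof.
move=> fE gE fgh H; apply: Lnorm_le; rewrite ?LB ?fE ?gE//.
exact: le_trans fgh.
Qed.

End lipschitz_estimates.

(** * The semiflow on the cone: order properties *)

Section semiflow.
Context {R : realType} {Omega : metricType R} {r : R} {m : nat}.
Context {sigma : R -> Omega -> Omega} {F : Omega -> Cseg r m -> 'cV[R]_m}.
Context (r0 : 0 < r) (sigma_flow : continuous_flow sigma).
Context (F_continuous : continuous (fun p : Omega * Cseg r m => F p.1 p.2)).
Context (F_C1 : C1_second F).
Context {B : 'M[R]_m} (qB : quasipositive B).
Context (F_bounded : forall X1 : set (Cseg r m), bounded_set X1 ->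
  bounded_set [set F w phi | w in [set: Omega] & phi in X1]).
Context (F_mono : forall w phi psi, exp_le B phi psi ->
  vle (B *m (psi 0 - phi 0)) (F w psi - F w phi)).
Context (F_sublin : forall w psi (lambda : R), exp_le B 0 psi -> 0 <= lambda <= 1 ->
  vle (lambda *: F w psi) (F w (lambda *: psi))).
Implicit Types (w : Omega) (phi psi : Cseg r m) (y z : R -> 'cV[R]_m).
Implicit Types (s t T : R).

Local Notation solves := (@solves R Omega r m sigma F).
Local Notation Fres := (@Fres R Omega r m F B).
Local Notation pos := (pos_trajectory r B).
Local Notation solC := (solC sigma F).

Let exists_solution := subsolution_solution r0 sigma_flow F_continuous qB F_bounded
  F_mono F_sublin.
Let unique_solution := solves_unique r0 sigma_flow F_continuous F_C1.

(* The solution made continuous on the whole line. *)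
Definition traj w phi (t : R) : 'cV[R]_m := sol sigma F w phi (Num.max t (- r)).

(** The zero forcing lies below [Fres] on the cone, so the linear flow of B is a subsolution from
    which the iteration can always start. *)
Lemma linear_lower_solution w phi : exp_cone B phi -> exists v,
  [/\ continuous v, forall s, - r <= s <= 0 -> v s = phi s, pos v &
    forall t : R, 0 < t -> is_derive t 1 v (B *m v t + 0)].
Proof.
move=> phi0; have c0 : continuous (fun _ : R => 0 : 'cV[R]_m) by exact: cst_continuous.
have [v [cv sv dv]] := @linear_ode_exists R r m r0 B phi (fun=> 0) c0.
exists v; split=> //; apply: (@pos_trajectory_ode _ _ r B qB v (fun=> 0) cv dv).
- by move=> t t0; exact: vle_refl.
- exact: ltW.
- by rewrite (toC_segment cv sv).
Qed.

Lemma cone_solution w phi : exp_cone B phi -> exists2 y, solves w phi y & pos y.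
Proof.
move=> phi0; have [v [cv sv pv dv]] := linear_lower_solution w phi0.
have [y [ys py _ _]] := exists_solution (w := w) phi0 cv sv pv dv (fun (t : R) (tgt : 0 < t) =>
  Fres_ge0 F_mono F_sublin (sigma t w) (exp_cone_history cv pv (ltW tgt))).
by exists y.
Qed.

Lemma traj_solves w phi : exp_cone B phi -> solves w phi (traj w phi).
Proof.
move=> /(cone_solution w)[y ys _]; apply: is_solution_solves => //.
apply: (@xgetPex _ (cst 0) [set y | is_solution sigma F w phi y]); exists y.
exact: solves_is_solution.
Qed.

Lemma traj_pos w phi : exp_cone B phi -> pos (traj w phi).
Proof.
move=> phi0; have [y ys [y0 yE]] := cone_solution w phi0.
have E t : - r <= t -> traj w phi t = y t by exact: unique_solution ys (traj_solves w phi0) _.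
split=> [s rs|s t rs st]; first by rewrite E//; exact: y0.
by rewrite !E//; [exact: yE|exact: le_trans st].
Qed.

Lemma cone_globally_solvable w phi : exp_cone B phi -> globally_solvable sigma F w phi.
Proof.
move=> phi0; have [y ys _] := cone_solution w phi0; split.
  apply: (@xgetPex _ (cst 0) [set y | is_solution sigma F w phi y]); exists y.
  exact: solves_is_solution.
move=> z /(is_solution_solves r0) zs t rt.
have := unique_solution (traj_solves w phi0) zs rt.
by rewrite /traj max_l.
Qed.

Lemma traj_continuous w phi : exp_cone B phi -> continuous (traj w phi).
Proof. by move=> /(traj_solves w)[]. Qed.

Lemma solCE t w phi : 0 <= t -> solC t w phi = history r (traj w phi) t.
Proof.
move=> t0; apply: history_eq => s /andP[rs _].
by rewrite /traj max_l// -[- r]add0r lerD.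
Qed.

Lemma solC_cone t w phi : 0 <= t -> exp_cone B phi -> exp_cone B (solC t w phi).
Proof.
move=> t0 phi0; rewrite (solCE _ _ t0).
exact: (exp_cone_history (traj_continuous phi0) (traj_pos w phi0) t0).
Qed.

Lemma solves_shift w phi y s : 0 <= s -> solves w phi y ->
  solves (sigma s w) (history r y s) (fun t => y (s + t)).
Proof.
move=> s0 [cy _ dy]; split.
- move=> t; apply: (@continuous_comp _ _ _ (fun t => s + t) y); last exact: cy.
  by apply: cvgD; [exact: cvg_cst|exact: cvg_id].
- by move=> u ru; rewrite historyE.
move=> t t0; have [_ _ flowD] := sigma_flow; rewrite -flowD.
have -> : history r (fun t => y (s + t)) t = history r y (s + t).
  by apply: toC_eq => u _; rewrite addrA.
have := dy (s + t) (ltr_wpDl s0 t0) => H; apply/is_derive_coordP => i.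
have /is_derive_coordP/(_ i) Hi := H.
have := @is_derive1_comp R (fun u => y u i ord0) (fun t => s + t) t _ 1 Hi.
rewrite mulr1; apply.
rewrite [X in is_derive _ _ X](_ : _ = cst s + id)//.
by apply: is_derive_eq; rewrite add0r.
Qed.

Lemma traj_shift w phi s t : exp_cone B phi -> 0 <= s -> - r <= t ->
  traj (sigma s w) (solC s w phi) t = traj w phi (s + t).
Proof.
move=> phi0 s0 rt; have := solves_shift s0 (traj_solves w phi0).
rewrite -solCE// => H.
by rewrite (unique_solution H (traj_solves _ (solC_cone w s0 phi0)) rt).
Qed.

Lemma solC_semigroup w phi s t : exp_cone B phi -> 0 <= s -> 0 <= t ->
  solC t (sigma s w) (solC s w phi) = solC (s + t) w phi.
Proof.
move=> phi0 s0 t0; have phis := solC_cone w s0 phi0.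
rewrite (solCE _ _ t0) (solCE _ _ (addr_ge0 s0 t0)); apply: Cseg_ext => u ru.
rewrite (historyE _ (traj_continuous phis) ru) (historyE _ (traj_continuous phi0) ru).
rewrite -addrA -(traj_shift w phi0 s0)//.
by case/andP : ru => ru _; rewrite -[- r]add0r lerD.
Qed.

(** The solution from phi is the least one above the linear lower solution v. The solution from psi
    is above v by comparison, hence above the solution from phi. *)
Lemma solC_mono w phi psi t : 0 <= t -> exp_cone B phi -> exp_le B phi psi ->
  exp_le B (solC t w phi) (solC t w psi).
Proof.
move=> t0 phi0 phipsi.
have psi0 : exp_cone B psi.
  by rewrite -exp_le0; apply: exp_le_trans phipsi; rewrite exp_le0.
have [v [cv sv pv dv]] := linear_lower_solution w phi0.
have [y [ys py _ yz]] := exists_solution (w := w) phi0 cv sv pv dv (fun (t : R) (tgt : 0 < t) =>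
  Fres_ge0 F_mono F_sublin (sigma t w) (exp_cone_history cv pv (ltW tgt))).
have zs := traj_solves w psi0; have pz := traj_pos w psi0; have [cz sz dz] := zs.
have zv : pos (traj w psi \- v).
  apply: (comparison r0 qB cv cz dv (g2 := fun t => Fres (sigma t w) (history r (traj w psi) t))).
  - move=> u u0; rewrite /Fres historyE ?addr0 ?lexx ?oppr_le0 ?(ltW r0)//.
    by rewrite addrC subrK; exact: dz.
  - move=> u u0; apply: (Fres_ge0 F_mono F_sublin).
    exact: (exp_cone_history cz pz (ltW u0)).
  rewrite (_ : toC r _ = psi - phi)//; apply: toC_segment.
    by move=> u; apply: cvgB; [exact: cz|exact: cv].
  by move=> s rs; rewrite CB -(sz _ rs) -(sv _ rs).
have := yz psi _ zs pz phipsi zv => -[H1 H2].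
have E u : - r <= u -> traj w phi u = y u by exact: unique_solution ys (traj_solves w phi0) _.
rewrite (solCE w phi t0) (solCE w psi t0).
apply: (exp_le_history (traj_continuous phi0) cz _ t0).
split=> [s rs|s u rs su].
  by rewrite -[(_ \- _) s]/(traj w psi s - traj w phi s) (E _ rs); exact: H1.
rewrite -[(_ \- _) s]/(traj w psi s - traj w phi s).
rewrite -[(_ \- _) u]/(traj w psi u - traj w phi u).
by rewrite (E _ rs) (E _ (le_trans rs su)); exact: H2.
Qed.

(** If z is the solution from psi, then a z is a subsolution with initial value a psi, by
    sublinearity of [Fres]; the iteration started there produces a solution above it, which
    uniqueness identifies. *)
Lemma solC_sublin w psi (a : R) t : 0 <= t -> exp_cone B psi -> 0 <= a <= 1 ->
  exp_le B (a *: solC t w psi) (solC t w (a *: psi)).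
Proof.
move=> t0 psi0 a01; have /andP[a0 a1] := a01.
have apsi0 : exp_cone B (a *: psi) by exact: exp_coneZ.
have pz := traj_pos w psi0; have [cz sz dz] := traj_solves w psi0.
set z := traj w psi in pz cz sz dz *.
have cv : continuous (a \*: z) by move=> u; apply: cvgZr; exact: cz.
have sv s : - r <= s <= 0 -> (a \*: z) s = (a *: psi) s.
  by move=> rs; rewrite CZ -(sz _ rs).
have pv : pos (a \*: z).
  case: pz => z0 zE; split=> [s rs|s u rs su] /=.
    by rewrite -(scaler0 _ a); apply: vleZ => //; exact: z0.
  by rewrite -scalemxAr; apply: vleZ => //; exact: zE.
have dv (u : R) : 0 < u -> is_derive u 1 (a \*: z)
    (B *m (a \*: z) u + a *: Fres (sigma u w) (history r z u)).
  move=> u0; have := dz u u0 => ?.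
  rewrite [X in is_derive _ _ _ X](_ : _ = a *: F (sigma u w) (history r z u)).
    exact: is_deriveZ.
  rewrite /= /Fres historyE ?addr0 ?lexx ?oppr_le0 ?(ltW r0)//.
  by rewrite scalerBr -scalemxAr addrC subrK.
have hv (u : R) : 0 < u -> vle (a *: Fres (sigma u w) (history r z u))
    (Fres (sigma u w) (history r (a \*: z) u)).
  move=> u0; rewrite (historyZ _ _ cz); apply: (Fres_sublin F_sublin) => //.
  exact: (exp_cone_history cz pz (ltW u0)).
have [y [ys py [H1 H2] _]] := exists_solution apsi0 cv sv pv dv hv.
have E u : - r <= u -> traj w (a *: psi) u = y u.
  exact: unique_solution ys (traj_solves w apsi0) _.
rewrite (solCE w psi t0) (solCE w (a *: psi) t0) -(historyZ _ _ cz).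
apply: (exp_le_history cv (traj_continuous apsi0) _ t0).
split=> [s rs|s u rs su].
  by rewrite -[(_ \- _) s]/(traj w (a *: psi) s - (a \*: z) s) (E _ rs); exact: H1.
rewrite -[(_ \- _) s]/(traj w (a *: psi) s - (a \*: z) s).
rewrite -[(_ \- _) u]/(traj w (a *: psi) u - (a \*: z) u).
by rewrite (E _ rs) (E _ (le_trans rs su)); exact: H2.
Qed.

(** Sublinearity applied to a psi with factor 1/a. *)
Lemma solC_superlin w psi (a : R) t : 0 <= t -> exp_cone B psi -> 1 <= a ->
  exp_le B (solC t w (a *: psi)) (a *: solC t w psi).
Proof.
move=> t0 psi0 a1; have a0 : 0 < a by rewrite (lt_le_trans ltr01).
have ainv : 0 <= a^-1 <= 1 by rewrite invr_ge0 ltW//= invf_le1.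
have := solC_sublin w t0 (exp_coneZ (ltW a0) psi0) ainv.
rewrite scalerA mulVf ?gt_eqF// scale1r => /(exp_leZ (ltW a0)).
by rewrite scalerA mulfV ?gt_eqF// scale1r.
Qed.

(** * Continuous dependence, uniformly on bounded time intervals *)

Lemma solC_near w phi T (e : R) : exp_cone B phi -> 0 <= T -> 0 < e ->
  \forall w' \near w & phi' \near phi, exp_cone B phi' ->
    forall t, 0 <= t <= T -> `|solC t w' phi' - solC t w phi| <= e.
Proof.
move=> phi0 T0 e0.
have [[U P] /= [Uw Pphi] UP] := solution_stability r0 sigma_flow F_continuous F_C1
  (traj_solves w phi0) e0 T0.
apply: (near_prodP Uw Pphi) => w' phi' Uw' Pphi' phi0' t /andP[t0 tT].
rewrite (solCE w phi t0) (solCE w' phi' t0).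
apply: Cnorm_le => [|s /[dup] rs /andP[rs' s0]]; first exact: ltW.
rewrite CB (historyE _ (traj_continuous phi0) rs) (historyE _ (traj_continuous phi0') rs).
apply: (UP (w', phi') (conj Uw' Pphi') _ (traj_solves w' phi0')).
rewrite -[- r]add0r lerD//=.
by rewrite (le_trans _ tT)// gerDl.
Qed.

Lemma solC_time_continuous w phi t : exp_cone B phi -> 0 <= t -> forall e : R, 0 < e ->
  \forall t' \near t, 0 <= t' -> `|solC t w phi - solC t' w phi| <= e.
Proof.
move=> phi0 t0 e e0.
have := @history_continuous R r m _ (traj_continuous (w := w) phi0) t.
move=> /cvgrPdist_le/(_ _ e0); apply: filterS => t' H t0'.
by rewrite (solCE w phi t0) (solCE w phi t0').
Qed.

(** Closeness of the derivatives of two solutions, the part of the X_L distance that sup-norm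
    estimates do not see. *)
Lemma rhs_near w phi T (e : R) : exp_cone B phi -> 0 <= T -> 0 < e ->
  \forall w' \near w & phi' \near phi, exp_cone B phi' ->
    forall t, 0 <= t <= T ->
      `|F (sigma t w') (solC t w' phi') - F (sigma t w) (solC t w phi)| <= e.
Proof.
move=> phi0 T0 e0; have e2 : 0 < e / 2 by rewrite divr_gt0.
have /compact_near_coveringP K := @segment_compact R 0 T.
pose P (i : Omega * Cseg r m) t := exp_cone B i.2 -> 0 <= t <= T ->
  `|F (sigma t i.1) (solC t i.1 i.2) - F (sigma t w) (solC t w phi)| <= e.
have : filter_prod (nbhs w) (nbhs phi) [set i | `[0, T]%classic `<=` P i].
  apply: (K _ (filter_prod (nbhs w) (nbhs phi)) P) => t; rewrite /= in_itv/= => /andP[t0 tT].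
  have [[U Q] /= [Uw /nbhs_normE[d d0 HQ]] UQ] :=
    F_near F_continuous (sigma t w) (solC t w phi) e2.
  have d3 : 0 < d / 3 by rewrite divr_gt0.
  have [dd dd'] := thirds_lt d0.
  have [[A W] /= [At Ww] AW] := flow_continuous sigma_flow Uw.
  have Hs := solC_time_continuous w phi0 t0 d3.
  have [[W' P'] /= [Ww' Pphi'] WP'] := solC_near w phi0 T0 d3.
  have Hi : filter_prod (nbhs w) (nbhs phi) [set i | W i.1 /\ W' i.1 /\ P' i.2].
    exists (W `&` W', P'); first by split=> //; exact: filterI.
    by move=> [w' phi'] /= [[? ?] ?].
  apply: (near_prodP (filterI At Hs) Hi) => s [w' phi'] [As hs] /= [Ww1 [Ww2 Pphi2]].
  move=> phi0' /andP[s0 sT] /=.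
  have sT' : 0 <= s <= T by rewrite s0.
  have near1 : `|solC t w phi - solC s w phi| <= d / 3 by exact: hs.
  have near2 : `|solC s w' phi' - solC s w phi| <= d / 3.
    exact: (WP' (w', phi') (conj Ww2 Pphi2) phi0' s sT').
  have Q1 : Q (solC s w phi) by apply: HQ; exact: le_lt_trans near1 dd.
  have Q2 : Q (solC s w' phi').
    apply: HQ; rewrite -(subrKA (solC s w phi)); apply: le_lt_trans (ler_normD _ _) _.
    by rewrite distrC in near2; exact: le_lt_trans (lerD near1 near2) dd'.
  have H1 := UQ (sigma s w, solC s w phi) (conj (AW (s, w) (conj As (nbhs_singleton Ww))) Q1).
  have H2 := UQ (sigma s w', solC s w' phi') (conj (AW (s, w') (conj As Ww1)) Q2).
  rewrite /= in H1 H2.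
  rewrite -(subrKA (F (sigma t w) (solC t w phi))) (le_trans (ler_normD _ _))//.
  by rewrite (splitr e) lerD// distrC.
move=> [[U Q] /= [Uw Qphi] UQ].
apply: (near_prodP Uw Qphi) => w' phi' Uw' Qphi' phi0' t tT.
by apply: (UQ (w', phi')) => //=; rewrite in_itv.
Qed.

(** * Lipschitz regularity of histories and distances in X_L *)

Let rhs w phi t : 'cV[R]_m := F (sigma t w) (history r (traj w phi) t).

Let rhs_cont w phi : exp_cone B phi -> continuous (rhs w phi).
Proof.
move=> phi0; exact: (rhs_continuous sigma_flow F_continuous (traj_continuous phi0)).
Qed.

Let rhsE w phi t : 0 <= t -> rhs w phi t = F (sigma t w) (solC t w phi).
Proof. by move=> t0; rewrite /rhs -(solCE w phi t0). Qed.

Let traj_derive w phi t : exp_cone B phi -> 0 < t ->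
  is_derive t 1 (traj w phi) (rhs w phi t).
Proof. by move=> phi0; case: (traj_solves w phi0) => _ _; exact. Qed.

Let traj_seg w phi s : exp_cone B phi -> - r <= s <= 0 -> traj w phi s = phi s.
Proof. by move=> phi0; case: (traj_solves w phi0) => _ + _; exact. Qed.

Let solC_traj w phi t s : exp_cone B phi -> 0 <= t -> - r <= s <= 0 ->
  solC t w phi s = traj w phi (t + s).
Proof.
by move=> phi0 t0 rs; rewrite (solCE w phi t0) (historyE t (traj_continuous phi0) rs).
Qed.

Let rhs_bounded w phi T : exp_cone B phi -> exists2 C : R, 0 <= C &
  forall t, 0 <= t <= T -> `|rhs w phi t| <= C.
Proof.
move=> phi0; have : compact (rhs w phi @` `[0, T]).
  apply: continuous_compact; last exact: segment_compact.
  exact: (continuous_subspaceT (rhs_cont phi0)).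
move=> /compact_bounded[M [_ /(_ (`|M| + 1))]].
rewrite (le_lt_trans (ler_norm _)) ?ltrDl// => /(_ isT) H.
exists (`|M| + 1); first by rewrite addr_ge0.
by move=> t tT; apply: H; exists t => //=; rewrite in_itv.
Qed.

Let traj_lipschitz w (phi : Lipseg r m) T C : exp_cone B (L_C phi) -> 0 <= T ->
  (forall t, 0 <= t <= T -> `|rhs w phi t| <= C) ->
  forall s t, - r <= s <= T -> - r <= t <= T ->
    `|traj w phi t - traj w phi s| <= Num.max `|phi| C * `|t - s|.
Proof.
move=> phi0 T0 HC; apply: (lipschitz_glue (dz := rhs w phi) T0 (traj_continuous phi0)).
- move=> s t rs rt; rewrite (traj_seg w phi0 rs) (traj_seg w phi0 rt).
  by rewrite (le_trans (Lnorm_lipschitz _ rs rt))// ler_wpM2r// le_max lexx.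
- by move=> u /andP[u0 _]; exact: (traj_derive w phi0 u0).
- by move=> u /andP[u0 uT]; rewrite le_max HC ?orbT// !ltW.
Qed.

Lemma solC_lipschitz w (phi : Lipseg r m) C t : exp_cone B (L_C phi) -> 0 <= t ->
  (forall u, 0 <= u <= t -> `|F (sigma u w) (solC u w phi)| <= C) ->
  forall s s', - r <= s <= 0 -> - r <= s' <= 0 ->
    `|solC t w phi s' - solC t w phi s| <= Num.max `|phi| C * `|s' - s|.
Proof.
move=> phi0 t0 HC s s' rs rs'.
rewrite (solC_traj w phi0 t0 rs) (solC_traj w phi0 t0 rs').
rewrite (_ : s' - s = t + s' - (t + s)); last by ring.
have inT u : - r <= u <= 0 -> - r <= t + u <= t.
  by move=> /andP[ru u0]; rewrite -[- r]add0r lerD//= gerDl.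
apply: (traj_lipschitz phi0 t0) (inT _ rs) (inT _ rs') => u /[dup] ut /andP[u0 _].
by rewrite (rhsE w phi u0); exact: HC.
Qed.

Lemma solLE t w (phi : Lipseg r m) : exp_cone B (L_C phi) -> 0 <= t ->
  L_C (solL sigma F t w phi) = solC t w phi.
Proof.
move=> phi0 t0; have [C C0 HC] := rhs_bounded w t phi0.
apply: (@toLK _ _ _ _ (Num.max `|phi| C)); apply: (solC_lipschitz phi0 t0).
by move=> u /[dup] ut /andP[u0 _]; rewrite -(rhsE w phi u0); exact: HC.
Qed.

Let shift_seg t s : r <= t -> - r <= s <= 0 -> 0 <= t + s <= t.
Proof.
move=> rt /andP[rs s0]; rewrite gerDl s0 andbT.
by rewrite -(subrr r) lerD.
Qed.

(** From time r on the history lies in nonnegative times, where the derivative is bounded on compact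
    intervals; phi need only be continuous. *)
Lemma toL_solCE t w phi : exp_cone B phi -> r <= t ->
  L_C (toL (solC t w phi)) = solC t w phi.
Proof.
move=> phi0 rt; have t0 : 0 <= t by rewrite (le_trans (ltW r0)).
have [C C0 HC] := rhs_bounded w t phi0.
apply: (@toLK _ _ _ _ C) => s s' rs rs'.
rewrite (solC_traj w phi0 t0 rs) (solC_traj w phi0 t0 rs').
rewrite (_ : s' - s = t + s' - (t + s)); last by ring.
apply: (mean_value_dist (dz := rhs w phi) (traj_continuous phi0))
  (shift_seg rt rs) (shift_seg rt rs') => u /andP[u0 ut].
  exact: (traj_derive w phi0 u0).
by apply: HC; rewrite !ltW.
Qed.

Let traj_diff w w' phi phi' : R -> 'cV[R]_m := traj w phi \- traj w' phi'.

Let traj_diff_continuous w w' phi phi' : exp_cone B phi -> exp_cone B phi' ->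
  continuous (traj_diff w w' phi phi').
Proof.
move=> phi0 phi0' t; apply: cvgB; first exact: (traj_continuous phi0).
exact: (traj_continuous phi0').
Qed.

Let traj_diff_derive w w' phi phi' t : exp_cone B phi -> exp_cone B phi' -> 0 < t ->
  is_derive t 1 (traj_diff w w' phi phi') (rhs w phi t - rhs w' phi' t).
Proof.
move=> phi0 phi0' t0; have := traj_derive w phi0 t0; have := traj_derive w' phi0' t0.
by move=> ? ?; exact: is_deriveB.
Qed.

(** For t < r the history still contains part of the initial segment, so the initial distance must
    be measured in X_L. The sum h + h reflects the norm, a sup-norm plus a seminorm, each at most
    h. *)
Lemma solL_dist w w' (phi phi' : Lipseg r m) t (h : R) :
  exp_cone B (L_C phi) -> exp_cone B (L_C phi') -> 0 <= t ->
  `|phi - phi'| <= h ->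
  (forall u, 0 <= u <= t ->
    `|F (sigma u w) (solC u w phi) - F (sigma u w') (solC u w' phi')| <= h) ->
  `|solC t w phi - solC t w' phi'| <= h ->
  `|solL sigma F t w phi - solL sigma F t w' phi'| <= h + h.
Proof.
move=> phi0 phi0' t0 hphi hF hC.
apply: (toL_dist (solLE w phi0 t0) (solLE w' phi0' t0) hC) => s s' rs rs'.
rewrite !CB (solC_traj w phi0 t0 rs) (solC_traj w phi0 t0 rs').
rewrite (solC_traj w' phi0' t0 rs) (solC_traj w' phi0' t0 rs').
rewrite (_ : s' - s = t + s' - (t + s)); last by ring.
have inT u : - r <= u <= 0 -> - r <= t + u <= t.
  by move=> /andP[ru u0]; rewrite -[- r]add0r lerD//= gerDl.
apply: (lipschitz_glue (z := traj_diff w w' phi phi')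
  (dz := fun u => rhs w phi u - rhs w' phi' u) t0 (traj_diff_continuous phi0 phi0'))
  (inT _ rs) (inT _ rs').
- move=> a b ra rb; rewrite /traj_diff /= (traj_seg w phi0 ra) (traj_seg w phi0 rb).
  rewrite (traj_seg w' phi0' ra) (traj_seg w' phi0' rb).
  by rewrite -!CB -!LB (le_trans (Lnorm_lipschitz _ ra rb))// ler_wpM2r.
- by move=> u /andP[u0 _]; exact: (traj_diff_derive w w' phi0 phi0' u0).
- move=> u /andP[u0 ut]; rewrite (rhsE w phi (ltW u0)) (rhsE w' phi' (ltW u0)).
  by apply: hF; rewrite !ltW.
Qed.

(** For t >= r the initial segments have left the histories, and sup-norm information on states and
    right-hand sides is enough: this is the smoothing from C to X_L. *)
Lemma toL_solC_dist w w' phi phi' t (h : R) :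
  exp_cone B phi -> exp_cone B phi' -> r <= t ->
  (forall u, 0 <= u <= t ->
    `|F (sigma u w) (solC u w phi) - F (sigma u w') (solC u w' phi')| <= h) ->
  `|solC t w phi - solC t w' phi'| <= h ->
  `|toL (solC t w phi) - toL (solC t w' phi')| <= h + h.
Proof.
move=> phi0 phi0' rt hF hC; have t0 : 0 <= t by rewrite (le_trans (ltW r0)).
apply: (toL_dist (toL_solCE w phi0 rt) (toL_solCE w' phi0' rt) hC) => s s' rs rs'.
rewrite !CB (solC_traj w phi0 t0 rs) (solC_traj w phi0 t0 rs').
rewrite (solC_traj w' phi0' t0 rs) (solC_traj w' phi0' t0 rs').
rewrite (_ : s' - s = t + s' - (t + s)); last by ring.
apply: (mean_value_dist (z := traj_diff w w' phi phi')
  (dz := fun u => rhs w phi u - rhs w' phi' u) (traj_diff_continuous phi0 phi0'))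
  (shift_seg rt rs) (shift_seg rt rs') => u /andP[u0 ut].
  exact: (traj_diff_derive w w' phi0 phi0' u0).
rewrite (rhsE w phi (ltW u0)) (rhsE w' phi' (ltW u0)).
by apply: hF; rewrite !ltW.
Qed.

Lemma solL_near w (phi : Lipseg r m) T (e : R) : exp_cone B (L_C phi) -> 0 <= T -> 0 < e ->
  \forall w' \near w & phi' \near phi, exp_cone B (L_C phi') ->
    forall t, 0 <= t <= T -> `|solL sigma F t w phi - solL sigma F t w' phi'| <= e.
Proof.
move=> phi0 T0 e0; have e2 : 0 < e / 2 by rewrite divr_gt0.
have [[U P] /= [Uw Pphi] UP] := solC_near w phi0 T0 e2.
have [[U' P'] /= [Uw' Pphi'] UP'] := rhs_near w phi0 T0 e2.
have PL : nbhs phi [set f : Lipseg r m | P (L_C f) /\ P' (L_C f)].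
  exact: (L_C_continuous (filterI Pphi Pphi')).
apply: (near_prodP (filterI Uw Uw') (filterI PL (near_dist_le phi e2))).
move=> w' phi' [Uw1 Uw2] [[P1 P2] hphi] phi0' t /[dup] tT /andP[t0 tT'].
rewrite (splitr e); apply: solL_dist => //.
- move=> u /andP[u0 ut]; rewrite distrC.
  by apply: (UP' (w', L_C phi') (conj Uw2 P2) phi0' u); rewrite u0 (le_trans ut).
- by rewrite distrC; exact: (UP (w', L_C phi') (conj Uw1 P1) phi0' t tT).
Qed.

Lemma toL_solC_near w phi T (e : R) : exp_cone B phi -> 0 <= T -> 0 < e ->
  \forall w' \near w & phi' \near phi, exp_cone B phi' ->
    forall t, r <= t <= T -> `|toL (solC t w phi) - toL (solC t w' phi')| <= e.
Proof.
move=> phi0 T0 e0; have e2 : 0 < e / 2 by rewrite divr_gt0.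
have [[U P] /= [Uw Pphi] UP] := solC_near w phi0 T0 e2.
have [[U' P'] /= [Uw' Pphi'] UP'] := rhs_near w phi0 T0 e2.
apply: (near_prodP (filterI Uw Uw') (filterI Pphi Pphi')).
move=> w' phi' [Uw1 Uw2] [P1 P2] phi0' t /andP[rt tT].
have t0 : 0 <= t by rewrite (le_trans (ltW r0)).
rewrite (splitr e); apply: toL_solC_dist => //.
- move=> u /andP[u0 ut]; rewrite distrC.
  by apply: (UP' (w', phi') (conj Uw2 P2) phi0' u); rewrite u0 (le_trans ut).
- by rewrite distrC; apply: (UP (w', phi') (conj Uw1 P1) phi0' t); rewrite t0.
Qed.

(** Translation is not continuous on X_L in general. Here the derivative of y_t is the history of
    the continuous function [rhs w phi], which varies continuously with t in the sup-norm. *)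
Lemma toL_solC_time_continuous w phi t (e : R) : exp_cone B phi -> r <= t -> 0 < e ->
  \forall t' \near t, r <= t' -> `|toL (solC t w phi) - toL (solC t' w phi)| <= e.
Proof.
move=> phi0 rt e0; have e2 : 0 < e / 2 by rewrite divr_gt0.
have t0 : 0 <= t by rewrite (le_trans (ltW r0)).
have crhs := rhs_cont (w := w) phi0.
have H1 : \forall t' \near t, `|history r (rhs w phi) t - history r (rhs w phi) t'| <= e / 2.
  by have /cvgrPdist_le := @history_continuous R r m _ crhs t; exact.
apply: filterS (filterI H1 (solC_time_continuous w phi0 t0 e2)) => t' [Hr HC] rt'.
have t0' : 0 <= t' by rewrite (le_trans (ltW r0)).
rewrite (splitr e); apply: (toL_dist (toL_solCE w phi0 rt) (toL_solCE w phi0 rt') (HC t0')).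
move=> s s' rs rs'; rewrite !CB.
rewrite (solC_traj w phi0 t0 rs) (solC_traj w phi0 t0 rs').
rewrite (solC_traj w phi0 t0' rs) (solC_traj w phi0 t0' rs').
have shift_derive a (u : R) : 0 < a + u ->
    is_derive u 1 (fun u => traj w phi (a + u)) (rhs w phi (a + u)).
  move=> au; apply/is_derive_coordP => i.
  have /is_derive_coordP/(_ i) Hi := traj_derive w phi0 au.
  have := @is_derive1_comp R (fun u => traj w phi u i ord0) (fun u => a + u) u _ 1 Hi.
  rewrite mulr1; apply.
  rewrite [X in is_derive _ _ X](_ : _ = cst a + id)//.
  by apply: is_derive_eq; rewrite add0r.
have shift_cont a : continuous (fun u => traj w phi (a + u)).
  move=> u; apply: (@continuous_comp _ _ _ (fun u => a + u) (traj w phi)).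
    by apply: cvgD; [exact: cvg_cst|exact: cvg_id].
  exact: (traj_continuous phi0).
apply: (mean_value_dist (z := (fun u => traj w phi (t + u)) \- (fun u => traj w phi (t' + u)))
  (dz := fun u => rhs w phi (t + u) - rhs w phi (t' + u)) (a := - r) (b := 0)) => //.
- by move=> u; apply: cvgB; [exact: (@shift_cont t u)|exact: (@shift_cont t' u)].
- move=> u /andP[ru u0].
  have tu : 0 < t + u by rewrite -(subrr r) ler_ltD.
  have tu' : 0 < t' + u by rewrite -(subrr r) ler_ltD.
  by have := shift_derive _ _ tu; have := shift_derive _ _ tu' => ? ?; exact: is_deriveB.
- move=> u /andP[ru u0]; have ru' : - r <= u <= 0 by rewrite !ltW.
  rewrite -(historyE t crhs ru') -(historyE t' crhs ru') -CB.
  exact: le_trans (le_Cnorm _ _) Hr.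
Qed.

(** * Compactness, minimality and companions over other base points *)

Context (Omega_compact : compact [set: Omega]) (sigma_minimal : minimal_flow sigma).

(** Only phi is confined to the compact set K; psi is an arbitrary nearby function. Stability needs
    this, since perturbed orbits are not known to lie in K. The covering is that of Omega x K. *)
Lemma F_modulus (K : set (Cseg r m)) (e : R) : compact K -> 0 < e ->
  exists2 d : R, 0 < d & forall w phi psi, K phi -> `|phi - psi| < d ->
    `|F w phi - F w psi| <= e.
Proof.
move=> cK e0; have e2 : 0 < e / 2 by rewrite divr_gt0.
have /compact_near_coveringP H := compact_setX Omega_compact cK.
pose P (n : nat) (p : Omega * Cseg r m) := forall psi,
  `|p.2 - psi| < n.+1%:R^-1 -> `|F p.1 p.2 - F p.1 psi| <= e.
have : \forall n \near \oo, [set: Omega] `*` K `<=` P n.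
  apply: (H _ _ P) => -[w phi] _.
  have [[U Q] /= [Uw /nbhs_normE[d d0 HQ]] UQ] := F_near F_continuous w phi e2.
  have d3 : 0 < d / 3 by rewrite divr_gt0.
  have [dd dd'] := thirds_lt d0.
  have Up : nbhs (w, phi) [set p : Omega * Cseg r m | U p.1 /\ `|phi - p.2| <= d / 3].
    exists (U, [set f : Cseg r m | `|phi - f| <= d / 3]); last by case.
    by split=> //; exact: near_dist_le.
  have nd : \forall n \near \oo, (n.+1%:R^-1 : R) < d / 3.
    exact: near_infty_natSinv_lt (PosNum d3).
  apply: (near_prodP Up nd) => -[w' f] n [/= Uw' hf] nd' psi hpsi /=.
  have H1 := UQ (w', f) (conj Uw' (HQ _ (le_lt_trans hf dd))).
  have Qpsi : Q psi.
    apply: HQ; rewrite -(subrKA f); apply: le_lt_trans (ler_normD _ _) _.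
    exact: le_lt_trans (lerD hf (ltW (lt_trans hpsi nd'))) dd'.
  have H2 := UQ (w', psi) (conj Uw' Qpsi).
  rewrite /= in H1 H2; rewrite -(subrKA (F w phi)); apply: le_trans (ler_normD _ _) _.
  by rewrite (splitr e) lerD// distrC.
move=> [n _ Hn]; exists n.+1%:R^-1 => // w phi psi Kphi; apply: (Hn n (leqnn n) (w, phi)).
by split.
Qed.

(** The cluster set of a forward orbit is closed, nonempty by compactness, and invariant under the
    flow in both time directions, hence everything by minimality. *)
Lemma forward_orbit_dense w w' : cluster (late (sigma ^~ w)) w'.
Proof.
have [sc s0 sD] := sigma_flow.
suff -> : cluster (late (sigma ^~ w)) = setT by [].
have inv s p : cluster (late (sigma ^~ w)) p -> cluster (late (sigma ^~ w)) (sigma s p).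
  move=> /cluster_lateP H; apply/cluster_lateP => V pV T0.
  have [[A W] /= [As Wp] AW] := flow_continuous sigma_flow pV.
  have [t tT Wt] := H W Wp (T0 - s).
  exists (t + s); first by rewrite -lerBlDr.
  by rewrite /= sD; apply: (AW (s, sigma t w)); split=> //; exact: nbhs_singleton.
apply: sigma_minimal.
- exact: cluster_closed.
- have [|p [_ Hp]] := Omega_compact (F := late (sigma ^~ w)); last by exists p.
  by exists 0.
- move=> t; apply/seteqP; split=> [_ [p Hp <-]|p Hp]; first exact: inv.
  by exists (sigma (- t) p); [exact: inv|rewrite -sD addNr s0].
Qed.

(** The trapping sets. M and L give compactness for the sup-norm in the manner of Arzela and Ascoli;
    the lower bound psi, when strongly positive, keeps limits in the interior of the cone. *)
Definition band (M L : R) (psi : Cseg r m) : set (Cseg r m) :=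
  [set f : Cseg r m | `|f| <= M /\
    forall s t, - r <= s <= 0 -> - r <= t <= 0 -> `|f t - f s| <= L * `|t - s|] `&`
  [set f : Cseg r m | exp_le B psi f].

Lemma band_compact M L psi : compact (band M L psi).
Proof.
apply: compact_closedI; first exact: lipschitz_ball_compact.
exact: exp_le_closed.
Qed.

Lemma band_closed M L psi : closed (band M L psi).
Proof. by apply: compact_closed; [exact: norm_hausdorff|exact: band_compact]. Qed.

Lemma band_cone M L psi : exp_cone B psi -> band M L psi `<=` exp_cone B.
Proof.
by move=> psi0 f [_ H]; rewrite -exp_le0; apply: exp_le_trans H; rewrite exp_le0.
Qed.

Lemma semiorbit_band w (phi : Lipseg r m) psi M : exp_cone B (L_C phi) ->
  (forall t, 0 <= t -> `|solC t w phi| <= M) ->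
  (forall t, 0 <= t -> exp_le B psi (solC t w phi)) ->
  exists L, forall t, 0 <= t -> band M L psi (solC t w phi).
Proof.
move=> phi0 HM Hpsi; have [C C0 HC] := F_boundedE F_bounded M.
exists (Num.max `|phi| C) => t t0; split; last exact: Hpsi.
split; first exact: HM.
by apply: (solC_lipschitz phi0 t0) => u /andP[u0 _]; apply: HC; exact: HM.
Qed.

(* By compactness of the band, that no such phi exists is an open condition on
   w; the orbit of w0 is dense and never satisfies it. *)
Lemma companion w0 (phi0 : Lipseg r m) psi M L w : exp_cone B psi ->
  (forall t, 0 <= t -> band M L psi (solC t w0 phi0)) -> exp_cone B (L_C phi0) ->
  exists2 phi, band M L psi phi & forall t, 0 <= t -> band M L psi (solC t w phi).
Proof.
move=> psi0 H phi00; apply: contrapT => Hno.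
have Hno' phi : band M L psi phi -> exists2 t, 0 <= t & ~ band M L psi (solC t w phi).
  move=> Hphi; apply: contrapT => Hall; apply: Hno.
  exists phi; [exact: Hphi|move=> t t0; apply: contrapT => Ht; apply: Hall].
  by exists t; [exact: t0|exact: Ht].
have /compact_near_coveringP K := @band_compact M L psi.
have : \forall w' \near w, band M L psi `<=` (fun phi =>
    band M L psi phi -> ~ forall t, 0 <= t -> band M L psi (solC t w' phi)).
  apply: K => phi Kphi; have [t t0 Ht] := Hno' phi Kphi.
  have phi_cone := band_cone psi0 Kphi.
  have : nbhs (solC t w phi) (~` band M L psi).
    apply: open_nbhs_nbhs; split; last exact: Ht.
    by apply: closed_openC; exact: band_closed.
  move=> /nbhs_normE[d d0 Hd]; have d3 : 0 < d / 3 by exact: divr_gt0.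
  have [dd _] := thirds_lt d0.
  have [[U P] /= [Uw Pphi] UP] := solC_near w phi_cone t0 d3.
  apply: (near_prodP Pphi Uw) => phi' w' Pphi' Uw' Kphi' /(_ t t0); apply: Hd.
  have := UP (w', phi') (conj Uw' Pphi') (band_cone psi0 Kphi') t.
  rewrite t0 lexx => /(_ isT); rewrite distrC => H'.
  exact: le_lt_trans H' dd.
move=> Hw.
have [t t0 Ht] := proj1 (cluster_lateP _ _) (@forward_orbit_dense w0 w) _ Hw 0.
have Kt := H t t0; apply: (Ht _ Kt Kt) => u u0.
rewrite (solC_semigroup w0 phi00 t0 u0); apply: H; exact: addr_ge0.
Qed.

Lemma exp_pos_dominates_cone (f g : Lipseg r m) : exp_pos B f ->
  exists2 a : R, 1 <= a & exp_le B (L_C g) (a *: L_C f).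
Proof.
move=> fpos; have [K K0 HK] := exp_pos_dominates fpos.
(* Adding 1 secures a >= 1, as the superlinear estimate requires. *)
have [H _] := HK g; exists (K * `|g| + 1); first by rewrite lerDr mulr_ge0// ltW.
apply: exp_le_trans H _; rewrite /exp_le scalerDl scale1r addrC addKr.
exact: exp_pos_cone.
Qed.

(** Componentwise, phi - psi lies between -a phi and a phi. *)
Lemma order_sandwich (phi psi : Cseg r m) (a : R) : 0 <= a -> exp_cone B phi ->
  exp_le B ((1 - a) *: phi) psi -> exp_le B psi ((1 + a) *: phi) ->
  `|phi - psi| <= a * `|phi|.
Proof.
move=> a0 [phi0 _] [H1 _] [H2 _].
apply: Cnorm_le => [|s rs]; first by rewrite mulr_ge0.
have rs' : `[- r, 0]%classic s by rewrite /= in_itv.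
apply: norm_le_coord => [|i]; first by rewrite mulr_ge0.
have := H1 s rs' i; have := H2 s rs' i; have := phi0 s rs' i; have := le_Cnorm phi s.
rewrite !CB !CZ !mxE => Hn phii H2' H1'.
have phin : phi s i ord0 <= `|phi|.
  by rewrite (le_trans _ Hn)// (le_trans (ler_norm _))// coord_le_norm.
have aphi : a * phi s i ord0 <= a * `|phi| by rewrite ler_wpM2l.
rewrite ler_norml; move: H1' H2' aphi; rewrite !mulrDl !mul1r mulNr.
by move=> *; apply/andP; split; lra.
Qed.

(** * Trapping of strongly positive semiorbits and uniform stability *)

Context (bounded_positive : exists (w0 : Omega) (phi0 : Lipseg r m),
  [/\ exp_pos B phi0,
    bounded_set [set solC t w0 phi0 | t in [set t | 0 <= t]] &
    exists2 psi0 : Lipseg r m, exp_pos B psi0 &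
      forall t, 0 <= t -> exp_le B psi0 (solC t w0 phi0)]).

(* The companion of (w0, phi0) over w traps every strongly positive semiorbit
   over w between two of its multiples. *)
Lemma semiorbit_trapped w (phi : Lipseg r m) : exp_pos B phi ->
  exists (M L : R) (psi : Lipseg r m), exp_pos B psi /\
    forall t, 0 <= t -> band M L psi (solC t w phi).
Proof.
move=> phipos; have phi_cone := exp_pos_cone phipos.
have [w0 [phi0 [phi0pos phi0bd [psi0 psi0pos Hpsi0]]]] := bounded_positive.
have [M0 HM0] : exists M, forall t, 0 <= t -> `|solC t w0 phi0| <= M.
  case: phi0bd => M [_ /(_ (`|M| + 1))].
  rewrite (le_lt_trans (ler_norm _)) ?ltrDl// => /(_ isT) H.
  by exists (`|M| + 1) => t t0; apply: H; exists t.
have phi0_cone := exp_pos_cone phi0pos; have psi0_cone := exp_pos_cone psi0pos.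
have [L0 HL0] := semiorbit_band phi0_cone HM0 Hpsi0.
have [chi Kchi Hchi] := companion w psi0_cone HL0 phi0_cone.
have chi_cone := band_cone psi0_cone Kchi.
have chiE : L_C (toL chi) = chi by case: Kchi => -[_ H] _; exact: toLK H.
have chipos : exp_pos B (toL chi).
  by apply: (exp_pos_ge psi0pos); rewrite chiE; case: Kchi.
(* Now phi <= a chi and chi <= b phi. Superlinearity at a bounds the semiorbit of phi above by a
   times that of chi; sublinearity at 1/b bounds it below by 1/b times that of chi, hence by
   psi0/b. *)
have [a a1 Ha] := exp_pos_dominates_cone phi chipos.
have [b b1 Hb] := exp_pos_dominates_cone (toL chi) phipos.
rewrite chiE in Ha Hb.
have a0 : 0 < a by rewrite (lt_le_trans ltr01).
have b0 : 0 < b by rewrite (lt_le_trans ltr01).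
have bV : b^-1 * b = 1 by exact: mulVf (lt0r_neq0 b0).
have binv : 0 <= b^-1 <= 1 by rewrite invr_ge0 ltW//= invf_le1.
have binv0 : 0 <= b^-1 by rewrite invr_ge0 ltW.
have psi1pos : exp_pos B (b^-1 *: psi0) by apply: exp_posZ; rewrite ?invr_gt0.
have HM t : 0 <= t -> `|solC t w phi| <= a * M0.
  move=> t0; have H1 := solC_mono w t0 phi_cone Ha.
  have H2 := solC_superlin w t0 chi_cone a1.
  apply: le_trans (exp_le_norm (solC_cone w t0 phi_cone) (exp_le_trans H1 H2)) _.
  rewrite normrZ gtr0_norm// ler_pM2l//.
  by case: (Hchi t t0) => -[].
have Hpsi t : 0 <= t -> exp_le B (L_C (b^-1 *: psi0)) (solC t w phi).
  move=> t0; have Hb' : exp_le B (b^-1 *: chi) (L_C phi).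
    have := exp_leZ binv0 Hb.
    by rewrite scalerA bV scale1r; exact.
  have H1 := solC_mono w t0 (exp_coneZ binv0 chi_cone) Hb'.
  have H2 := solC_sublin w t0 chi_cone binv.
  apply: exp_le_trans H1; apply: exp_le_trans H2; rewrite LZ; apply: exp_leZ => //.
  by case: (Hchi t t0).
have [L HL] := semiorbit_band phi_cone HM Hpsi.
by exists (a * M0), L, (b^-1 *: psi0).
Qed.

(* An initial value near y_s lies between (1 - th) y_s and (1 + th) y_s, and
   monotonicity and sublinearity preserve these bounds. *)
Lemma strongly_positive_uniformly_stable w (phi : Lipseg r m) : exp_pos B phi ->
  uniformly_stable sigma F B w phi.
Proof.
move=> phipos e e0; have phi_cone := exp_pos_cone phipos.
have [M [L [psi1 [psi1pos HK]]]] := semiorbit_trapped w phipos.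
have psi1_cone := exp_pos_cone psi1pos.
have [Kd Kd0 HKd] := exp_pos_dominates psi1pos.
have e3 : 0 < e / 3 by rewrite divr_gt0.
have [ee ee'] := thirds_lt e0.
have [d1 d10 Hd1] := F_modulus (@band_compact M L psi1) e3.
have M0 : 0 <= M by case: (HK 0 (lexx _)) => -[+ _] _; apply: le_trans.
have M1 : 0 < M + 1 by rewrite ltr_wpDl.
(* In the sup-norm the orbits stay within th M. This has to be below the modulus d1, so that the
   right-hand sides differ by at most e/3, and below e/3; the X_L distance is then at most 2e/3. The
   minimum with 1 keeps 1 - th nonnegative. *)
pose th := Num.min 1 (Num.min (d1 / 2) (e / 3) / (M + 1)).
have min0 : 0 < Num.min (d1 / 2) (e / 3) by rewrite lt_min divr_gt0.
have th0 : 0 < th by rewrite lt_min ltr01 divr_gt0.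
have th1 : th <= 1 by rewrite ge_min lexx.
have thM : th * M <= Num.min (d1 / 2) (e / 3).
  rewrite (@le_trans _ _ (th * (M + 1)))//; first by rewrite ler_pM2l// lerDl.
  by rewrite -ler_pdivlMr// ge_min lexx orbT.
have thMd : th * M < d1.
  apply: le_lt_trans thM _; rewrite gt_min; apply/orP; left.
  by rewrite ltr_pdivrMr// ltr_pMr// ltr1n.
have thMe : th * M <= e / 3 by apply: le_trans thM _; rewrite ge_min lexx orbT.
(* The bound th/Kd puts psi between (1 - th) y_s and (1 + th) y_s; the bound e/3 controls the part
   of the initial segment still present in the histories before time r. *)
exists (Num.min (e / 3) (th / Kd)); first by rewrite lt_min e3 divr_gt0.
move=> s psi s0 psipos; rewrite lt_min => /andP[hpsi1 hpsi2] t t0.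
have psi_cone := exp_pos_cone psipos.
set base := solL sigma F s w phi in hpsi1 hpsi2 *.
have baseE : L_C base = solC s w phi by exact: solLE.
have base_cone : exp_cone B (L_C base) by rewrite baseE; exact: solC_cone.
have Ksd : Kd * `|psi - base| <= th.
  rewrite mulrC -(ler_pdivlMr _ _ Kd0) distrC; exact: ltW.
have [H1 H2] := HKd (psi - base).
have le_base : exp_le B (L_C psi1) (L_C base).
  by rewrite baseE; case: (HK s s0).
have th_base : exp_le B ((Kd * `|psi - base|) *: L_C psi1) (th *: L_C base).
  apply: (@exp_le_trans _ _ _ _ _ (th *: L_C psi1)).
    by rewrite /exp_le -scalerBl; apply: exp_coneZ => //; rewrite subr_ge0.
  by apply: exp_leZ => //; exact: ltW.
have up : exp_le B (L_C psi) ((1 + th) *: L_C base).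
  have := exp_le_trans H1 th_base; rewrite /exp_le LB opprB addrA.
  by rewrite scalerDl scale1r [_ + th *: _]addrC.
have low : exp_le B ((1 - th) *: L_C base) (L_C psi).
  have th_base' : exp_le B (- (th *: L_C base)) (- ((Kd * `|psi - base|) *: L_C psi1)).
    by move: th_base; rewrite /exp_le opprK addrC.
  have := exp_le_trans th_base' H2; rewrite /exp_le LB opprK.
  by rewrite scalerBl scale1r opprB addrA addrAC.
have thle : 0 <= 1 - th <= 1 by rewrite subr_ge0 th1 gerBl ltW.
have th1' : 1 <= 1 + th by rewrite lerDl ltW.
have close u : 0 <= u ->
    `|solC u (sigma s w) base - solC u (sigma s w) psi| <= th * M.
  move=> u0; have base_u := solC_cone (sigma s w) u0 base_cone.
  have Hup := exp_le_trans (solC_mono (sigma s w) u0 psi_cone up)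
    (solC_superlin (sigma s w) u0 base_cone th1').
  have lowc : exp_cone B ((1 - th) *: L_C base).
    by apply: exp_coneZ => //; case/andP : thle.
  have Hlow := exp_le_trans (solC_sublin (sigma s w) u0 base_cone thle)
    (solC_mono (sigma s w) u0 lowc low).
  apply: le_trans (order_sandwich (ltW th0) base_u Hlow Hup) _.
  rewrite ler_pM2l// baseE solC_semigroup//.
  by case: (HK (s + u) (addr_ge0 s0 u0)) => -[].
have -> : solL sigma F (s + t) w phi = solL sigma F t (sigma s w) base.
  by rewrite /solL baseE solC_semigroup.
apply: le_lt_trans ee'; apply: solL_dist => //; first exact: ltW.
- move=> u /andP[u0 _]; apply: Hd1; last exact: le_lt_trans (close u u0) thMd.
  rewrite baseE (solC_semigroup w phi_cone s0 u0); exact: (HK _ (addr_ge0 s0 u0)).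
- exact: le_trans (close t t0) thMe.
Qed.

(** * Continuity of [tau] at time-r images and compactness in X_L *)

Lemma solL_solC_r w phi s t : exp_cone B phi -> 0 <= s -> 0 <= t -> r <= s ->
  solL sigma F t (sigma s w) (toL (solC s w phi)) = toL (solC (s + t) w phi).
Proof.
move=> phi0 s0 t0 rs; rewrite /solL (toL_solCE w phi0 rs).
by rewrite (solC_semigroup w phi0 s0 t0).
Qed.

Lemma tau_semigroup s t w (phi : Lipseg r m) : exp_cone B (L_C phi) -> 0 <= s -> 0 <= t ->
  tau sigma F t (tau sigma F s (w, phi)) = tau sigma F (s + t) (w, phi).
Proof.
move=> phi0 s0 t0; have [_ _ sD] := sigma_flow.
rewrite /tau /= sD; congr pair; rewrite {1}/solL (solLE w phi0 s0).
by rewrite (solC_semigroup w phi0 s0 t0).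
Qed.

(** The distance is split at [tau sigma F t' p]: between t and t' the orbit of p is continuous in
    X_L because p is already a time-r image, and between p and p' dependence on initial data is
    uniform on [0, t + 1]. *)
Lemma tau_continuous w phi t : exp_cone B phi -> 0 <= t ->
  let p := (sigma r w, toL (solC r w phi)) in
  forall V, nbhs (tau sigma F t p) V -> \forall t' \near t & p' \near p,
    0 <= t' -> exp_cone B (L_C p'.2) -> V (tau sigma F t' p').
Proof.
move=> phi0 t0 p V [[A P] /= [Ap /nbhs_normE[d d0 HP]] AP].
have d3 : 0 < d / 3 by exact: divr_gt0.
have [_ dd] := thirds_lt d0.
have [[I W] /= [It Wp] IW] := flow_continuous sigma_flow Ap.
have r0' := ltW r0.
have pE : L_C p.2 = solC r w phi by exact: (toL_solCE w phi0 (lexx r)).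
have p0 : exp_cone B (L_C p.2) by rewrite pE; exact: (solC_cone w r0' phi0).
have t10 : 0 <= t + 1 by exact: addr_ge0.
have [[U Q] /= [Up Qp] UQ] := solL_near (sigma r w) p0 t10 d3.
have rrt : r <= r + t by rewrite lerDl.
have time := toL_solC_time_continuous w phi0 rrt d3.
have time' : \forall t' \near t, r <= r + t' ->
    `|toL (solC (r + t) w phi) - toL (solC (r + t') w phi)| <= d / 3.
  have c : (fun u => r + u) t' @[t' --> t] --> r + t.
    by apply: cvgD; [exact: cvg_cst|exact: cvg_id].
  exact: c time.
have near1 : \forall t' \near t, t' <= t + 1.
  have tt1 : t < t + 1 by rewrite ltrDl ltr01.
  by apply: filterS (lt_nbhsl tt1) => u; exact: ltW.
have pWU : nbhs p [set q | (W q.1 /\ U q.1) /\ Q q.2].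
  by exists (W `&` U, Q); [split; [exact: filterI|exact: Qp]|move=> q []].
apply: (near_prodP (filterI It (filterI time' near1)) pWU).
move=> t' [w' phi'] [It' [Ht' t'1]] [[/= Ww' Uw'] Qphi'] t'0 phi'0.
apply: AP; split; first exact: (IW (t', w') (conj It' Ww')).
apply: HP; apply: le_lt_trans dd.
rewrite -(subrKA (solL sigma F t' p.1 p.2)); apply: le_trans (ler_normD _ _) _.
apply: lerD.
  rewrite (solL_solC_r w phi0 r0' t0 (lexx r)) (solL_solC_r w phi0 r0' t'0 (lexx r)).
  by apply: Ht'; rewrite lerDl.
by apply: (UQ (w', phi') (conj Uw' Qphi') phi'0); rewrite t'0.
Qed.

(** Bands are compact for the sup-norm only; their images under the time-r map are compact in Omega
    x X_L and contain the trapped semiorbits from time r on. *)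
Definition smoothed (M L : R) psi : set (Omega * Lipseg r m) :=
  [set (sigma r p.1, toL (solC r p.1 p.2)) | p in [set: Omega] `*` band M L psi].

Lemma smoothed_compact M L psi : exp_cone B psi -> compact (smoothed M L psi).
Proof.
move=> psi0; apply: continuous_compact; last first.
  exact: compact_setX Omega_compact (@band_compact M L psi).
apply/subspace_continuousP => -[w phi] [_ Kphi] V /= [[A P] /= [Aw /nbhs_normE[d d0 HP]] AP].
have phi0 : exp_cone B phi := band_cone psi0 Kphi.
have d3 : 0 < d / 3 by exact: divr_gt0.
have [dd _] := thirds_lt d0.
have [[I W] /= [Ir Ww] IW] := flow_continuous sigma_flow Aw.
have [[U Q] /= [Uw Qphi] UQ] := toL_solC_near w phi0 (ltW r0) d3.
exists (W `&` U, Q); first by split; [exact: filterI|exact: Qphi].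
move=> [w' phi'] [[/= Ww' Uw'] Qphi'] [_ Kphi'].
apply: AP; split; first exact: (IW (r, w') (conj (nbhs_singleton Ir) Ww')).
apply: HP; apply: le_lt_trans dd.
by apply: (UQ (w', phi') (conj Uw' Qphi') (band_cone psi0 Kphi')); rewrite !lexx.
Qed.

Let hausdorff_OL : hausdorff_space (Omega * Lipseg r m)%type.
Proof. by apply: hausdorff_prod; [exact: metric_hausdorff|exact: norm_hausdorff]. Qed.

Lemma smoothed_closed M L psi : exp_cone B psi -> closed (smoothed M L psi).
Proof.
by move=> psi0; apply: compact_closed; [exact: hausdorff_OL|exact: smoothed_compact].
Qed.

Lemma semiorbit_smoothed M L psi w (phi : Lipseg r m) : exp_cone B (L_C phi) ->
  (forall t, 0 <= t -> band M L psi (solC t w phi)) ->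
  forall t, r <= t -> smoothed M L psi (tau sigma F t (w, phi)).
Proof.
move=> phi0 HK t rt; have [_ _ sD] := sigma_flow.
have tr : 0 <= t - r by rewrite subr_ge0.
exists (sigma (t - r) w, solC (t - r) w phi); first by split; [exact: I|exact: HK].
by rewrite /= (solC_semigroup w phi0 tr (ltW r0)) -sD subrK.
Qed.

Lemma strongly_positive_relatively_compact w (phi : Lipseg r m) : exp_pos B phi ->
  relatively_compact_semiorbit sigma F w phi.
Proof.
move=> phipos; have phi0 := exp_pos_cone phipos.
have [M [L [psi [psipos HK]]]] := semiorbit_trapped w phipos.
have psi0 := exp_pos_cone psipos.
split; first by move=> t t0; exact: solLE.
- exists ([set: Omega] `*` band M L psi).
    by move=> _ [t t0 <-]; split; [exact: I|exact: HK].
  have c := compact_setX Omega_compact (@band_compact M L psi).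
  split; first exact: c.
  by apply: compact_closed c; apply: hausdorff_prod; [exact: metric_hausdorff|exact: norm_hausdorff].
- exists (smoothed M L psi).
    by move=> _ [t rt <-]; exact: (semiorbit_smoothed phi0 HK).
  by split; [exact: smoothed_compact|exact: smoothed_closed].
Qed.

(** * The omega-limit set *)

Lemma omega_limit_cluster w (phi : Lipseg r m) :
  omega_limit sigma F w phi = cluster (late (fun t => tau sigma F t (w, phi))).
Proof.
apply/seteqP; split=> p.
  move=> [u [_ _ uoo up]]; apply/cluster_lateP => V pV T0.
  have /cvgryPge/(_ T0) H := uoo.
  have [n [Hn1 Hn2]] := filter_ex (filterI H (up _ pV)).
  by exists (u n).
move=> /cluster_lateP H.
have /choice[g Hg] : forall q : nat * R, exists u : R,
    q.2 + 1 <= u /\ ball p q.1.+1%:R^-1 (tau sigma F u (w, phi)).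
  move=> [n t] /=; have e0 : 0 < n.+1%:R^-1 :> R by rewrite invr_gt0.
  by have [u tu pu] := H _ (nbhsx_ballx p _ e0) (t + 1); exists u.
(* Each time exceeds the previous one by at least 1, so the sequence increases to infinity, while
   [u n] brings the orbit within 1/(n + 1) of p. *)
pose u := fix u n := if n is k.+1 then g (k.+1, u k) else g (0%N, 0).
have uS n : u n + 1 <= u n.+1 by case: (Hg (n.+1, u n)).
have un n : n%:R <= u n.
  elim: n => [|n IH]; last by rewrite -natr1; apply: le_trans (uS n); rewrite lerD2r.
  by case: (Hg (0%N, 0)) => /= + _; apply: le_trans; rewrite add0r ler01.
exists u; split.
- by move=> n; apply: le_trans (un n); exact: ler0n.
- by apply/nondecreasing_seqP => n; apply: le_trans (uS n); rewrite lerDl ler01.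
- apply/cvgryPge => A; apply: filterS (nbhs_infty_ger A) => n /= An.
  exact: le_trans An (un n).
- apply/cvg_ballP => e e0.
  apply: filterS (near_infty_natSinv_lt (PosNum e0)) => n /= ne.
  apply: (le_ball (ltW ne)).
  by case: n {ne} => [|n]; [case: (Hg (0%N, 0))|case: (Hg (n.+1, u n))].
Qed.

Section omega_limit_set.
Context {w : Omega} {phi psi : Lipseg r m} {M L : R}.
Context (phi_cone : exp_cone B (L_C phi)) (psi_pos : exp_pos B psi).
Context (trapped : forall t, 0 <= t -> band M L psi (solC t w phi)).
Local Notation O := (omega_limit sigma F w phi).

Let psi_cone := exp_pos_cone psi_pos.

Lemma omega_limit_smoothed : O `<=` smoothed M L psi.
Proof.
rewrite omega_limit_cluster; apply: cluster_late_sub; first exact: smoothed_closed.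
by exists r; exact: semiorbit_smoothed.
Qed.

Lemma omega_limit_compact : compact O.
Proof.
apply: subclosed_compact omega_limit_smoothed; last exact: smoothed_compact.
by rewrite omega_limit_cluster; exact: cluster_closed.
Qed.

(** The lower bound along the semiorbit is a closed condition, already for the sup-norm, so it
    passes to limits; strong positivity is then inherited from psi. *)
Lemma omega_limit_ge p : O p -> exp_le B (L_C psi) (L_C p.2).
Proof.
move: p; change (O `<=` (fun p => L_C p.2) @^-1` [set f : Cseg r m | exp_le B (L_C psi) f]).
rewrite omega_limit_cluster; apply: cluster_late_sub.
  apply: preimage_closed; last exact: exp_le_closed.
  move=> p _; apply: (@continuous_comp _ _ _ snd (@L_C R r m)); first exact: cvg_snd.
  exact: L_C_continuous.
by exists 0 => t t0 /=; rewrite (solLE w phi_cone t0); case: (trapped t0).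
Qed.

Lemma omega_limit_strongly_positive : strongly_positive B O.
Proof.
split; first exact: omega_limit_compact.
by move=> p Op; split; [exact: I|exact: exp_pos_ge (omega_limit_ge Op)].
Qed.

Lemma omega_limit_cone p : O p -> exp_cone B (L_C p.2).
Proof. by move=> Op; exact: exp_pos_cone (exp_pos_ge psi_pos (omega_limit_ge Op)). Qed.

(** Every limit point is a time-r image. The points p' range over the cone and not just over the
    limit set, because invariance is proved by comparison with points of the semiorbit itself. *)
Lemma omega_limit_near t p : 0 <= t -> O p ->
  forall V, nbhs (tau sigma F t p) V -> \forall t' \near t & p' \near p,
    0 <= t' -> exp_cone B (L_C p'.2) -> V (tau sigma F t' p').
Proof.
move=> t0 /omega_limit_smoothed[[v chi] [_ Kchi] <-].
have chi0 : exp_cone B chi := band_cone psi_cone Kchi.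
exact: (@tau_continuous v chi t chi0 t0).
Qed.

Lemma omega_limit_continuous :
  {within [set q : R * (Omega * Lipseg r m) | 0 <= q.1 /\ O q.2],
    continuous (fun q => tau sigma F q.1 q.2)}.
Proof.
apply/subspace_continuousP => -[t p] [/= t0 Op] V /(omega_limit_near t0 Op).
apply: filterS => -[t' p'] /= H [t'0 Op'].
exact: H t'0 (omega_limit_cone Op').
Qed.

(** Forward invariance is continuity of [tau] at limit points. For the converse, if p is the limit
    along times u_n, compactness of [smoothed] gives a cluster point q along u_n - t, and continuity
    sends q to p. *)
Lemma omega_limit_invariant t : 0 <= t -> tau sigma F t @` O = O.
Proof.
move=> t0; apply/seteqP; split=> [_ [p Op <-]|p].
  rewrite omega_limit_cluster; apply/cluster_lateP => V /(omega_limit_near t0 Op).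
  move=> [[I W] /= [It Wp] IW] T0.
  have := Op; rewrite omega_limit_cluster => /cluster_lateP/(_ W Wp (Num.max 0 (T0 - t))).
  move=> [s]; rewrite ge_max => /andP[s0 sT] Ws; exists (s + t).
    by rewrite -lerBlDr.
  rewrite -(tau_semigroup w phi_cone s0 t0).
  apply: (IW (t, _) (conj (nbhs_singleton It) Ws) t0).
  by rewrite /= (solLE w phi_cone s0); exact: (solC_cone w s0 phi_cone).
move=> [u [_ _ uoo up]].
have late_u T0 : \forall n \near \oo, T0 <= u n - t.
  by have /cvgryPge/(_ (T0 + t)) := uoo; apply: filterS => n; rewrite lerBrDr.
pose x s := tau sigma F s (w, phi).
have [|q [_ Hq]] := @smoothed_compact M L psi psi_cone ((fun n => x (u n - t)) @ \oo) _.
  by apply: filterS (late_u r) => n; exact: semiorbit_smoothed.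
have Oq : O q.
  rewrite omega_limit_cluster; apply/cluster_lateP => V qV T0.
  have H : ((fun n => x (u n - t)) @ \oo) (x @` [set s | T0 <= s]).
    by apply: filterS (late_u T0) => n H; exists (u n - t).
  by have [_ [[s sT <-] Vs]] := Hq _ _ H qV; exists s.
exists q; first exact: Oq.
(* Instead of extracting a subsequence, it is shown that every neighbourhood of the image of q meets
   every neighbourhood of p, at a point [x (s + t)] with [x s] near q. *)
apply: hausdorff_OL => A P /(omega_limit_near t0 Oq)[[I W] /= [It Wq] IW] Pp.
have H : ((fun n => x (u n - t)) @ \oo) (x @` [set s | 0 <= s /\ P (x (s + t))]).
  apply: filterS (filterI (late_u 0) (up _ Pp)) => n [H Pn].
  by exists (u n - t) => //; split; [exact: H|rewrite subrK; exact: Pn].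
have [_ [[s [s0 Ps] <-] Ws]] := Hq _ _ H Wq.
exists (x (s + t)); split; last exact: Ps.
rewrite /x -(tau_semigroup w phi_cone s0 t0).
apply: (IW (t, _) (conj (nbhs_singleton It) Ws) t0).
by rewrite /= (solLE w phi_cone s0); exact: (solC_cone w s0 phi_cone).
Qed.

End omega_limit_set.

Lemma strongly_positive_semiorbit w (phi : Lipseg r m) : exp_pos B phi ->
  [/\ relatively_compact_semiorbit sigma F w phi,
      uniformly_stable sigma F B w phi,
      strongly_positive B (omega_limit sigma F w phi),
      forall t, 0 <= t ->
        tau sigma F t @` omega_limit sigma F w phi = omega_limit sigma F w phi &
      {within [set q : R * (Omega * Lipseg r m) |
                 0 <= q.1 /\ omega_limit sigma F w phi q.2],
         continuous (fun q => tau sigma F q.1 q.2)}].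
Proof.
move=> phipos; have phi0 := exp_pos_cone phipos.
have [M [L [psi [psipos HK]]]] := semiorbit_trapped w phipos.
split.
- exact: strongly_positive_relatively_compact.
- exact: strongly_positive_uniformly_stable.
- exact: (omega_limit_strongly_positive phi0 psipos HK).
- exact: (omega_limit_invariant phi0 psipos HK).
- exact: (omega_limit_continuous phi0 psipos HK).
Qed.

End semiflow.

Theorem proposition3p2 (R : realType) (Omega : metricType R)
    (sigma : R -> Omega -> Omega) (r : R) (m : nat) (B : 'M[R]_m)
    (F : Omega -> Cseg r m -> 'cV[R]_m) :
  compact [set: Omega] -> continuous_flow sigma -> minimal_flow sigma ->
  0 < r -> (0 < m)%N -> quasipositive B ->
  continuous (fun p : Omega * Cseg r m => F p.1 p.2) ->
  C1_second F ->
  (forall X1 : set (Cseg r m), bounded_set X1 ->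
    bounded_set [set F w phi | w in [set: Omega] & phi in X1]) ->
  (forall w phi psi, exp_le B phi psi ->
    vle (B *m (psi 0 - phi 0)) (F w psi - F w phi)) ->
  (forall w psi (lambda : R), exp_le B 0 psi -> 0 <= lambda <= 1 ->
    vle (lambda *: F w psi) (F w (lambda *: psi))) ->
  (exists (w0 : Omega) (phi0 : Lipseg r m),
    [/\ exp_pos B phi0,
        bounded_set [set solC sigma F t w0 phi0 | t in [set t | 0 <= t]] &
        exists2 psi0 : Lipseg r m, exp_pos B psi0 &
          forall t, 0 <= t -> exp_le B psi0 (solC sigma F t w0 phi0)]) ->
  (forall w phi, exp_cone B phi -> globally_solvable sigma F w phi) /\
  forall w (phi : Lipseg r m), exp_pos B phi ->
    [/\ relatively_compact_semiorbit sigma F w phi,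
        uniformly_stable sigma F B w phi,
        strongly_positive B (omega_limit sigma F w phi),
        forall t, 0 <= t ->
          tau sigma F t @` omega_limit sigma F w phi
          = omega_limit sigma F w phi &
        {within [set q : R * (Omega * Lipseg r m) |
                   0 <= q.1 /\ omega_limit sigma F w phi q.2],
           continuous (fun q => tau sigma F q.1 q.2)}].
Proof.
move=> Omega_compact sigma_flow sigma_minimal r0 _ qB F_continuous F_C1 F_bounded F_mono
  F_sublin bounded_positive; split=> [w phi|w phi phi_pos].
  exact: (cone_globally_solvable r0 sigma_flow F_continuous F_C1 qB F_bounded F_mono
    F_sublin).
exact: (strongly_positive_semiorbit r0 sigma_flow F_continuous F_C1 qB F_bounded F_mono
  F_sublin Omega_compact sigma_minimal bounded_positive w phi_pos).
Qed.
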